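(* Let $\Gamma\subseteq\mathrm{SL}_2(\mathbb Z)$ be a congruence subgroup and let $f(z)=\sum_{n\ge1}a(n)e(nz)$ and $g(z)=\sum_{n\ge1}b(n)e(nz)$ be holomorphic cusp forms of weight $k>2$, $k\in\mathbb Z\cup(\mathbb Z+\frac12)$, on $\Gamma$, possibly with a nebentypus $\chi$ if $\Gamma=\Gamma_0(N)$. Then \[ \operatorname{Res}_{s=1}\sum_{n\ge1}\frac{a(n)\overline{b(n)}}{n^{s+k-1}}=-\operatorname{Res}_{s=1}\sum_{n,h\ge1}\frac{a(n)\overline{b(n-h)}+a(n-h)\overline{b(n)}}{n^{s+k-1}}, \] where both Dirichlet series are understood via their meromorphic continuations to a neighbourhood of $s=1$.
   Context: $e(z)=e^{2\pi i z}$, and $a(n)=b(n)=0$ for $n\le0$. *)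

(* Defs.v *)
From Stdlib Require Import Reals ZArith List.
From Coquelicot Require Import Coquelicot.
From mathcomp Require prime.

Open Scope R_scope.

(** * Complex functions *)

Definition Cexp (z : C) : C :=
  (RtoC (exp (Re z)) * (cos (Im z), sin (Im z)))%C.

Definition e (z : C) : C := Cexp (2 * PI * Ci * z)%C.

(* n^w for a positive integer n; junk for n <= 0. *)
Definition Zcpow (n : Z) (w : C) : C := Cexp (w * ln (IZR n))%C.

(* The principal square root: argument in (-pi/2, pi/2]. *)
Definition Csqrt (z : C) : C :=
  (sqrt ((Cmod z + Re z) / 2),
   (if Rle_dec 0 (Im z) then 1 else -1) * sqrt ((Cmod z - Re z) / 2)).

Definition holomorphic_at (f : C -> C) (s0 : C) : Prop :=
  locally s0 (fun s : C => ex_derive (K := C_AbsRing) (V := C_NormedModule) f s).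

(* F has an isolated singularity at s0 whose principal part is
   sum_(0 <= j <= m) c j / (s - s0)^(j+1).  The value F s0 is irrelevant. *)
Definition principal_part (F : C -> C) (s0 : C) (m : nat) (c : nat -> C) : Prop :=
  exists h : C -> C, holomorphic_at h s0 /\
    locally' s0 (fun s : C =>
      F s = (sum_n (fun j => c j / (s - s0) ^ (S j)) m + h s)%C).

Definition meromorphic_at (F : C -> C) (s0 : C) : Prop :=
  exists m c, principal_part F s0 m c.

Definition is_residue (F : C -> C) (s0 r : C) : Prop :=
  exists m c, principal_part F s0 m c /\ c 0%nat = r.

(* [sum_at s v] reads "the series converges at s, with sum v".  F continues the
   sum meromorphically from a half-plane Re s > sigma to an open set containing
   the half-plane Re s > 1 and the point 1, so the germ of F at 1 is determined
   by the series. *)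
Definition meromorphic_continuation (sum_at : C -> C -> Prop) (F : C -> C) : Prop :=
  exists U : C -> Prop,
    open U /\ U 1 /\ (forall s, 1 < Re s -> U s) /\
    (forall s, U s -> meromorphic_at F s) /\
    exists sigma : R, forall s, sigma < Re s -> sum_at s (F s).

(* Absolutely convergent double series, summed by squares. *)
Definition is_double_series (t : nat -> nat -> C) (l : C) : Prop :=
  (exists M : R, forall n : nat,
      sum_n (fun i => sum_n (fun j => Cmod (t i j)) n) n <= M) /\
  filterlim (fun n => sum_n (fun i => sum_n (t i) n) n) eventually (locally l).

(** * Congruence subgroups of SL_2(Z) *)

Record mat2 : Type := Mat2 { ma : Z; mb : Z; mc : Z; md : Z }.

Definition mat2_mul (x y : mat2) : mat2 :=
  Mat2 (ma x * ma y + mb x * mc y) (ma x * mb y + mb x * md y)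
       (mc x * ma y + md x * mc y) (mc x * mb y + md x * md y).

Definition SL2Z (x : mat2) : Prop := (ma x * md x - mb x * mc x = 1)%Z.

(* the inverse, for x in SL2Z *)
Definition mat2_inv (x : mat2) : mat2 := Mat2 (md x) (- mb x) (- mc x) (ma x).

Definition principal_Gamma (N : Z) (x : mat2) : Prop :=
  SL2Z x /\ (N | ma x - 1)%Z /\ (N | mb x)%Z /\ (N | mc x)%Z /\ (N | md x - 1)%Z.

Definition Gamma0 (N : Z) (x : mat2) : Prop := SL2Z x /\ (N | mc x)%Z.

Definition congruence_subgroup (G : mat2 -> Prop) : Prop :=
  (forall x, G x -> SL2Z x) /\
  G (Mat2 1 0 0 1) /\
  (forall x y, G x -> G y -> G (mat2_mul x y)) /\
  (forall x, G x -> G (mat2_inv x)) /\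
  exists N : Z, (0 < N)%Z /\ forall x, principal_Gamma N x -> G x.

Definition dirichlet_character (N : Z) (chi : Z -> C) : Prop :=
  (forall m n, chi (m * n)%Z = (chi m * chi n)%C) /\
  (forall n, chi (n + N)%Z = chi n) /\
  (forall n, chi n <> 0 <-> Z.gcd n N = 1%Z).

Definition nebentypus (G : mat2 -> Prop) (chi : Z -> C) : Prop :=
  (forall n, chi n = 1) \/
  (exists N : Z, (0 < N)%Z /\ (forall x, G x <-> Gamma0 N x) /\
     dirichlet_character N chi).

(** * Automorphy factors *)

Definition legendre (c : Z) (p : nat) : Z :=
  if (c mod Z.of_nat p =? 0)%Z then 0%Z
  else if existsb (fun x => ((Z.of_nat x * Z.of_nat x - c) mod Z.of_nat p =? 0)%Z)
                  (seq 1 (p - 1))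
       then 1%Z else (-1)%Z.

(* Jacobi symbol, for n odd and positive *)
Definition jacobi (c : Z) (n : nat) : Z :=
  fold_right (fun p acc => (legendre c p ^ Z.of_nat (prime.logn p n) * acc)%Z)
             1%Z (prime.primes n).

(* Shimura's extension of (c/d) to negative odd d *)
Definition shimura_symbol (c d : Z) : Z :=
  if andb (c <? 0)%Z (d <? 0)%Z then (- jacobi c (Z.abs_nat d))%Z
  else jacobi c (Z.abs_nat d).

Definition eps (d : Z) : C := if (d mod 4 =? 1)%Z then 1 else Ci.

Definition mobius (x : mat2) (z : C) : C :=
  ((IZR (ma x) * z + IZR (mb x)) / (IZR (mc x) * z + IZR (md x)))%C.

Definition denom (x : mat2) (z : C) : C := (IZR (mc x) * z + IZR (md x))%C.

(* j(x, z) = theta(x z) / theta(z) for x in Gamma0(4) and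
   theta(z) = sum_n e(n^2 z) *)
Definition theta_factor (x : mat2) (z : C) : C :=
  (/ eps (md x) * IZR (shimura_symbol (mc x) (md x)) * Csqrt (denom x z))%C.

(* In weight kappa / 2: (c z + d)^(kappa / 2) in integral weight, and
   j(x, z)^kappa in half-integral weight. *)
Definition automorphy_factor (kappa : nat) (x : mat2) (z : C) : C :=
  if Nat.even kappa then (denom x z ^ (Nat.div2 kappa))%C
  else (theta_factor x z ^ kappa)%C.

(** * Cusp forms *)

Definition upper_half_plane (z : C) : Prop := 0 < Im z.

(* Slash operator of weight kappa / 2, with the principal branch of
   (c z + d)^(-kappa / 2). *)
Definition slash (kappa : nat) (f : C -> C) (x : mat2) (z : C) : C :=
  (f (mobius x z) / Csqrt (denom x z) ^ kappa)%C.

(* F(z) = sum_(n >= 1) c n e(n z / M) on the upper half-plane *)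
Definition fourier_expansion (M : nat) (F : C -> C) (c : Z -> C) : Prop :=
  forall z, upper_half_plane z ->
    is_series (fun m : nat =>
      let n := Z.of_nat (S m) in (c n * e (IZR n * z / INR M))%C) (F z).

(* In the last clause M is not required to be the width of the cusp: the
   multiplier system takes roots of unity as values, so at an irregular cusp, or
   in half-integral weight, the local expansion is in powers of e(z / M) for
   some multiple M of the width. *)
Definition cusp_form (kappa : nat) (G : mat2 -> Prop) (chi : Z -> C) (f : C -> C)
  : Prop :=
  (forall z, upper_half_plane z -> holomorphic_at f z) /\
  (forall x z, G x -> upper_half_plane z ->
     f (mobius x z) = (chi (md x) * automorphy_factor kappa x z * f z)%C) /\
  (forall x, SL2Z x -> exists (M : nat) (c : Z -> C),
     (0 < M)%nat /\ fourier_expansion M (slash kappa f x) c).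

(* Main.v *)
Require Import Defs.
From Stdlib Require Import Reals ZArith Lra Lia Psatz Classical ClassicalEpsilon.
From Coquelicot Require Import Coquelicot.

(* Write A(n) and B(n) for the partial sums of a and b, c(n) = A(n) conj(B(n)) and
   w = s + k - 1.  For large Re s, summing over h first turns the second series
   into sum_n (a(n) conj(B(n-1)) + A(n-1) conj(b(n))) n^-w, so that the two series
   add up to sum_n (c(n) - c(n-1)) n^-w = H(s) := sum_n c(n) (n^-w - (n+1)^-w).
   The latter converges absolutely for Re s > 1/2, because the second moment of
   A(n) is small: by Parseval, sum_n |A(n)|^2 e^(-4 pi n y) is the integral of
   |f(z) / (1 - e(z))|^2 over |x| <= 1/2, and it is O(y^(-k-1/2)) since
   |f(z)|^2 y^k is bounded and, as f vanishes at the cusp 0, is also O(|z|^2 / y).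
   Hence H is holomorphic at 1.  The meromorphic function D1 + D2 - H vanishes far
   to the right, so by the identity theorem it vanishes near 1.  *)

(** Why the cusp 0 must enter: near $z=0$ the weight $|1-e(z)|^{-2}$ has size $|z|^{-2}$.
    Boundedness of $|f|^2y^k$ alone would bound the second moment by $O(y^{-k-1})$, and $H$ would
    converge only for $\mathrm{Re}\,s>1$, just missing the point. Vanishing at 0 replaces $|z|^{-2}$
    by $(x^2+y)^{-1}$, whose integral is at most $\pi y^{-1/2}$; this half power is the whole
    margin. A dyadic sum over $y=4^{-j}$ turns the moment bound into $\sum|c(n)|n^{-\beta}<\infty$
    for $\beta>k+1/2$, and the difference $n^{-w}-(n+1)^{-w}$ gains one more power of $n$. Part of
    the margin pays for the logarithm in the $w$-derivative, so the half-plane actually used is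
    $\mathrm{Re}\,s>3/4$. Automorphy factors enter only through upper bounds for their moduli, so
    integral and half-integral weights are treated alike. The domain of a continuation is not
    assumed connected: the identity theorem is run along the real ray from $+\infty$ down to 1,
    clearing poles locally. It is derived from Goursat's theorem on rectangles in logarithmic
    coordinates. *)

Lemma Cmod_le_abs_sum (z : C) : Cmod z <= Rabs (Re z) + Rabs (Im z).
Proof.
  replace z with (RtoC (Re z) + Ci * RtoC (Im z))%C at 1
    by (destruct z; apply injective_projections; simpl; ring).
  eapply Rle_trans; [apply Cmod_triangle|].
  rewrite Cmod_mult, !Cmod_R, Cmod_Ci; lra.
Qed.

Lemma im_le_Cmod (z : C) : Rabs (Im z) <= Cmod z.
Proof. eapply Rle_trans; [|apply Rmax_Cmod]; apply Rmax_r. Qed.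

Lemma Cmod_sqr (z : C) : Cmod z * Cmod z = Re z * Re z + Im z * Im z.
Proof. generalize (Cmod2_alt z); simpl; rewrite !Rmult_1_r; auto. Qed.

Lemma Cmod_triangle_sub (x y : C) : Cmod x <= Cmod y + Cmod (x - y).
Proof. replace x with (y + (x - y))%C at 1 by ring; apply Cmod_triangle. Qed.

Lemma Cmod_minus_sym (x y : C) : Cmod (x - y) = Cmod (y - x).
Proof. rewrite <- Cmod_opp; f_equal; ring. Qed.

Lemma Cmod_minus_le (x y : C) : Cmod (x - y) <= Cmod x + Cmod y.
Proof. rewrite <- (Cmod_opp y); apply Cmod_triangle. Qed.

(** * Complex differentiability *)

(** The weak inequality lets [t = s] through without an exception. The derivative stays existential:
    Goursat's theorem uses only that some linear approximation exists. *)
Definition cdiff (f : C -> C) (s : C) : Prop :=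
  exists l : C, forall eps, 0 < eps -> exists del, 0 < del /\
    forall t, Cmod (t - s) < del ->
      Cmod (f t - f s - l * (t - s))%C <= eps * Cmod (t - s).

Lemma ex_derive_cdiff (f : C -> C) (s : C) :
  ex_derive (K := C_AbsRing) (V := C_NormedModule) f s -> cdiff f s.
Proof.
  intros [l [_ H]]; exists l; intros eps Heps.
  destruct (H s (fun P HP => HP) (mkposreal eps Heps)) as [del Hdel].
  exists del; split; [apply cond_pos|]; intros t Ht.
  generalize (Hdel t Ht); simpl.
  replace (f t - f s - l * (t - s))%C with
    (minus (minus (f t) (f s)) (scal (minus t s) l)); [intros K; exact K|].
  unfold minus, plus, opp, scal, mult; simpl; unfold mult; simpl; ring.
Qed.

Lemma cdiff_const (c s : C) : cdiff (fun _ => c) s.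
Proof.
  exists 0; intros eps Heps; exists 1; split; [lra|]; intros t _.
  replace (c - c - 0 * (t - s))%C with (RtoC 0) by ring; rewrite Cmod_0.
  generalize (Cmod_ge_0 (t - s)); nra.
Qed.

Lemma cdiff_id (s : C) : cdiff (fun t => t) s.
Proof.
  exists 1; intros eps Heps; exists 1; split; [lra|]; intros t _.
  replace (t - s - 1 * (t - s))%C with (RtoC 0) by ring; rewrite Cmod_0.
  generalize (Cmod_ge_0 (t - s)); nra.
Qed.

Lemma cdiff_lipschitz (f : C -> C) (s : C) : cdiff f s ->
  exists K del, 0 < K /\ 0 < del /\ forall t, Cmod (t - s) < del ->
    Cmod (f t - f s) <= K * Cmod (t - s).
Proof.
  intros [l H]; destruct (H 1 Rlt_0_1) as [del [Hd Hdel]].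
  exists (Cmod l + 1), del; split; [generalize (Cmod_ge_0 l); lra|].
  split; [exact Hd|]; intros t Ht.
  eapply Rle_trans; [apply (Cmod_triangle_sub _ (l * (t - s))%C)|].
  rewrite Cmod_mult; specialize (Hdel t Ht); lra.
Qed.

Lemma cdiff_continuous (f : C -> C) (s : C) : cdiff f s ->
  forall eps, 0 < eps -> exists del, 0 < del /\
    forall t, Cmod (t - s) < del -> Cmod (f t - f s) < eps.
Proof.
  intros Hf eps Heps; destruct (cdiff_lipschitz f s Hf) as (K & d & HK & Hd & H).
  exists (Rmin d (eps / K)); split.
  - apply Rmin_pos; [exact Hd|]; apply Rdiv_lt_0_compat; assumption.
  - intros t Ht; eapply Rle_lt_trans.
    + apply H; eapply Rlt_le_trans; [exact Ht | apply Rmin_l].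
    + apply Rlt_le_trans with (K * (eps / K)).
      * apply Rmult_lt_compat_l; [exact HK|].
        eapply Rlt_le_trans; [exact Ht | apply Rmin_r].
      * right; field; lra.
Qed.

Lemma cdiff_plus (f g : C -> C) (s : C) :
  cdiff f s -> cdiff g s -> cdiff (fun t => f t + g t)%C s.
Proof.
  intros [l H] [m K]; exists (l + m)%C; intros eps Heps.
  destruct (H (eps / 2)) as (d1 & Hd1 & H1); [lra|].
  destruct (K (eps / 2)) as (d2 & Hd2 & H2); [lra|].
  exists (Rmin d1 d2); split; [apply Rmin_pos; assumption|]; intros t Ht.
  replace (f t + g t - (f s + g s) - (l + m) * (t - s))%C
    with ((f t - f s - l * (t - s)) + (g t - g s - m * (t - s)))%C by ring.
  eapply Rle_trans; [apply Cmod_triangle|].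
  specialize (H1 t (Rlt_le_trans _ _ _ Ht (Rmin_l _ _))).
  specialize (H2 t (Rlt_le_trans _ _ _ Ht (Rmin_r _ _))); lra.
Qed.

Lemma cdiff_comp (f g : C -> C) (s : C) :
  cdiff f (g s) -> cdiff g s -> cdiff (fun t => f (g t)) s.
Proof.
  intros [l H] Hg; destruct (cdiff_lipschitz g s Hg) as (K & d0 & HK & Hd0 & L).
  destruct Hg as [m G]; exists (l * m)%C; intros eps Heps.
  destruct (H (eps / (2 * K))) as (d1 & Hd1 & H1);
    [apply Rdiv_lt_0_compat; lra|].
  assert (Hl : 0 < Cmod l + 1) by (generalize (Cmod_ge_0 l); lra).
  destruct (G (eps / (2 * (Cmod l + 1)))) as (d2 & Hd2 & H2);
    [apply Rdiv_lt_0_compat; lra|].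
  exists (Rmin d0 (Rmin d2 (d1 / K))); split.
  { repeat apply Rmin_pos; auto; apply Rdiv_lt_0_compat; assumption. }
  intros t Ht.
  assert (T0 : Cmod (t - s) < d0) by (eapply Rlt_le_trans; [exact Ht | apply Rmin_l]).
  assert (T1 : Cmod (t - s) < Rmin d2 (d1 / K))
    by (eapply Rlt_le_trans; [exact Ht | apply Rmin_r]).
  assert (T2 : Cmod (t - s) < d2) by (eapply Rlt_le_trans; [exact T1 | apply Rmin_l]).
  assert (T3 : Cmod (t - s) < d1 / K) by (eapply Rlt_le_trans; [exact T1 | apply Rmin_r]).
  specialize (L t T0); specialize (H2 t T2).
  assert (Hg : Cmod (g t - g s) < d1).
  { eapply Rle_lt_trans; [exact L|].
    replace d1 with (K * (d1 / K)) by (field; lra).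
    apply Rmult_lt_compat_l; assumption. }
  specialize (H1 (g t) Hg).
  replace (f (g t) - f (g s) - l * m * (t - s))%C
    with ((f (g t) - f (g s) - l * (g t - g s)) + l * (g t - g s - m * (t - s)))%C by ring.
  eapply Rle_trans; [apply Cmod_triangle|]; rewrite Cmod_mult.
  set (x := Cmod (t - s)) in *.
  assert (Hx : 0 <= x) by apply Cmod_ge_0.
  assert (E1 : eps / (2 * K) * Cmod (g t - g s) <= eps / 2 * x).
  { apply Rle_trans with (eps / (2 * K) * (K * x)).
    - apply Rmult_le_compat_l; [apply Rlt_le, Rdiv_lt_0_compat; lra | exact L].
    - right; field; lra. }
  assert (E2 : Cmod l * Cmod (g t - g s - m * (t - s)) <= eps / 2 * x).
  { apply Rle_trans with ((Cmod l + 1) * (eps / (2 * (Cmod l + 1)) * x)).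
    - apply Rmult_le_compat; try apply Cmod_ge_0; [lra | exact H2].
    - right; field; lra. }
  lra.
Qed.

Lemma cdiff_scal (c : C) (f : C -> C) (s : C) : cdiff f s -> cdiff (fun t => c * f t)%C s.
Proof.
  intros H; apply (cdiff_comp (fun z => c * z)%C f s); [|exact H].
  exists c; intros eps Heps; exists 1; split; [lra|]; intros t _.
  replace (c * t - c * f s - c * (t - f s))%C with (RtoC 0) by ring; rewrite Cmod_0.
  generalize (Cmod_ge_0 (t - f s)); nra.
Qed.

Lemma cdiff_sqr (s : C) : cdiff (fun t => t * t)%C s.
Proof.
  exists (2 * s)%C; intros eps Heps; exists eps; split; [exact Heps|]; intros t Ht.
  replace (t * t - s * s - 2 * s * (t - s))%C with ((t - s) * (t - s))%C by ring.
  rewrite Cmod_mult; apply Rmult_le_compat_r; [apply Cmod_ge_0 | lra].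
Qed.

Lemma cdiff_ext (f g : C -> C) (s : C) : (forall t, f t = g t) -> cdiff f s -> cdiff g s.
Proof.
  intros E [l H]; exists l; intros eps Heps; destruct (H eps Heps) as (d & Hd & K).
  exists d; split; [exact Hd|]; intros t Ht; rewrite <- !E; auto.
Qed.

(* Polarization: 4 f g = (f + g)^2 - (f - g)^2. *)
Lemma cdiff_mult (f g : C -> C) (s : C) :
  cdiff f s -> cdiff g s -> cdiff (fun t => f t * g t)%C s.
Proof.
  intros Hf Hg.
  apply cdiff_ext with (fun t => (/ 4) * ((f t + g t) * (f t + g t)) +
     (- / 4) * ((f t + (-1) * g t) * (f t + (-1) * g t)))%C.
  { intros t. field; intros K; apply RtoC_inj in K; lra. }
  apply cdiff_plus; apply cdiff_scal.
  - apply (cdiff_comp (fun t => t * t)%C (fun t => f t + g t)%C);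
      [apply cdiff_sqr | apply cdiff_plus; assumption].
  - apply (cdiff_comp (fun t => t * t)%C (fun t => f t + (-1) * g t)%C);
      [apply cdiff_sqr | apply cdiff_plus; [|apply cdiff_scal]; assumption].
Qed.

Lemma cdiff_pow (f : C -> C) (s : C) (n : nat) : cdiff f s -> cdiff (fun t => f t ^ n)%C s.
Proof.
  intros H; induction n as [|n IH]; [exact (cdiff_const 1 s)|].
  apply (cdiff_mult f (fun t => f t ^ n)%C); assumption.
Qed.

Lemma cdiff_minus (f g : C -> C) (s : C) :
  cdiff f s -> cdiff g s -> cdiff (fun t => f t - g t)%C s.
Proof.
  intros Hf Hg; apply cdiff_ext with (fun t => f t + (-1) * g t)%C; [intros t; ring|].
  apply cdiff_plus; [exact Hf | apply cdiff_scal; exact Hg].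
Qed.

(** * The exponential *)

Lemma mvt_bound (phi : R -> R) (dphi : R -> R) (a b M : R) : a <= b ->
  (forall t, a <= t <= b -> is_derive phi t (dphi t) /\ Rabs (dphi t) <= M) ->
  Rabs (phi b - phi a) <= M * (b - a).
Proof.
  intros Hab H; destruct (MVT_gen phi a b dphi) as (c & Hc & E).
  - intros x Hx; apply H; rewrite Rmin_left, Rmax_right in Hx; lra.
  - intros x Hx; rewrite Rmin_left, Rmax_right in Hx by lra.
    apply derivable_continuous_pt; exists (dphi x); apply is_derive_Reals, H; lra.
  - rewrite Rmin_left, Rmax_right in Hc by lra; rewrite E, Rabs_mult, (Rabs_right (b - a)) by lra.
    apply Rmult_le_compat_r; [lra | apply H; lra].
Qed.

(** The mean value theorem fails for complex values; applying it to the real and imaginary parts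
    separately costs the factor 2. *)
Lemma mvt_bound_C (phi dphi : R -> C) (a b M : R) : a <= b ->
  (forall t, a <= t <= b -> is_derive (fun u => Re (phi u)) t (Re (dphi t)) /\
     is_derive (fun u => Im (phi u)) t (Im (dphi t)) /\ Cmod (dphi t) <= M) ->
  Cmod (phi b - phi a) <= 2 * M * (b - a).
Proof.
  intros Hab H; eapply Rle_trans; [apply Cmod_le_abs_sum|].
  replace (Re (phi b - phi a)) with (Re (phi b) - Re (phi a)) by reflexivity.
  replace (Im (phi b - phi a)) with (Im (phi b) - Im (phi a)) by reflexivity.
  assert (R1 := mvt_bound (fun u => Re (phi u)) (fun u => Re (dphi u)) a b M Hab).
  assert (R2 := mvt_bound (fun u => Im (phi u)) (fun u => Im (dphi u)) a b M Hab).
  cbv beta in R1, R2.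
  lapply R1; [clear R1; intros R1 | intros t Ht; destruct (H t Ht) as (K1 & K2 & K3);
    split; [exact K1 | eapply Rle_trans; [apply re_le_Cmod | exact K3]]].
  lapply R2; [clear R2; intros R2 | intros t Ht; destruct (H t Ht) as (K1 & K2 & K3);
    split; [exact K2 | eapply Rle_trans; [apply im_le_Cmod | exact K3]]].
  lra.
Qed.

Lemma Re_Cexp (z : C) : Re (Cexp z) = exp (Re z) * cos (Im z).
Proof. unfold Cexp; simpl; ring. Qed.

Lemma Im_Cexp (z : C) : Im (Cexp z) = exp (Re z) * sin (Im z).
Proof. unfold Cexp; simpl; ring. Qed.

Lemma exp_le (x y : R) : x <= y -> exp x <= exp y.
Proof. intros [H|H]; [left; apply exp_increasing; exact H | rewrite H; right; reflexivity]. Qed.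

Lemma Cexp_0 : Cexp 0 = 1.
Proof.
  apply injective_projections; [change (Re (Cexp 0) = 1) | change (Im (Cexp 0) = 0)];
  rewrite ?Re_Cexp, ?Im_Cexp; simpl; rewrite exp_0, ?cos_0, ?sin_0; ring.
Qed.

Lemma Cexp_plus (x y : C) : Cexp (x + y) = (Cexp x * Cexp y)%C.
Proof.
  destruct x as [x1 x2], y as [y1 y2]; unfold Cexp.
  replace (Re ((x1, x2) + (y1, y2))) with (x1 + y1) by reflexivity.
  replace (Im ((x1, x2) + (y1, y2))) with (x2 + y2) by reflexivity.
  rewrite exp_plus, cos_plus, sin_plus.
  apply injective_projections; simpl; ring.
Qed.

Lemma Cmod_Cexp (z : C) : Cmod (Cexp z) = exp (Re z).
Proof.
  unfold Cexp; rewrite Cmod_mult, Cmod_R, Rabs_right by (apply Rle_ge, Rlt_le, exp_pos).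
  replace (Cmod (cos (Im z), sin (Im z))) with 1; [ring|].
  unfold Cmod; simpl fst; simpl snd; symmetry; rewrite <- sqrt_1; f_equal.
  generalize (sin2_cos2 (Im z)); unfold Rsqr; simpl; lra.
Qed.

Lemma Cexp_neq_0 (z : C) : Cexp z <> 0.
Proof. apply Cmod_gt_0; rewrite Cmod_Cexp; apply exp_pos. Qed.

Lemma Cexp_opp (z : C) : Cexp (- z) = (/ Cexp z)%C.
Proof.
  assert (H : (Cexp (- z) * Cexp z)%C = 1)
    by (rewrite <- Cexp_plus; replace (- z + z)%C with (RtoC 0) by ring; apply Cexp_0).
  rewrite <- (Cmult_1_l (/ Cexp z)), <- H; field; apply Cexp_neq_0.
Qed.

Lemma Cexp_pow (z : C) (n : nat) : (Cexp z ^ n)%C = Cexp (INR n * z).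
Proof.
  induction n as [|n IH].
  - simpl; replace (0 * z)%C with (RtoC 0) by ring; rewrite Cexp_0; reflexivity.
  - rewrite S_INR, RtoC_plus; replace ((INR n + 1) * z)%C with (z + INR n * z)%C by ring.
    rewrite Cexp_plus, <- IH; reflexivity.
Qed.

Lemma is_derive_Cexp_line (h : C) (t : R) :
  is_derive (fun u : R => Re (Cexp (u * h))) t (Re (h * Cexp (t * h))) /\
  is_derive (fun u : R => Im (Cexp (u * h))) t (Im (h * Cexp (t * h))).
Proof.
  split.
  - apply is_derive_ext with (fun u => exp (u * Re h) * cos (u * Im h)).
    { intros u; rewrite Re_Cexp, re_scal_l, im_scal_l; reflexivity. }
    replace (Re (h * Cexp (t * h))) with (Re h * Re (Cexp (t * h)) - Im h * Im (Cexp (t * h)))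
      by reflexivity.
    rewrite Re_Cexp, Im_Cexp, re_scal_l, im_scal_l; auto_derive; trivial; ring.
  - apply is_derive_ext with (fun u => exp (u * Re h) * sin (u * Im h)).
    { intros u; rewrite Im_Cexp, re_scal_l, im_scal_l; reflexivity. }
    replace (Im (h * Cexp (t * h))) with (Re h * Im (Cexp (t * h)) + Im h * Re (Cexp (t * h)))
      by reflexivity.
    rewrite Re_Cexp, Im_Cexp, re_scal_l, im_scal_l; auto_derive; trivial; ring.
Qed.

Lemma Cmod_Cexp_line (h : C) (t : R) : 0 <= t <= 1 -> Cmod (Cexp (t * h)) <= exp (Cmod h).
Proof.
  intros Ht; rewrite Cmod_Cexp, re_scal_l; apply exp_le.
  assert (H := re_le_Cmod h); generalize (Rle_abs (Re h)) (Rabs_pos (Re h)); nra.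
Qed.

Lemma Cmod_Cexp_minus_1 (h : C) : Cmod (Cexp h - 1) <= 2 * Cmod h * exp (Cmod h).
Proof.
  assert (H := mvt_bound_C (fun u => Cexp (u * h)) (fun u => h * Cexp (u * h))%C
                 0 1 (Cmod h * exp (Cmod h)) Rle_0_1).
  cbv beta in H.
  replace (1 * h)%C with h in H by ring; replace (0 * h)%C with (RtoC 0) in H by ring.
  rewrite Cexp_0 in H; rewrite <- Rmult_assoc, Rminus_0_r, Rmult_1_r in H.
  apply H; intros t Ht; destruct (is_derive_Cexp_line h t) as [D1 D2].
  split; [exact D1 | split; [exact D2|]].
  rewrite Cmod_mult; apply Rmult_le_compat_l; [apply Cmod_ge_0 | apply Cmod_Cexp_line, Ht].
Qed.

(** The derivative of $e^{uh}-uh$ along the segment is $h(e^{uh}-1)$, which is of second order by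
    [Cmod_Cexp_minus_1]; each of the two mean value steps contributes a factor 2. *)
Lemma Cmod_Cexp_taylor (h : C) :
  Cmod (Cexp h - 1 - h) <= 4 * Cmod h * Cmod h * exp (Cmod h).
Proof.
  assert (H := mvt_bound_C (fun u => Cexp (u * h) - u * h)%C (fun u => h * (Cexp (u * h) - 1))%C
                 0 1 (2 * Cmod h * Cmod h * exp (Cmod h)) Rle_0_1).
  cbv beta in H.
  replace (1 * h)%C with h in H by ring; replace (0 * h)%C with (RtoC 0) in H by ring.
  rewrite Cexp_0 in H.
  replace (Cexp h - h - (1 - 0))%C with (Cexp h - 1 - h)%C in H by ring.
  eapply Rle_trans; [apply H; clear H|right; ring].
  intros t Ht; split; [|split].
  - replace (Re (h * (Cexp (t * h) - 1))) with (Re (h * Cexp (t * h)) - Re h)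
      by (generalize (Cexp (t * h)); intros w; unfold Re, Im; simpl; ring).
    apply (is_derive_ext (fun u : R => Re (Cexp (u * h)) - u * Re h)).
    { intros u; rewrite <- re_scal_l; reflexivity. }
    apply (is_derive_minus (V := R_NormedModule)); [apply is_derive_Cexp_line|].
    auto_derive; trivial; ring.
  - replace (Im (h * (Cexp (t * h) - 1))) with (Im (h * Cexp (t * h)) - Im h)
      by (generalize (Cexp (t * h)); intros w; unfold Re, Im; simpl; ring).
    apply (is_derive_ext (fun u : R => Im (Cexp (u * h)) - u * Im h)).
    { intros u; rewrite <- im_scal_l; reflexivity. }
    apply (is_derive_minus (V := R_NormedModule)); [apply is_derive_Cexp_line|].
    auto_derive; trivial; ring.
  - rewrite Cmod_mult; assert (K := Cmod_Cexp_minus_1 (t * h)).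
    assert (L : Cmod (t * h) <= Cmod h).
    { rewrite Cmod_mult, Cmod_R, Rabs_right by lra; generalize (Cmod_ge_0 h); nra. }
    assert (L2 : exp (Cmod (t * h)) <= exp (Cmod h)).
    { apply exp_le, L. }
    assert (L3 : Cmod (t * h) * exp (Cmod (t * h)) <= Cmod h * exp (Cmod h)).
    { apply Rmult_le_compat; auto; [apply Cmod_ge_0 | left; apply exp_pos]. }
    apply Rle_trans with (Cmod h * (2 * (Cmod h * exp (Cmod h)))).
    + apply Rmult_le_compat_l; [apply Cmod_ge_0 | lra].
    + right; ring.
Qed.

Lemma cdiff_Cexp (s : C) : cdiff Cexp s.
Proof.
  exists (Cexp s); intros eps Heps.
  assert (Hc : 0 < 4 * exp (Re s) * exp 1).
  { generalize (exp_pos (Re s)) (exp_pos 1); intros; repeat apply Rmult_lt_0_compat; lra. }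
  exists (Rmin 1 (eps / (4 * exp (Re s) * exp 1))); split.
  { apply Rmin_pos; [lra | apply Rdiv_lt_0_compat; assumption]. }
  intros t Ht.
  assert (T1 : Cmod (t - s) < 1) by (eapply Rlt_le_trans; [exact Ht | apply Rmin_l]).
  assert (T2 : Cmod (t - s) < eps / (4 * exp (Re s) * exp 1))
    by (eapply Rlt_le_trans; [exact Ht | apply Rmin_r]).
  replace (Cexp t) with (Cexp s * Cexp (t - s))%C
    by (rewrite <- Cexp_plus; f_equal; ring).
  set (h := (t - s)%C) in *.
  replace (Cexp s * Cexp h - Cexp s - Cexp s * h)%C
    with (Cexp s * (Cexp h - 1 - h))%C by ring.
  rewrite Cmod_mult, Cmod_Cexp.
  assert (K := Cmod_Cexp_taylor h).
  assert (E : exp (Cmod h) <= exp 1) by (apply exp_le; lra).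
  apply Rle_trans with (exp (Re s) * (4 * Cmod h * Cmod h * exp 1)).
  - apply Rmult_le_compat_l; [left; apply exp_pos|].
    eapply Rle_trans; [exact K|]; apply Rmult_le_compat_l; [|exact E].
    generalize (Cmod_ge_0 h); nra.
  - apply Rle_trans with ((Cmod h * (4 * exp (Re s) * exp 1)) * Cmod h); [right; ring|].
    apply Rmult_le_compat_r; [apply Cmod_ge_0|].
    apply Rle_trans with (eps / (4 * exp (Re s) * exp 1) * (4 * exp (Re s) * exp 1)).
    + apply Rmult_le_compat_r; lra.
    + right; field; split; apply Rgt_not_eq, exp_pos.
Qed.

(** * Goursat's theorem and the identity theorem *)

Lemma nested_intervals (u l : nat -> R) :
  (forall n, 0 <= l n) -> (forall n, u n <= u (S n)) ->
  (forall n, u (S n) + l (S n) <= u n + l n) ->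
  exists x, forall n, u n <= x <= u n + l n.
Proof.
  intros Hl Hu Hul.
  assert (Um : forall n m, (n <= m)%nat -> u n <= u m).
  { intros n m H; induction H as [|m H IH]; [lra | specialize (Hu m); lra]. }
  assert (Lm : forall n m, (n <= m)%nat -> u m + l m <= u n + l n).
  { intros n m H; induction H as [|m H IH]; [lra | specialize (Hul m); lra]. }
  assert (B : forall n m, u m <= u n + l n).
  { intros n m; destruct (Nat.le_ge_cases n m) as [H|H].
    - specialize (Lm n m H); specialize (Hl m); lra.
    - specialize (Um m n H); specialize (Hl n); lra. }
  destruct (completeness (fun x => exists n, x = u n)) as [x [Hx1 Hx2]].
  - exists (u O + l O); intros y [n ->]; apply B.
  - exists (u O); exists O; reflexivity.
  - exists x; intros n; split; [apply Hx1; exists n; reflexivity|].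
    apply Hx2; intros y [m ->]; apply B.
Qed.

(* The imaginary part of the integral of F dz along the boundary of
   [a, b] x [c, d]. *)
Definition boundary_int (F : C -> C) (a b c d : R) : R :=
  RInt (fun x => Im (F (x, c)) - Im (F (x, d))) a b +
  RInt (fun y => Re (F (b, y)) - Re (F (a, y))) c d.

Definition holo_rect (F : C -> C) (a b c d : R) : Prop :=
  forall x y, a <= x <= b -> c <= y <= d -> cdiff F (x, y).

Lemma cdiff_continuous_along (F : C -> C) (p : R -> C) (t : R) :
  (forall u, Cmod (p u - p t) <= Rabs (u - t)) -> cdiff F (p t) ->
  continuous (fun u => Re (F (p u))) t /\ continuous (fun u => Im (F (p u))) t.
Proof.
  intros Hp HF.
  assert (K : forall P : C -> R, (forall z w, Rabs (P z - P w) <= Cmod (z - w)) ->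
                continuous (fun u => P (F (p u))) t).
  { intros P HP; apply continuity_pt_filterlim, continuity_pt_locally; intros eps.
    destruct (cdiff_continuous F _ HF eps (cond_pos eps)) as (d & Hd & H).
    exists (mkposreal d Hd); intros u Hu.
    eapply Rle_lt_trans; [apply HP|]; apply H.
    eapply Rle_lt_trans; [apply Hp | exact Hu]. }
  split; apply K; intros z w.
  - exact (re_le_Cmod (z - w)).
  - exact (im_le_Cmod (z - w)).
Qed.

Lemma Cmod_horizontal (c x t : R) : Cmod ((x, c) - (t, c)) <= Rabs (x - t).
Proof.
  eapply Rle_trans; [apply Cmod_le_abs_sum|]; simpl.
  replace (c + - c) with 0 by ring; rewrite Rabs_R0; unfold Rminus; lra.
Qed.

Lemma Cmod_vertical (c x t : R) : Cmod ((c, x) - (c, t)) <= Rabs (x - t).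
Proof.
  eapply Rle_trans; [apply Cmod_le_abs_sum|]; simpl.
  replace (c + - c) with 0 by ring; rewrite Rabs_R0; unfold Rminus; lra.
Qed.

Lemma continuous_horizontal F x y : cdiff F (x, y) ->
  continuous (fun t => Re (F (t, y))) x /\ continuous (fun t => Im (F (t, y))) x.
Proof. apply (cdiff_continuous_along F (fun t => (t, y))); intros; apply Cmod_horizontal. Qed.

Lemma continuous_vertical F x y : cdiff F (x, y) ->
  continuous (fun t => Re (F (x, t))) y /\ continuous (fun t => Im (F (x, t))) y.
Proof. apply (cdiff_continuous_along F (fun t => (x, t))); intros; apply Cmod_vertical. Qed.

Lemma ex_RInt_horizontal F a b c d : a <= b -> c <= d -> holo_rect F a b c d ->
  ex_RInt (fun x => Im (F (x, c)) - Im (F (x, d))) a b.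
Proof.
  intros Hab Hcd H; apply (ex_RInt_continuous (V := R_CompleteNormedModule)).
  intros z Hz; rewrite Rmin_left, Rmax_right in Hz by lra.
  apply (continuous_minus (V := R_NormedModule)); apply continuous_horizontal, H; lra.
Qed.

Lemma ex_RInt_vertical F a b c d : a <= b -> c <= d -> holo_rect F a b c d ->
  ex_RInt (fun y => Re (F (b, y)) - Re (F (a, y))) c d.
Proof.
  intros Hab Hcd H; apply (ex_RInt_continuous (V := R_CompleteNormedModule)).
  intros z Hz; rewrite Rmin_left, Rmax_right in Hz by lra.
  apply (continuous_minus (V := R_NormedModule)); apply continuous_vertical, H; lra.
Qed.

Lemma holo_rect_sub F a b c d a' b' c' d' :
  a <= a' -> b' <= b -> c <= c' -> d' <= d -> holo_rect F a b c d -> holo_rect F a' b' c' d'.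
Proof. intros H1 H2 H3 H4 H x y Hx Hy; apply H; lra. Qed.

Lemma boundary_int_split_x F a m b c d : a <= m <= b -> c <= d -> holo_rect F a b c d ->
  boundary_int F a b c d = boundary_int F a m c d + boundary_int F m b c d.
Proof.
  intros Hm Hcd H; unfold boundary_int.
  assert (H1 : holo_rect F a m c d) by (eapply holo_rect_sub; [..|exact H]; lra).
  assert (H2 : holo_rect F m b c d) by (eapply holo_rect_sub; [..|exact H]; lra).
  rewrite <- (RInt_Chasles (V := R_CompleteNormedModule) _ a m b)
    by (apply ex_RInt_horizontal; auto; lra).
  rewrite (RInt_ext (fun y => Re (F (b, y)) - Re (F (a, y)))
     (fun y => plus (Re (F (m, y)) - Re (F (a, y))) (Re (F (b, y)) - Re (F (m, y))))).
  - rewrite (RInt_plus (V := R_CompleteNormedModule)) by (apply ex_RInt_vertical; auto; lra).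
    unfold plus; simpl; ring.
  - intros y _; unfold plus; simpl; ring.
Qed.

Lemma boundary_int_split_y F a b c m d : a <= b -> c <= m <= d -> holo_rect F a b c d ->
  boundary_int F a b c d = boundary_int F a b c m + boundary_int F a b m d.
Proof.
  intros Hab Hm H; unfold boundary_int.
  assert (H1 : holo_rect F a b c m) by (eapply holo_rect_sub; [..|exact H]; lra).
  assert (H2 : holo_rect F a b m d) by (eapply holo_rect_sub; [..|exact H]; lra).
  rewrite <- (RInt_Chasles (V := R_CompleteNormedModule) _ c m d)
    by (apply ex_RInt_vertical; auto; lra).
  rewrite (RInt_ext (fun x => Im (F (x, c)) - Im (F (x, d)))
     (fun x => plus (Im (F (x, c)) - Im (F (x, m))) (Im (F (x, m)) - Im (F (x, d))))).
  - rewrite (RInt_plus (V := R_CompleteNormedModule)) by (apply ex_RInt_horizontal; auto; lra).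
    unfold plus; simpl; ring.
  - intros y _; unfold plus; simpl; ring.
Qed.

(** Halving both sides writes the integral as a sum of four, and one of them carries at least a
    quarter of the absolute value. *)
Lemma boundary_int_quarter F a c w h : 0 <= w -> 0 <= h -> holo_rect F a (a + w) c (c + h) ->
  exists a' c', a <= a' /\ a' + w / 2 <= a + w /\ c <= c' /\ c' + h / 2 <= c + h /\
    Rabs (boundary_int F a (a + w) c (c + h)) <=
      4 * Rabs (boundary_int F a' (a' + w / 2) c' (c' + h / 2)).
Proof.
  intros Hw Hh H.
  rewrite (boundary_int_split_x F a (a + w / 2) (a + w)) by (auto; lra).
  rewrite (boundary_int_split_y F a (a + w / 2) c (c + h / 2) (c + h));
    [|lra|lra|eapply holo_rect_sub; [..|exact H]; lra].
  rewrite (boundary_int_split_y F (a + w / 2) (a + w) c (c + h / 2) (c + h));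
    [|lra|lra|eapply holo_rect_sub; [..|exact H]; lra].
  replace (a + w) with (a + w / 2 + w / 2) by field.
  replace (c + h) with (c + h / 2 + h / 2) by field.
  set (J1 := boundary_int F a (a + w / 2) c (c + h / 2)).
  set (J2 := boundary_int F a (a + w / 2) (c + h / 2) (c + h / 2 + h / 2)).
  set (J3 := boundary_int F (a + w / 2) (a + w / 2 + w / 2) c (c + h / 2)).
  set (J4 := boundary_int F (a + w / 2) (a + w / 2 + w / 2) (c + h / 2) (c + h / 2 + h / 2)).
  assert (T := Rabs_triang (J1 + J2) (J3 + J4)).
  assert (T1 := Rabs_triang J1 J2); assert (T2 := Rabs_triang J3 J4).
  set (J := Rabs (J1 + J2 + (J3 + J4))) in *.
  destruct (Rle_lt_dec J (4 * Rabs J1)) as [L1|L1];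
    [exists a, c; unfold J1 in L1; lra|].
  destruct (Rle_lt_dec J (4 * Rabs J2)) as [L2|L2];
    [exists a, (c + h / 2); unfold J2 in L2; lra|].
  destruct (Rle_lt_dec J (4 * Rabs J3)) as [L3|L3];
    [exists (a + w / 2), c; unfold J3 in L3; lra|].
  exists (a + w / 2), (c + h / 2); unfold J4 in *; lra.
Qed.

(* Near a point of differentiability the two sides of each difference in
   [boundary_int] agree up to a term that is constant along the side; the two
   constants cancel by the Cauchy-Riemann equations. *)
Lemma boundary_int_small F (p : C) (eps : R) : 0 < eps -> cdiff F p ->
  exists del, 0 < del /\ forall a c w h, 0 <= w -> 0 <= h -> w + h < del ->
    a <= Re p <= a + w -> c <= Im p <= c + h -> holo_rect F a (a + w) c (c + h) ->
    Rabs (boundary_int F a (a + w) c (c + h)) <= eps * ((w + h) * (w + h)).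
Proof.
  intros Heps [l Hl]; destruct (Hl (eps / 2)) as (del & Hd & H); [lra|].
  exists del; split; [exact Hd|]; intros a c w h Hw Hh Hwh Hp1 Hp2 Hol.
  assert (G : forall x y, a <= x <= a + w -> c <= y <= c + h ->
    Rabs (Re (F (x, y)) - Re (F p) - (Re l * (x - Re p) - Im l * (y - Im p))) <= eps / 2 * (w + h) /\
    Rabs (Im (F (x, y)) - Im (F p) - (Re l * (y - Im p) + Im l * (x - Re p))) <= eps / 2 * (w + h)).
  { intros x y Hx Hy.
    assert (D : Cmod ((x, y) - p) <= w + h).
    { eapply Rle_trans; [apply Cmod_le_abs_sum|].
      apply Rplus_le_compat; apply Rabs_le; unfold Re, Im in *; simpl; lra. }
    assert (K := H (x, y) (Rle_lt_trans _ _ _ D Hwh)).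
    assert (K' : eps / 2 * Cmod ((x, y) - p) <= eps / 2 * (w + h))
      by (apply Rmult_le_compat_l; lra).
    split.
    - replace (Re (F (x, y)) - Re (F p) - (Re l * (x - Re p) - Im l * (y - Im p)))
        with (Re (F (x, y) - F p - l * ((x, y) - p)))
        by (unfold Re, Im; simpl; ring).
      eapply Rle_trans; [apply re_le_Cmod | lra].
    - replace (Im (F (x, y)) - Im (F p) - (Re l * (y - Im p) + Im l * (x - Re p)))
        with (Im (F (x, y) - F p - l * ((x, y) - p)))
        by (unfold Re, Im; simpl; ring).
      eapply Rle_trans; [apply im_le_Cmod | lra]. }
  unfold boundary_int.
  assert (I1 : Rabs (RInt (fun x => Im (F (x, c)) - Im (F (x, c + h)) + Re l * h) a (a + w))
            <= (a + w - a) * (eps * (w + h))).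
  { apply abs_RInt_le_const; [lra| |].
    - apply (ex_RInt_plus (V := R_NormedModule));
        [apply ex_RInt_horizontal; auto; lra | apply ex_RInt_const].
    - intros t Ht.
      destruct (G t c) as [_ G1]; [lra|lra|]; destruct (G t (c + h)) as [_ G2]; [lra|lra|].
      apply Rabs_le_between in G1; apply Rabs_le_between in G2; apply Rabs_le; lra. }
  assert (I2 : Rabs (RInt (fun y => Re (F (a + w, y)) - Re (F (a, y)) - Re l * w) c (c + h))
            <= (c + h - c) * (eps * (w + h))).
  { apply abs_RInt_le_const; [lra| |].
    - apply (ex_RInt_minus (V := R_NormedModule));
        [apply ex_RInt_vertical; auto; lra | apply ex_RInt_const].
    - intros t Ht.
      destruct (G (a + w) t) as [G1 _]; [lra|lra|]; destruct (G a t) as [G2 _]; [lra|lra|].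
      apply Rabs_le_between in G1; apply Rabs_le_between in G2; apply Rabs_le; lra. }
  rewrite (RInt_plus (V := R_CompleteNormedModule) (fun x => Im (F (x, c)) - Im (F (x, c + h)))
    (fun _ => Re l * h)) in I1;
    [|apply ex_RInt_horizontal; auto; lra | apply ex_RInt_const].
  rewrite (RInt_minus (V := R_CompleteNormedModule) (fun y => Re (F (a + w, y)) - Re (F (a, y)))
    (fun _ => Re l * w)) in I2;
    [|apply ex_RInt_vertical; auto; lra | apply ex_RInt_const].
  rewrite !RInt_const in I1, I2.
  unfold plus, minus, opp, scal in I1, I2; simpl in I1, I2; unfold mult in I1, I2; simpl in I1, I2.
  apply Rabs_le_between in I1; apply Rabs_le_between in I2.
  apply Rabs_le; unfold plus, opp in *; simpl in *; nra.
Qed.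

(** Quartering n times loses a factor $4^n$, while at the limit point [boundary_int_small] bounds
    the small integral by an arbitrary [eps] times $(w+h)^2/4^n$; the powers of 4 cancel. *)
Theorem goursat F a c w h : 0 <= w -> 0 <= h -> holo_rect F a (a + w) c (c + h) ->
  boundary_int F a (a + w) c (c + h) = 0.
Proof.
  intros Hw Hh Hol.
  set (wn := fun n => w / 2 ^ n); set (hn := fun n => h / 2 ^ n).
  set (J := fun n (p : R * R) =>
    Rabs (boundary_int F (fst p) (fst p + wn n) (snd p) (snd p + hn n))).
  assert (P2 : forall n, 0 < 2 ^ n) by (intros n; apply pow_lt; lra).
  assert (Wpos : forall n, 0 <= wn n)
    by (intros n; apply Rmult_le_pos; [|left; apply Rinv_0_lt_compat]; auto).
  assert (Hpos : forall n, 0 <= hn n)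
    by (intros n; apply Rmult_le_pos; [|left; apply Rinv_0_lt_compat]; auto).
  assert (WS : forall n, wn (S n) = wn n / 2).
  { intros n; unfold wn; simpl; field; apply Rgt_not_eq, P2. }
  assert (HS : forall n, hn (S n) = hn n / 2).
  { intros n; unfold hn; simpl; field; apply Rgt_not_eq, P2. }
  set (rel := fun n (p q : R * R) =>
    fst p <= fst q /\ fst q + wn (S n) <= fst p + wn n /\
    snd p <= snd q /\ snd q + hn (S n) <= snd p + hn n /\ J n p <= 4 * J (S n) q).
  (* The chosen corner satisfies [rel] only while the current rectangle lies in the initial one, so
     [Inv] has to carry the containment along with [rel]. *)
  set (nxt := fun n p => epsilon (inhabits (0, 0)) (rel n p)).
  set (pn := fix pn n := match n with O => (a, c) | S n => nxt n (pn n) end).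
  assert (Inv : forall n, a <= fst (pn n) /\ fst (pn n) + wn n <= a + w /\
     c <= snd (pn n) /\ snd (pn n) + hn n <= c + h /\ rel n (pn n) (pn (S n))).
  { assert (St : forall n, a <= fst (pn n) -> fst (pn n) + wn n <= a + w ->
      c <= snd (pn n) -> snd (pn n) + hn n <= c + h -> rel n (pn n) (pn (S n))).
    { intros n H1 H2 H3 H4; simpl; unfold nxt; apply epsilon_spec.
      destruct (boundary_int_quarter F (fst (pn n)) (snd (pn n)) (wn n) (hn n))
        as (a' & c' & K1 & K2 & K3 & K4 & K5); auto.
      - eapply holo_rect_sub; [..|exact Hol]; lra.
      - exists (a', c'); unfold rel, J; simpl fst; simpl snd; rewrite WS, HS; repeat split; lra. }
    assert (W0 : wn O = w) by (unfold wn; simpl; field).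
    assert (H0 : hn O = h) by (unfold hn; simpl; field).
    induction n as [|n IH].
    - change (pn O) with (a, c); simpl fst; simpl snd; rewrite W0, H0.
      do 4 (split; [lra|]); apply (St O); simpl; lra.
    - destruct IH as (H1 & H2 & H3 & H4 & (R1 & R2 & R3 & R4 & _)).
      do 4 (split; [lra|]); apply St; lra. }
  destruct (nested_intervals (fun n => fst (pn n)) wn) as [x Hx]; auto;
    [intros n; apply Inv | intros n; apply Inv |].
  destruct (nested_intervals (fun n => snd (pn n)) hn) as [y Hy]; auto;
    [intros n; apply Inv | intros n; apply Inv |].
  assert (JJ : forall n, J O (a, c) <= 4 ^ n * J n (pn n)).
  { induction n as [|n IH]; [simpl; lra|].
    destruct (Inv n) as (_ & _ & _ & _ & (_ & _ & _ & _ & R)).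
    assert (0 < 4 ^ n) by (apply pow_lt; lra); simpl pow; nra. }
  assert (J0 : J O (a, c) = Rabs (boundary_int F a (a + w) c (c + h))).
  { unfold J, wn, hn; simpl; unfold Rdiv; rewrite Rinv_1, !Rmult_1_r; reflexivity. }
  assert (Hxy : cdiff F (x, y)).
  { destruct (Inv O) as (A1 & A2 & A3 & A4 & _); specialize (Hx O); specialize (Hy O).
    apply Hol; lra. }
  assert (Z : forall eps, 0 < eps -> J O (a, c) <= eps * ((w + h) * (w + h))).
  { intros eps Heps; destruct (boundary_int_small F (x, y) eps Heps Hxy) as (del & Hd & H).
    (* The added 1 keeps the divisor positive when the rectangle degenerates to a point. *)
    destruct (pow_lt_1_zero (/ 2)) with (y := del / (w + h + 1)) as [N HN];
      [rewrite Rabs_right; lra | apply Rdiv_lt_0_compat; lra|].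
    specialize (HN N (Nat.le_refl N)); rewrite Rabs_right in HN
      by (apply Rle_ge, pow_le; lra).
    assert (E : wn N + hn N = (w + h) * (/ 2) ^ N)
      by (unfold wn, hn; rewrite pow_inv; field; apply Rgt_not_eq, P2).
    assert (P : 0 < (/ 2) ^ N) by (apply pow_lt; lra).
    assert (Sm : wn N + hn N < del).
    { rewrite E; apply Rlt_le_trans with ((w + h + 1) * (del / (w + h + 1))).
      - apply Rle_lt_trans with ((w + h + 1) * (/ 2) ^ N);
          [apply Rmult_le_compat_r; lra | apply Rmult_lt_compat_l; lra].
      - right; field; lra. }
    destruct (Inv N) as (A1 & A2 & A3 & A4 & _).
    assert (K := H (fst (pn N)) (snd (pn N)) (wn N) (hn N) (Wpos N) (Hpos N) Sm (Hx N) (Hy N)).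
    lapply K; [clear K; intros K | eapply holo_rect_sub; [..|exact Hol]; lra].
    specialize (JJ N); fold (J N (pn N)) in K.
    eapply Rle_trans; [exact JJ|].
    apply Rle_trans with (4 ^ N * (eps * ((wn N + hn N) * (wn N + hn N)))).
    - apply Rmult_le_compat_l; [left; apply pow_lt; lra | exact K].
    - right; rewrite E.
      replace (4 ^ N * (eps * ((w + h) * (/ 2) ^ N * ((w + h) * (/ 2) ^ N))))
        with (eps * ((w + h) * (w + h)) * (4 ^ N * ((/ 2) ^ N * (/ 2) ^ N))) by ring.
      rewrite <- !Rpow_mult_distr; replace (4 * (/ 2 * / 2)) with 1 by field.
      rewrite pow1; ring. }
  rewrite J0 in Z.
  destruct (Req_dec (boundary_int F a (a + w) c (c + h)) 0) as [E|E]; [exact E|].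
  apply Rabs_pos_lt in E; set (B := Rabs _) in *.
  set (q := (w + h) * (w + h)) in *.
  assert (Hq : 0 <= q) by (unfold q; nra).
  specialize (Z (B / (2 * (q + 1)))); lapply Z; [clear Z; intros Z|apply Rdiv_lt_0_compat; lra].
  assert (B / (2 * (q + 1)) * q < B); [|lra].
  apply Rlt_le_trans with (B / (2 * (q + 1)) * (2 * (q + 1))).
  - apply Rmult_lt_compat_l; [apply Rdiv_lt_0_compat; lra | lra].
  - right; field; lra.
Qed.

(** * From Goursat's theorem to the identity theorem on discs *)

Lemma small_nonneg_eq_0 (x K : R) : 0 <= x -> (forall n, x * INR n <= K) -> x = 0.
Proof.
  intros [Hx|Hx] H; [exfalso|auto].
  destruct (INR_archimed x (Rabs K)) as [n Hn]; [exact Hx|].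
  specialize (H n); generalize (Rle_abs K); lra.
Qed.

Lemma le_of_le_plus_eps (x y : R) : (forall eps, 0 < eps -> x <= y + eps) -> x <= y.
Proof.
  intros H; destruct (Rle_lt_dec x y) as [L|L]; [exact L|].
  specialize (H ((x - y) / 2)); lra.
Qed.

(* Goursat's theorem for f (s0 + exp w) on [A, ln r] x [0, 2 pi]: the horizontal
   sides cancel by periodicity, and the left side tends to 2 pi f(s0). *)
Lemma circle_bound_Re f (s0 : C) (r r' M : R) : 0 < r < r' ->
  (forall s, Cmod (s - s0) < r' -> cdiff f s) ->
  (forall y, 0 <= y <= 2 * PI -> Cmod (f (s0 + r * Cexp (0, y)))%C <= M) ->
  Rabs (Re (f s0)) <= M.
Proof.
  intros Hr Hf HM; apply le_of_le_plus_eps; intros eps Heps.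
  set (F := fun w => f (s0 + Cexp w)%C).
  assert (HF : forall x y, x <= ln r -> cdiff F (x, y)).
  { intros x y Hx; apply (cdiff_comp f (fun w => s0 + Cexp w)%C).
    - apply Hf; replace (s0 + Cexp (x, y) - s0)%C with (Cexp (x, y)) by ring.
      rewrite Cmod_Cexp; simpl; apply Rle_lt_trans with (exp (ln r)); [apply exp_le, Hx|].
      rewrite exp_ln; lra.
    - apply cdiff_plus; [apply cdiff_const | apply cdiff_Cexp]. }
  assert (Hs0 : cdiff f s0).
  { apply Hf; replace (s0 - s0)%C with (RtoC 0) by ring; rewrite Cmod_0; lra. }
  destruct (cdiff_continuous f s0 Hs0 eps Heps) as (d & Hd & Hc).
  (* The left side is placed so far out that the circle of radius $e^A$ lies where [f] differs from
     [f s0] by less than [eps]. *)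
  set (A := ln (Rmin r (d / 2))).
  assert (Hm : 0 < Rmin r (d / 2)) by (apply Rmin_pos; lra).
  assert (HA : A <= ln r) by (apply Rcomplements.ln_le; [exact Hm | apply Rmin_l]).
  assert (P := PI_RGT_0).
  assert (G := goursat F A 0 (ln r - A) (2 * PI)).
  replace (A + (ln r - A)) with (ln r) in G by ring; rewrite Rplus_0_l in G.
  assert (Hol : holo_rect F A (ln r) 0 (2 * PI)) by (intros x y Hx Hy; apply HF; lra).
  specialize (G ltac:(lra) ltac:(lra) Hol); unfold boundary_int in G.
  assert (Per : forall x, F (x, 0) = F (x, 2 * PI)).
  { intros x; unfold F; do 2 f_equal.
    apply injective_projections;
      [change (Re (Cexp (x, 0)) = Re (Cexp (x, 2 * PI))) |
       change (Im (Cexp (x, 0)) = Im (Cexp (x, 2 * PI)))];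
      rewrite ?Re_Cexp, ?Im_Cexp; simpl;
      rewrite ?cos_0, ?sin_0, ?cos_2PI, ?sin_2PI; reflexivity. }
  rewrite (RInt_ext _ (fun _ => 0)) in G by (intros x _; rewrite Per; apply Rminus_diag).
  rewrite (RInt_const (V := R_CompleteNormedModule)) in G.
  unfold scal in G; simpl in G; unfold mult in G; simpl in G; rewrite Rmult_0_r, Rplus_0_l in G.
  assert (X := ex_RInt_vertical F A (ln r) 0 (2 * PI) HA ltac:(lra) Hol).
  (* Adding the constant [Re (f s0)] makes the integrand at most [M + eps] pointwise; by [G] this
     constant is also all that survives integration. *)
  assert (I : Rabs (RInt (fun y => Re (F (ln r, y)) - Re (F (A, y)) + Re (f s0)) 0 (2 * PI))
      <= (2 * PI - 0) * (M + eps)).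
  { apply abs_RInt_le_const; [lra| |].
    - apply (ex_RInt_plus (V := R_NormedModule)); [exact X | apply ex_RInt_const].
    - intros y Hy.
      assert (E1 : F (ln r, y) = f (s0 + r * Cexp (0, y))%C).
      { unfold F; do 2 f_equal; replace (ln r, y) with (RtoC (ln r) + (0, y))%C
          by (apply injective_projections; simpl; ring).
        rewrite Cexp_plus; f_equal.
        apply injective_projections;
          [change (Re (Cexp (ln r)) = r) | change (Im (Cexp (ln r)) = 0)];
          rewrite ?Re_Cexp, ?Im_Cexp; simpl; rewrite exp_ln, ?cos_0, ?sin_0 by lra; ring. }
      assert (E2 : Cmod (F (A, y) - f s0) < eps).
      { apply Hc; replace (s0 + Cexp (A, y) - s0)%C with (Cexp (A, y)) by ring.
        rewrite Cmod_Cexp; simpl; unfold A; rewrite exp_ln by exact Hm.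
        generalize (Rmin_r r (d / 2)); lra. }
      rewrite E1; specialize (HM y Hy).
      assert (T1 := re_le_Cmod (f (s0 + r * Cexp (0, y))%C)).
      assert (T2 := re_le_Cmod (F (A, y) - f s0)%C).
      change (Re (F (A, y) - f s0)) with (Re (F (A, y)) + - Re (f s0)) in T2.
      replace (Re (f (s0 + r * Cexp (0, y))%C) - Re (F (A, y)) + Re (f s0))
        with (Re (f (s0 + r * Cexp (0, y))%C) - (Re (F (A, y)) + - Re (f s0))) by ring.
      unfold Rminus; eapply Rle_trans; [apply Rabs_triang|]; rewrite Rabs_Ropp; lra. }
  rewrite (RInt_plus (V := R_CompleteNormedModule)
    (fun y => Re (F (ln r, y)) - Re (F (A, y))) (fun _ => Re (f s0))) in I;
    [|exact X | apply ex_RInt_const].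
  rewrite G, RInt_const in I; unfold plus, scal in I; simpl in I; unfold mult in I; simpl in I.
  rewrite Rplus_0_l, Rminus_0_r, Rabs_mult, (Rabs_right (2 * PI)) in I by lra.
  apply Rmult_le_reg_l with (2 * PI); lra.
Qed.

(** The imaginary part of [f] is the real part of [- Ci * f], so the bound for real parts is used
    twice, whence the factor 2. *)
Lemma circle_bound f (s0 : C) (r r' M : R) : 0 < r < r' ->
  (forall s, Cmod (s - s0) < r' -> cdiff f s) ->
  (forall y, 0 <= y <= 2 * PI -> Cmod (f (s0 + r * Cexp (0, y)))%C <= M) ->
  Cmod (f s0) <= 2 * M.
Proof.
  intros Hr Hf HM; eapply Rle_trans; [apply Cmod_le_abs_sum|].
  assert (H1 := circle_bound_Re f s0 r r' M Hr Hf HM).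
  assert (H2 := circle_bound_Re (fun s => - Ci * f s)%C s0 r r' M Hr).
  cbv beta in H2; replace (Re (- Ci * f s0)) with (Im (f s0)) in H2
    by (unfold Re, Im; simpl; ring).
  assert (Rabs (Im (f s0)) <= M); [|lra].
  apply H2.
  - intros s Hs; apply cdiff_scal; auto.
  - intros y Hy; rewrite Cmod_mult, Cmod_opp, Cmod_Ci, Rmult_1_l; auto.
Qed.

(* The weight exp(N(-u + u^2/(2r))), u = s - s0, equals 1 at s0 and is
   exponentially small in N on the part of the circle |u| = r with
   Re u >= - r / 8; on the rest of the circle f vanishes. *)
Lemma halfplane_zero_step f (x0 x1 : R) : x0 < x1 ->
  (forall s, Re s < x1 -> cdiff f s) -> (forall s, Re s < x0 -> f s = 0) ->
  forall s, Re s < x0 + (x1 - x0) / 16 -> f s = 0.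
Proof.
  (* With [r] half the gap, the hypothesis reads [Re s0 < x0 + r / 8]: the circle stays to the left
     of [x1], and its points with real part at least [x0] have cosine at least -1/8. *)
  intros Hx Hf H0 s0 Hs0; set (r := (x1 - x0) / 2).
  assert (Hr : 0 < r) by (unfold r; lra).
  set (pt := fun y : R => (Re s0 + r * cos y, Im s0 + r * sin y) : C).
  assert (Hc : forall y, (s0 + r * Cexp (0, y))%C = pt y).
  { intros y; unfold pt, Cexp, Re, Im; apply injective_projections; simpl; rewrite exp_0; ring. }
  assert (Rec : forall y, Re s0 + r * cos y < x1).
  { intros y; generalize (COS_bound y); unfold r in *; nra. }
  assert (Bd : exists M, forall y, 0 <= y <= 2 * PI ->
      Cmod (f (s0 + r * Cexp (0, y)))%C <= M).
  { destruct (continuity_ab_maj (fun y => Cmod (f (s0 + r * Cexp (0, y)))%C) 0 (2 * PI))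
      as [y0 [Hy0 _]].
    - generalize PI_RGT_0; lra.
    - intros y Hy; apply continuity_pt_locally; intros eps.
      assert (D : cdiff (fun w => f (s0 + r * Cexp w)%C) (0, y)).
      { apply (cdiff_comp f (fun w => s0 + r * Cexp w)%C).
        - apply Hf; rewrite Hc; apply Rec.
        - apply cdiff_plus; [apply cdiff_const | apply cdiff_scal, cdiff_Cexp]. }
      destruct (cdiff_continuous _ _ D eps (cond_pos eps)) as (d & Hd & H).
      exists (mkposreal d Hd).
      assert (K : forall u : R, Rabs (u - y) < d -> Rabs (Cmod (f (s0 + r * Cexp (0, u)))%C -
                    Cmod (f (s0 + r * Cexp (0, y)))%C) < eps); [|exact K].
      intros u Hu; eapply Rle_lt_trans;
        [|apply (H (0, u)), (Rle_lt_trans _ _ _ (Cmod_vertical 0 u y) Hu)]; cbv beta.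
      generalize (f (s0 + r * Cexp (0, u))%C) (f (s0 + r * Cexp (0, y))%C); intros v w.
      assert (K1 := Cmod_triangle_sub v w); assert (K2 := Cmod_triangle_sub w v).
      rewrite (Cmod_minus_sym w v) in K2; apply Rabs_le; lra.
    - eexists; intros y Hy; apply Hy0, Hy. }
  destruct Bd as [M HM].
  assert (M0 : 0 <= M).
  { eapply Rle_trans; [apply Cmod_ge_0 | apply (HM 0)]; generalize PI_RGT_0; lra. }
  (* A bound of order 1/n for every n suffices; the exponential decay in n is weakened to this at
     the end through $e^{-u}u\le1$. *)
  apply Cmod_eq_0, (small_nonneg_eq_0 _ (2 * M * (3 / r))); [apply Cmod_ge_0|].
  intros n.
  set (g := fun s => (f s * Cexp (INR n * (- (s - s0) + / (2 * r) * ((s - s0) * (s - s0)))))%C).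
  assert (Hg : Cmod (g s0) <= 2 * (M * exp (- (INR n * r / 3)))).
  { apply (circle_bound g s0 r (x1 - Re s0)).
    - unfold r in *; lra.
    - intros s Hs; assert (K := re_le_Cmod (s - s0)).
      assert (K2 := Rle_abs (Re (s - s0))); change (Re (s - s0)) with (Re s + - Re s0) in *.
      apply cdiff_mult; [apply Hf; lra|].
      assert (U : cdiff (fun t => t - s0)%C s)
        by (apply cdiff_minus; [apply cdiff_id | apply cdiff_const]).
      apply (cdiff_comp Cexp); [apply cdiff_Cexp|].
      apply cdiff_scal, cdiff_plus.
      + apply cdiff_ext with (fun t => (-1) * (t - s0))%C; [intros t; ring|].
        apply cdiff_scal, U.
      + apply cdiff_scal, cdiff_mult; exact U.
    - intros y Hy; unfold g; rewrite Cmod_mult.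
      destruct (Rlt_le_dec (Re s0 + r * cos y) x0) as [L|L].
      + rewrite (H0 (s0 + r * Cexp (0, y))%C), Cmod_0, Rmult_0_l by (rewrite Hc; exact L).
        apply Rmult_le_pos; [exact M0 | left; apply exp_pos].
      + apply Rmult_le_compat; try apply Cmod_ge_0; [apply HM, Hy|].
        rewrite Cmod_Cexp; apply exp_le.
        rewrite Hc.
        replace (Re (INR n * (- (pt y - s0) + / (2 * r) * ((pt y - s0) * (pt y - s0)))))
          with (INR n * (- (r * cos y) + r / 2 * (cos y * cos y - sin y * sin y))).
        2:{ replace (pt y - s0)%C with ((r * cos y, r * sin y) : C)
              by (unfold pt; apply injective_projections; unfold Re, Im; simpl; ring).
            rewrite <- RtoC_mult, <- RtoC_inv by lra.
            unfold Re; simpl; field; lra. }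
        assert (S2 : sin y * sin y = 1 - cos y * cos y)
          by (generalize (sin2_cos2 y); unfold Rsqr; lra).
        rewrite S2.
        assert (C1 : - / 8 <= cos y).
        { apply Rmult_le_reg_l with r; [exact Hr|]; unfold r in *; lra. }
        assert (C2 := COS_bound y).
        (* By convexity the extreme values occur at cosine -1/8 and 1, where they are -23/64 and
           -1/2. *)
        assert (Q : cos y * cos y - cos y - / 2 <= - / 3) by nra.
        assert (Hn := pos_INR n).
        replace (- (r * cos y) + r / 2 * (cos y * cos y - (1 - cos y * cos y)))
          with (r * (cos y * cos y - cos y - / 2)) by field.
        replace (- (INR n * r / 3)) with (INR n * (r * - / 3)) by field.
        apply Rmult_le_compat_l; [exact Hn|]; apply Rmult_le_compat_l; lra. }
  assert (E : g s0 = f s0).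
  { unfold g; replace (s0 - s0)%C with (RtoC 0) by ring.
    replace (INR n * (- 0 + / (2 * r) * (0 * 0)))%C with (RtoC 0) by ring.
    rewrite Cexp_0; ring. }
  rewrite E in Hg; clear E g.
  set (u := INR n * r / 3) in *.
  assert (Hu : 0 <= u) by (unfold u; generalize (pos_INR n); intros; apply Rmult_le_pos; [nra | lra]).
  assert (Ex : exp (- u) * u <= 1).
  { assert (K := exp_ineq1_le u); assert (K2 : exp (- u) * exp u = 1)
      by (rewrite <- exp_plus, Rplus_opp_l; apply exp_0).
    generalize (exp_pos (- u)); nra. }
  replace (INR n) with (u * (3 / r)) by (unfold u; field; lra).
  rewrite <- Rmult_assoc; apply Rmult_le_compat_r; [left; apply Rdiv_lt_0_compat; lra|].
  apply Rle_trans with (2 * (M * exp (- u)) * u).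
  - apply Rmult_le_compat_r; assumption.
  - replace (2 * (M * exp (- u)) * u) with (2 * M * (exp (- u) * u)) by ring.
    rewrite <- (Rmult_1_r (2 * M)) at 2; apply Rmult_le_compat_l; lra.
Qed.

(** Each step moves the region of zeros across a sixteenth of the gap still left before [x1], so n
    steps leave $(15/16)^n$ of the original gap. *)
Lemma halfplane_zero f (x0 x1 : R) :
  (forall s, Re s < x1 -> cdiff f s) -> (forall s, Re s < x0 -> f s = 0) ->
  forall s, Re s < x1 -> f s = 0.
Proof.
  intros Hf H0 s Hs.
  destruct (Rle_lt_dec x1 x0) as [Hx|Hx]; [apply H0; lra|].
  assert (St : forall n t, Re t < x1 - (15 / 16) ^ n * (x1 - x0) -> f t = 0).
  { induction n as [|n IH]; intros t Ht; [apply H0; simpl in Ht; lra|].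
    assert (P : 0 < (15 / 16) ^ n) by (apply pow_lt; lra).
    apply (halfplane_zero_step f (x1 - (15 / 16) ^ n * (x1 - x0)) x1); auto; [nra|].
    simpl in Ht; lra. }
  destruct (pow_lt_1_zero (15 / 16)) with (y := (x1 - Re s) / (x1 - x0)) as [N HN];
    [rewrite Rabs_right; lra | apply Rdiv_lt_0_compat; lra|].
  specialize (HN N (Nat.le_refl N)).
  apply (St N); assert (K := Rle_abs ((15 / 16) ^ N)).
  assert (L : (15 / 16) ^ N * (x1 - x0) < (x1 - Re s) / (x1 - x0) * (x1 - x0))
    by (apply Rmult_lt_compat_r; lra).
  replace ((x1 - Re s) / (x1 - x0) * (x1 - x0)) with (x1 - Re s) in L by (field; lra); lra.
Qed.

Lemma polar_form (z : C) : z <> 0 -> exists w, Cexp w = z.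
Proof.
  intros Hz; assert (Hm := proj1 (Cmod_gt_0 z) Hz); set (m := Cmod z) in *.
  assert (Hs := Cmod_sqr z); fold m in Hs.
  set (x := Re z / m); set (y := Im z / m).
  assert (Hxy : x * x + y * y = 1).
  { unfold x, y; replace (Re z / m * (Re z / m) + Im z / m * (Im z / m))
      with ((Re z * Re z + Im z * Im z) / (m * m)) by (field; lra).
    rewrite <- Hs; field; lra. }
  assert (Hx : -1 <= x <= 1) by nra.
  assert (T : exists t, cos t = x /\ sin t = y).
  { assert (S := sin_acos x Hx); assert (Cc := cos_acos x Hx).
    assert (Sq : 1 - x² = y²) by (unfold Rsqr; lra); rewrite Sq in S.
    destruct (Rle_lt_dec 0 y) as [L|L].
    - exists (acos x); rewrite sqrt_Rsqr in S by exact L; auto.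
    - exists (- acos x); rewrite cos_neg, sin_neg, S, sqrt_Rsqr_abs, Rabs_left by exact L.
      split; [exact Cc | ring]. }
  destruct T as (t & T1 & T2); exists (ln m, t).
  apply injective_projections;
    [change (Re (Cexp (ln m, t)) = Re z) | change (Im (Cexp (ln m, t)) = Im z)];
    rewrite ?Re_Cexp, ?Im_Cexp; simpl; rewrite exp_ln by exact Hm;
    rewrite ?T1, ?T2; unfold x, y; field; lra.
Qed.

(** The map $w\mapsto q+e^w$ carries half-planes onto punctured discs about [q], so radii [r0] and
    [rho] become abscissas [ln r0] and [ln rho]. The centre, missed by the exponential, lies in the
    small disc. *)
Theorem disc_identity f (q : C) (r0 rho : R) : 0 < r0 ->
  (forall s, Cmod (s - q) < rho -> cdiff f s) ->
  (forall s, Cmod (s - q) < r0 -> f s = 0) ->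
  forall s, Cmod (s - q) < rho -> f s = 0.
Proof.
  intros Hr0 Hf H0 s Hs.
  destruct (classic (s - q = 0)%C) as [E|E].
  { apply H0; rewrite E, Cmod_0; exact Hr0. }
  assert (Hrho : 0 < rho) by (generalize (Cmod_ge_0 (s - q)); lra).
  destruct (polar_form _ E) as [w Hw].
  replace s with (q + Cexp w)%C by (rewrite Hw; ring).
  apply (halfplane_zero (fun w => f (q + Cexp w)%C) (ln r0) (ln rho)).
  - intros t Ht; apply (cdiff_comp f (fun w => q + Cexp w)%C).
    + apply Hf; replace (q + Cexp t - q)%C with (Cexp t) by ring.
      rewrite Cmod_Cexp, <- (exp_ln rho) by exact Hrho; apply exp_increasing, Ht.
    + apply cdiff_plus; [apply cdiff_const | apply cdiff_Cexp].
  - intros t Ht; apply H0; replace (q + Cexp t - q)%C with (Cexp t) by ring.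
    rewrite Cmod_Cexp, <- (exp_ln r0) by exact Hr0; apply exp_increasing, Ht.
  - rewrite <- Hw, Cmod_Cexp, <- (exp_ln rho) in Hs by exact Hrho.
    apply exp_lt_inv, Hs.
Qed.

(** * Growth of cusp forms *)

Definition clim (u : nat -> C) (l : C) : Prop :=
  forall eps, 0 < eps -> exists N, forall n, (N <= n)%nat -> Cmod (u n - l) < eps.

Lemma filterlim_clim (u : nat -> C) (l : C) :
  filterlim u eventually (locally l) -> clim u l.
Proof.
  intros H eps Heps.
  assert (P : locally l (fun y : C => Cmod (y - l) < eps)).
  { assert (S2 : 0 < sqrt 2) by (apply sqrt_lt_R0; lra).
    assert (E : 0 < eps / sqrt 2) by (apply Rdiv_lt_0_compat; assumption).
    exists (mkposreal _ E); intros y Hy.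
    assert (K := C_NormedModule_mixin_compat2 l y _ Hy); simpl in K.
    replace (sqrt 2 * (eps / sqrt 2)) with eps in K by (field; lra); exact K. }
  destruct (H _ P) as [N HN]; exists N; exact HN.
Qed.

Lemma is_series_clim (u : nat -> C) (l : C) :
  is_series u l -> clim (sum_n u) l.
Proof. apply filterlim_clim. Qed.

Lemma clim_le (u : nat -> C) (l : C) (M : R) :
  clim u l -> (forall n, Cmod (u n) <= M) -> Cmod l <= M.
Proof.
  intros H HM; apply le_of_le_plus_eps; intros eps Heps.
  destruct (H eps Heps) as [N HN]; specialize (HN N (Nat.le_refl N)).
  assert (K := Cmod_triangle_sub l (u N)); rewrite Cmod_minus_sym in K.
  specialize (HM N); lra.
Qed.

Lemma bounded_of_eventually (u : nat -> R) (N : nat) (M : R) :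
  (forall n, (N <= n)%nat -> u n <= M) -> exists M', forall n, u n <= M'.
Proof.
  intros H; assert (K : exists M', forall n, (n < N)%nat -> u n <= M').
  { clear H; induction N as [|N [M' IH]]; [exists 0; intros; lia|].
    exists (Rmax M' (u N)); intros n Hn.
    destruct (Nat.eq_dec n N) as [->|E]; [apply Rmax_r|].
    eapply Rle_trans; [apply IH; lia | apply Rmax_l]. }
  destruct K as [M' K]; exists (Rmax M M'); intros n.
  destruct (Nat.lt_ge_cases n N) as [L|L].
  - eapply Rle_trans; [apply K, L | apply Rmax_r].
  - eapply Rle_trans; [apply H, L | apply Rmax_l].
Qed.

Lemma series_terms_bounded (u : nat -> C) (l : C) :
  is_series u l -> exists B, forall n, Cmod (u n) <= B.
Proof.
  intros H; destruct (is_series_clim u l H 1 Rlt_0_1) as [N HN].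
  apply (bounded_of_eventually _ (S N) 2); intros [|n] Hn; [lia|].
  replace (u (S n)) with ((sum_n u (S n) - l) - (sum_n u n - l))%C.
  - assert (K1 := HN (S n) ltac:(lia)); assert (K2 := HN n ltac:(lia)).
    eapply Rle_trans; [apply Cmod_minus_le | lra].
  - rewrite sum_Sn; unfold plus; simpl; ring.
Qed.

Lemma sum_n_S_C (u : nat -> C) n : sum_n u (S n) = (sum_n u n + u (S n))%C.
Proof. rewrite sum_Sn; reflexivity. Qed.

Lemma sum_n_S_R (u : nat -> R) n : sum_n u (S n) = sum_n u n + u (S n).
Proof. rewrite sum_Sn; reflexivity. Qed.

Lemma Cmod_sum_n (u : nat -> C) n : Cmod (sum_n u n) <= sum_n (fun i => Cmod (u i)) n.
Proof.
  induction n as [|n IH]; [rewrite !sum_O; lra|].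
  rewrite sum_n_S_C, sum_n_S_R; eapply Rle_trans; [apply Cmod_triangle | lra].
Qed.

Lemma sum_n_geom_le (q : R) n : 0 <= q < 1 -> sum_n (fun i => q ^ i) n <= / (1 - q).
Proof.
  intros Hq.
  assert (E : sum_n (fun i => q ^ i) n * (1 - q) = 1 - q ^ S n).
  { induction n as [|n IH]; [rewrite sum_O; simpl; ring|].
    rewrite sum_n_S_R, Rmult_plus_distr_r, IH; simpl; ring. }
  apply Rmult_le_reg_r with (1 - q); [lra|]; rewrite E, Rinv_l by lra.
  assert (0 <= q ^ S n) by (apply pow_le; lra); lra.
Qed.

Lemma sum_n_le_R (u v : nat -> R) n :
  (forall i, (i <= n)%nat -> u i <= v i) -> sum_n u n <= sum_n v n.
Proof.
  induction n as [|n IH]; intros H; [rewrite !sum_O; apply H; lia|].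
  rewrite !sum_n_S_R; apply Rplus_le_compat; [apply IH; intros; apply H; lia | apply H; lia].
Qed.

Lemma sum_n_scal_R (c : R) (u : nat -> R) n : c * sum_n u n = sum_n (fun i => c * u i) n.
Proof.
  induction n as [|n IH]; [rewrite !sum_O; reflexivity|].
  rewrite !sum_n_S_R, <- IH; ring.
Qed.

Lemma Cmod_e (w : C) : Cmod (e w) = exp (- (2 * PI * Im w)).
Proof.
  unfold e; rewrite Cmod_Cexp; f_equal; unfold Re, Im; simpl; ring.
Qed.

Lemma Im_scaled (n : Z) (z : C) (M : nat) : (0 < M)%nat ->
  Im (IZR n * z / INR M) = IZR n * Im z / INR M.
Proof.
  intros HM; assert (0 < INR M) by (apply lt_0_INR, HM).
  unfold Cdiv; rewrite <- RtoC_inv by lra; rewrite im_scal_r, im_scal_l; reflexivity.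
Qed.

Lemma exp_mul_nat (n : nat) (x : R) : exp (INR n * x) = exp x ^ n.
Proof.
  induction n as [|n IH]; [simpl; rewrite Rmult_0_l; apply exp_0|].
  rewrite S_INR; replace ((INR n + 1) * x) with (x + INR n * x) by ring.
  rewrite exp_plus, IH; reflexivity.
Qed.

(** The terms of a convergent series are bounded, here at the point $iy_0$. The height is left free
    because each use takes it strictly below the height at which the series is then summed. *)
Lemma fourier_coeff_bound (M : nat) F c (y0 : R) : (0 < M)%nat -> fourier_expansion M F c ->
  0 < y0 -> exists B, 0 <= B /\ forall m,
    Cmod (c (Z.of_nat (S m))) <= B * exp (2 * PI * y0 / INR M) ^ S m.
Proof.
  intros HM HF Hy; assert (HMr : 0 < INR M) by (apply lt_0_INR, HM).
  destruct (series_terms_bounded _ _ (HF (0, y0) Hy)) as [B HB].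
  exists B; split; [eapply Rle_trans; [apply Cmod_ge_0 | apply (HB O)]|].
  intros m; specialize (HB m); cbv zeta in HB.
  rewrite Cmod_mult, Cmod_e, Im_scaled, <- INR_IZR_INZ in HB by exact HM.
  rewrite <- exp_mul_nat.
  replace (INR (S m) * (2 * PI * y0 / INR M))
    with (2 * PI * (INR (S m) * Im (0, y0) / INR M)) by (simpl Im; field; lra).
  set (t := 2 * PI * (INR (S m) * Im (0, y0) / INR M)) in *.
  apply Rmult_le_reg_r with (exp (- t)); [apply exp_pos|].
  rewrite Rmult_assoc, <- exp_plus, Rplus_opp_r, exp_0, Rmult_1_r; exact HB.
Qed.

(** Coefficients controlled at height 1/4 make the series at height at least 1/2 geometric, with
    ratio bounded away from 1. Since it starts at n = 1, one factor [q] comes out, and that factor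
    is the decay. *)
Lemma fourier_decay (M : nat) F c : (0 < M)%nat -> fourier_expansion M F c ->
  exists B del, 0 <= B /\ 0 < del /\
    forall z, / 2 <= Im z -> Cmod (F z) <= B * exp (- (del * Im z)).
Proof.
  intros HM HF; assert (HMr : 0 < INR M) by (apply lt_0_INR, HM).
  destruct (fourier_coeff_bound M F c (/ 4) HM HF) as (B & HB0 & HB); [lra|].
  assert (P := PI_RGT_0).
  set (del := 2 * PI / INR M); assert (Hd : 0 < del) by (apply Rdiv_lt_0_compat; lra).
  set (q0 := exp (- (del / 4))).
  assert (Hq0 : 0 < q0 < 1).
  { split; [apply exp_pos|]; rewrite <- exp_0; apply exp_increasing; lra. }
  exists (B * exp (del / 4) / (1 - q0)), del; split; [|split; [exact Hd|]].
  { apply Rmult_le_pos; [apply Rmult_le_pos; [exact HB0 | left; apply exp_pos]|].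
    left; apply Rinv_0_lt_compat; lra. }
  intros z Hz; assert (Hz' : upper_half_plane z) by (unfold upper_half_plane; lra).
  set (q := exp (- (del * (Im z - / 4)))).
  assert (Hq : 0 < q <= q0).
  { split; [apply exp_pos|]; apply exp_le; nra. }
  assert (Tm : forall m, Cmod (c (Z.of_nat (S m)) *
       e (IZR (Z.of_nat (S m)) * z / INR M))%C <= B * q * q ^ m).
  { intros m; rewrite Cmod_mult, Cmod_e, Im_scaled, <- INR_IZR_INZ by exact HM.
    replace (- (2 * PI * (INR (S m) * Im z / INR M))) with (INR (S m) * - (del * Im z))
      by (unfold del; field; lra).
    rewrite exp_mul_nat.
    apply Rle_trans with (B * exp (2 * PI * / 4 / INR M) ^ S m * exp (- (del * Im z)) ^ S m).
    - apply Rmult_le_compat_r; [left; apply pow_lt, exp_pos | apply HB].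
    - right; rewrite (Rmult_assoc B), <- Rpow_mult_distr, <- exp_plus.
      replace (2 * PI * / 4 / INR M + - (del * Im z)) with (- (del * (Im z - / 4)))
        by (unfold del; field; lra).
      fold q; simpl; ring. }
  apply (clim_le _ _ _ (is_series_clim _ _ (HF z Hz'))); intros n.
  eapply Rle_trans; [apply Cmod_sum_n|].
  eapply Rle_trans; [apply sum_n_le_R; intros i _; apply Tm|].
  rewrite <- sum_n_scal_R.
  assert (G := sum_n_geom_le q n ltac:(lra)).
  assert (G2 : / (1 - q) <= / (1 - q0)) by (apply Rinv_le_contravar; lra).
  replace (B * exp (del / 4) / (1 - q0) * exp (- (del * Im z)))
    with (B * (exp (del / 4) * exp (- (del * Im z))) * / (1 - q0)) by (unfold Rdiv; ring).
  rewrite <- exp_plus; replace (del / 4 + - (del * Im z)) with (- (del * (Im z - / 4)))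
    by field.
  fold q; apply Rmult_le_compat_l; [apply Rmult_le_pos; lra | eapply Rle_trans; [exact G | exact G2]].
Qed.

(** Half of the exponential absorbs one factor [y] and the other half goes to the induction
    hypothesis, which is why the rate is quantified after [n]. *)
Lemma pow_exp_bounded (n : nat) : forall a, 0 < a ->
  exists K, forall y, 0 <= y -> y ^ n * exp (- (a * y)) <= K.
Proof.
  induction n as [|n IH]; intros a Ha.
  - exists 1; intros y Hy; simpl; rewrite Rmult_1_l, <- exp_0; apply exp_le; nra.
  - destruct (IH (a / 2)) as [K HK]; [lra|].
    assert (K0 : 0 <= K).
    { eapply Rle_trans; [|apply (HK 0 (Rle_refl 0))].
      apply Rmult_le_pos; [apply pow_le; lra | left; apply exp_pos]. }
    exists (2 / a * K); intros y Hy.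
    replace (y ^ S n * exp (- (a * y))) with
      ((y * exp (- (a / 2 * y))) * (y ^ n * exp (- (a / 2 * y)))).
    + apply Rmult_le_compat; auto;
        [apply Rmult_le_pos; [exact Hy | left; apply exp_pos] |
         apply Rmult_le_pos; [apply pow_le, Hy | left; apply exp_pos] |].
      assert (E := exp_ineq1_le (a / 2 * y)).
      assert (E2 : exp (- (a / 2 * y)) * exp (a / 2 * y) = 1)
        by (rewrite <- exp_plus, Rplus_opp_l; apply exp_0).
      assert (E3 := exp_pos (- (a / 2 * y))).
      apply Rmult_le_reg_l with (a / 2); [lra|].
      replace (a / 2 * (2 / a)) with 1 by (field; lra); nra.
    + replace (- (a * y)) with (- (a / 2 * y) + - (a / 2 * y)) by field.
      rewrite exp_plus; simpl; ring.
Qed.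

(** * Automorphy factors *)

(** Through this lemma the estimates for [slash] and [theta_factor] become independent of the branch
    of the square root. *)
Lemma Cmod_Csqrt (w : C) : Cmod (Csqrt w) = sqrt (Cmod w).
Proof.
  set (m := Cmod w); assert (H := re_le_Cmod w); fold m in H.
  apply Rabs_le_between in H.
  assert (Hm : 0 <= m) by apply Cmod_ge_0.
  assert (S : Cmod (Csqrt w) * Cmod (Csqrt w) = m).
  { rewrite Cmod_sqr; unfold Csqrt; fold m.
    set (sg := if Rle_dec 0 (Im w) then 1 else -1).
    assert (Hs : sg * sg = 1) by (unfold sg; destruct Rle_dec; ring).
    change (sqrt ((m + Re w) / 2) * sqrt ((m + Re w) / 2) +
      sg * sqrt ((m - Re w) / 2) * (sg * sqrt ((m - Re w) / 2)) = m).
    replace (sg * sqrt ((m - Re w) / 2) * (sg * sqrt ((m - Re w) / 2)))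
      with (sg * sg * (sqrt ((m - Re w) / 2) * sqrt ((m - Re w) / 2))) by ring.
    rewrite Hs, !sqrt_sqrt by lra; field. }
  symmetry; rewrite <- S; apply sqrt_square, Cmod_ge_0.
Qed.

Lemma legendre_abs c p : (Z.abs (legendre c p) <= 1)%Z.
Proof.
  unfold legendre; destruct (_ =? 0)%Z; [simpl; lia|]; destruct List.existsb; simpl; lia.
Qed.

Lemma abs_pow_le_1 (x : Z) (n : nat) : (Z.abs x <= 1)%Z -> (Z.abs (x ^ Z.of_nat n) <= 1)%Z.
Proof.
  intros H; induction n as [|n IH]; [simpl; lia|].
  rewrite Nat2Z.inj_succ, Z.pow_succ_r, Z.abs_mul by lia; nia.
Qed.

Lemma jacobi_abs c n : (Z.abs (jacobi c n) <= 1)%Z.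
Proof.
  unfold jacobi; induction (prime.primes n) as [|p l IH]; simpl; [lia|].
  rewrite Z.abs_mul.
  assert (H := abs_pow_le_1 _ (prime.logn p n) (legendre_abs c p)); nia.
Qed.

Lemma shimura_symbol_abs c d : (Z.abs (shimura_symbol c d) <= 1)%Z.
Proof.
  unfold shimura_symbol; destruct andb; rewrite ?Z.abs_opp; apply jacobi_abs.
Qed.

Lemma Cmod_eps d : Cmod (eps d) = 1.
Proof. unfold eps; destruct (_ =? 1)%Z; [apply Cmod_1 | apply Cmod_Ci]. Qed.

(** Only an inequality, because the symbol is known merely to have absolute value at most 1. An
    upper bound is what [Phi_automorphic] asks for. *)
Lemma Cmod_theta_factor x z : Cmod (theta_factor x z) <= sqrt (Cmod (denom x z)).
Proof.
  unfold theta_factor; rewrite !Cmod_mult, Cmod_inv, Cmod_eps, Cmod_Csqrt, Cmod_R.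
  - rewrite <- abs_IZR; assert (H := IZR_le _ _ (shimura_symbol_abs (mc x) (md x))).
    assert (0 <= IZR (Z.abs (shimura_symbol (mc x) (md x)))) by (apply IZR_le; lia).
    generalize (sqrt_pos (Cmod (denom x z))); rewrite Rinv_1; nra.
  - apply Cmod_gt_0; rewrite Cmod_eps; lra.
Qed.

Lemma Cmod_automorphy_factor kappa x z :
  Cmod (automorphy_factor kappa x z) <= sqrt (Cmod (denom x z)) ^ kappa.
Proof.
  unfold automorphy_factor; destruct (Nat.even kappa) eqn:E.
  - right; rewrite Cmod_pow; apply Nat.even_spec in E; destruct E as [n ->].
    rewrite Nat.div2_double, pow_mult; f_equal; simpl; rewrite Rmult_1_r.
    symmetry; apply sqrt_sqrt, Cmod_ge_0.
  - rewrite Cmod_pow; apply pow_incr; split; [apply Cmod_ge_0 | apply Cmod_theta_factor].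
Qed.

Lemma exists_uniform_bound (N : nat) (P : nat -> R -> Prop) :
  (forall i K K', P i K -> K <= K' -> P i K') ->
  (forall i, (i < N)%nat -> exists K, P i K) ->
  exists K, forall i, (i < N)%nat -> P i K.
Proof.
  intros Mon H; induction N as [|N IH]; [exists 0; intros; lia|].
  destruct IH as [K1 H1]; [intros; apply H; lia|].
  destruct (H N) as [K2 H2]; [lia|].
  exists (Rmax K1 K2); intros i Hi; destruct (Nat.eq_dec i N) as [->|E].
  - eapply Mon; [exact H2 | apply Rmax_r].
  - eapply Mon; [apply H1; lia | apply Rmax_l].
Qed.

(* The powers chi(n)^m = chi(n^m) take finitely many values. *)
Lemma Cmod_dirichlet_character N chi n : (0 < N)%Z -> dirichlet_character N chi ->
  Cmod (chi n) <= 1.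
Proof.
  intros HN (Hmul & Hper & _).
  assert (Hmod : forall m, chi m = chi (m mod N)%Z).
  { assert (St : forall m (k : nat), chi (m + Z.of_nat k * N)%Z = chi m).
    { intros m k; induction k as [|k IH]; [f_equal; lia|].
      rewrite <- IH, <- (Hper (m + Z.of_nat k * N)%Z); f_equal; lia. }
    intros m; assert (E := Z.div_mod m N ltac:(lia)).
    destruct (Z.le_ge_cases 0 (m / N)) as [L|L].
    - rewrite E at 1; rewrite <- (St (m mod N)%Z (Z.to_nat (m / N))).
      f_equal; rewrite Z2Nat.id by exact L; lia.
    - rewrite <- (St m (Z.to_nat (- (m / N)))); f_equal; rewrite Z2Nat.id by lia; lia. }
  destruct (exists_uniform_bound (Z.to_nat N) (fun i K => Cmod (chi (Z.of_nat i)) <= K))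
    as [B HB]; [intros; lra | intros i _; eexists; apply Rle_refl|].
  assert (HB' : forall m, Cmod (chi m) <= B).
  { intros m; rewrite Hmod; assert (K := Z.mod_pos_bound m N HN).
    rewrite <- (Z2Nat.id (m mod N)) by lia; apply HB; lia. }
  assert (Hpow : forall k, Cmod (chi n) ^ S k <= B).
  { intros k; rewrite <- Cmod_pow; replace (chi n ^ S k)%C with (chi (n ^ Z.of_nat (S k))%Z);
      [apply HB'|].
    induction k as [|k IH]; [simpl; rewrite Cmult_1_r; f_equal; lia|].
    rewrite Cpow_S, <- IH, <- Hmul; f_equal.
    rewrite (Nat2Z.inj_succ (S k)), Z.pow_succ_r by lia; reflexivity. }
  apply Rnot_lt_le; intros L.
  destruct (Pow_x_infinity (Cmod (chi n))) with (b := B + 1) as [k Hk];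
    [rewrite Rabs_right; lra|].
  specialize (Hk (S k) ltac:(lia)); specialize (Hpow k).
  rewrite Rabs_right in Hk; [lra|]; apply Rle_ge, pow_le; lra.
Qed.

Lemma Cmod_nebentypus G chi n : nebentypus G chi -> Cmod (chi n) <= 1.
Proof.
  intros [H|(N & HN & _ & H)]; [rewrite H, Cmod_1; lra|].
  apply (Cmod_dirichlet_character N); assumption.
Qed.

(** * The modular action *)

Lemma IZR_det x : SL2Z x -> IZR (ma x) * IZR (md x) - IZR (mb x) * IZR (mc x) = 1.
Proof. intros H; rewrite <- !mult_IZR, <- minus_IZR; f_equal; exact H. Qed.

Lemma Im_denom x z : Im (denom x z) = IZR (mc x) * Im z.
Proof. unfold denom, Re, Im; simpl; ring. Qed.

Lemma Re_denom x z : Re (denom x z) = IZR (mc x) * Re z + IZR (md x).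
Proof. unfold denom, Re, Im; simpl; ring. Qed.

Lemma denom_neq_0 x z : SL2Z x -> upper_half_plane z -> denom x z <> 0.
Proof.
  intros Hx Hz E; assert (D := IZR_det x Hx).
  assert (E1 := f_equal Im E); assert (E2 := f_equal Re E).
  rewrite Im_denom in E1; rewrite Re_denom in E2; simpl in E1, E2.
  unfold upper_half_plane in Hz.
  assert (C0 : IZR (mc x) = 0) by (apply Rmult_integral in E1; destruct E1; lra).
  rewrite C0 in *; assert (IZR (md x) = 0) by lra; nra.
Qed.

Lemma Im_mobius x z : SL2Z x -> upper_half_plane z ->
  Im (mobius x z) = Im z / (Cmod (denom x z) * Cmod (denom x z)).
Proof.
  intros Hx Hz; assert (D := IZR_det x Hx).
  assert (Hd := proj1 (Cmod_gt_0 _) (denom_neq_0 x z Hx Hz)).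
  assert (P : 0 < Cmod (denom x z) * Cmod (denom x z)) by nra.
  rewrite Cmod_sqr, Re_denom, Im_denom in *.
  replace (Im z) with (Im z * (IZR (ma x) * IZR (md x) - IZR (mb x) * IZR (mc x)))
    at 1 by (rewrite D; ring).
  unfold mobius; destruct z as [u v]; unfold Re, Im in *; simpl in *; field.
  intros K; apply Rlt_not_eq in P; apply P; rewrite <- K; ring.
Qed.

Lemma mobius_upper x z : SL2Z x -> upper_half_plane z -> upper_half_plane (mobius x z).
Proof.
  intros Hx Hz; unfold upper_half_plane; rewrite Im_mobius by assumption.
  assert (Hd := proj1 (Cmod_gt_0 _) (denom_neq_0 x z Hx Hz)).
  apply Rdiv_lt_0_compat; [exact Hz | nra].
Qed.

Lemma SL2Z_mul x y : SL2Z x -> SL2Z y -> SL2Z (mat2_mul x y).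
Proof. unfold SL2Z, mat2_mul; simpl; intros Hx Hy; nia. Qed.

Lemma SL2Z_inv x : SL2Z x -> SL2Z (mat2_inv x).
Proof. unfold SL2Z, mat2_inv; simpl; intros; lia. Qed.

Lemma denom_mul x y z : SL2Z y -> upper_half_plane z ->
  denom (mat2_mul x y) z = (denom x (mobius y z) * denom y z)%C.
Proof.
  intros Hy Hz; assert (H := denom_neq_0 y z Hy Hz); unfold denom, mobius in *; simpl.
  rewrite !plus_IZR, !mult_IZR, !RtoC_plus, !RtoC_mult; field; exact H.
Qed.

Lemma mobius_mul x y z : SL2Z x -> SL2Z y -> upper_half_plane z ->
  mobius (mat2_mul x y) z = mobius x (mobius y z).
Proof.
  intros Hx Hy Hz; assert (H := denom_neq_0 y z Hy Hz).
  assert (H1 := denom_neq_0 x (mobius y z) Hx (mobius_upper y z Hy Hz)).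
  assert (H2 := denom_neq_0 (mat2_mul x y) z (SL2Z_mul x y Hx Hy) Hz).
  assert (E := denom_mul x y z Hy Hz).
  unfold mobius at 1 2; fold (denom (mat2_mul x y) z); fold (denom x (mobius y z)).
  rewrite E.
  replace (IZR (ma (mat2_mul x y)) * z + IZR (mb (mat2_mul x y)))%C
    with ((IZR (ma x) * mobius y z + IZR (mb x)) * denom y z)%C.
  - field; split; assumption.
  - unfold mobius; fold (denom y z); simpl.
    rewrite !plus_IZR, !mult_IZR, !RtoC_plus, !RtoC_mult.
    unfold denom in *; field; exact H.
Qed.

Lemma mat2_mul_inv_mul x y : SL2Z y -> mat2_mul (mat2_mul x (mat2_inv y)) y = x.
Proof.
  unfold SL2Z, mat2_mul, mat2_inv; destruct x as [a b c d], y as [a' b' c' d']; simpl.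
  intros H; f_equal.
  - replace a with (a * (a' * d' - b' * c'))%Z at 3 by (rewrite H; ring); ring.
  - replace b with (b * (a' * d' - b' * c'))%Z at 3 by (rewrite H; ring); ring.
  - replace c with (c * (a' * d' - b' * c'))%Z at 3 by (rewrite H; ring); ring.
  - replace d with (d * (a' * d' - b' * c'))%Z at 3 by (rewrite H; ring); ring.
Qed.

Lemma mobius_inv_mobius x z : SL2Z x -> upper_half_plane z ->
  mobius (mat2_inv x) (mobius x z) = z.
Proof.
  intros Hx Hz; rewrite <- mobius_mul by (auto; apply SL2Z_inv, Hx).
  assert (E : mat2_mul (mat2_inv x) x = Mat2 1 0 0 1).
  { unfold SL2Z in Hx; unfold mat2_mul, mat2_inv; destruct x as [a b c d]; simpl in *.
    f_equal; nia. }
  rewrite E; unfold mobius; simpl; field.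
Qed.

(* |f(z)|^2 (Im z)^k in weight k = kappa / 2. *)
Definition Phi (kappa : nat) (f : C -> C) (z : C) : R :=
  Cmod (f z) ^ 2 * sqrt (Im z) ^ kappa.

Lemma Phi_nonneg kappa f z : 0 <= Phi kappa f z.
Proof. apply Rmult_le_pos; apply pow_le; [apply Cmod_ge_0 | apply sqrt_pos]. Qed.

Lemma sqrt_Im_mobius x z : SL2Z x -> upper_half_plane z ->
  sqrt (Im (mobius x z)) = sqrt (Im z) / Cmod (denom x z).
Proof.
  intros Hx Hz; assert (Hd := proj1 (Cmod_gt_0 _) (denom_neq_0 x z Hx Hz)).
  rewrite Im_mobius by assumption; rewrite sqrt_div.
  - f_equal; apply sqrt_square; lra.
  - left; exact Hz.
  - nra.
Qed.

(** The factor $|cz+d|^{2k}$ from $|f|^2$ cancels against the one by which $(\mathrm{Im}\,z)^k$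
    shrinks. The relation is an inequality since the multipliers are only bounded by 1. *)
Lemma Phi_automorphic kappa G chi f x z :
  (forall n, Cmod (chi n) <= 1) -> cusp_form kappa G chi f -> G x -> SL2Z x ->
  upper_half_plane z -> Phi kappa f (mobius x z) <= Phi kappa f z.
Proof.
  intros Hchi (_ & Hf & _) Gx Hx Hz; unfold Phi.
  assert (Hd := proj1 (Cmod_gt_0 _) (denom_neq_0 x z Hx Hz)).
  rewrite Hf, sqrt_Im_mobius by assumption; set (D := Cmod (denom x z)) in *.
  assert (K : Cmod (chi (md x) * automorphy_factor kappa x z * f z)
              <= sqrt D ^ kappa * Cmod (f z)).
  { rewrite !Cmod_mult; apply Rmult_le_compat_r; [apply Cmod_ge_0|].
    rewrite <- (Rmult_1_l (sqrt D ^ kappa)).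
    apply Rmult_le_compat; try apply Cmod_ge_0; [apply Hchi | apply Cmod_automorphy_factor]. }
  apply Rle_trans with ((sqrt D ^ kappa * Cmod (f z)) ^ 2 * (sqrt (Im z) / D) ^ kappa).
  - apply Rmult_le_compat_r.
    + apply pow_le, Rmult_le_pos; [apply sqrt_pos | left; apply Rinv_0_lt_compat, Hd].
    + apply pow_incr; split; [apply Cmod_ge_0 | exact K].
  - right; unfold Rdiv; rewrite !Rpow_mult_distr, <- pow_mult, Nat.mul_comm, pow_mult, pow2_sqrt,
      pow_inv by lra; field; apply pow_nonzero; lra.
Qed.

Lemma sqrt_le_double y : / 2 <= y -> sqrt y <= 2 * y.
Proof.
  intros Hy; rewrite <- (sqrt_square (2 * y)) by lra; apply sqrt_le_1; nra.
Qed.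

(** Moving the cusp to infinity turns [Phi] into $|f|_kx|^2(\mathrm{Im}\,z)^k$, which decays
    exponentially because the expansion has no constant term. A single power of $\mathrm{Im}\,z$ is
    kept from this decay; at the cusp 0 it becomes the saving $|z|^2/y$. *)
Lemma Phi_cusp kappa G chi f x : cusp_form kappa G chi f -> SL2Z x ->
  exists K, forall z, / 2 <= Im z -> Phi kappa f (mobius x z) <= K / Im z.
Proof.
  intros (_ & _ & Hf) Hx; destruct (Hf x Hx) as (M & c & HM & HF).
  destruct (fourier_decay M _ c HM HF) as (B & del & HB & Hdel & Hdec).
  (* [kappa] powers majorize the half-integral power of the imaginary part through [sqrt_le_double];
     the extra one pays for the division by [Im z]. *)
  destruct (pow_exp_bounded (S kappa) (2 * del)) as [K HK]; [lra|].
  exists (B ^ 2 * (2 ^ kappa * K)); intros z Hz.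
  assert (Hz' : upper_half_plane z) by (unfold upper_half_plane; lra).
  assert (Hd := proj1 (Cmod_gt_0 _) (denom_neq_0 x z Hx Hz')).
  assert (D := Hdec z Hz); unfold slash in D.
  assert (Hs : 0 < sqrt (Cmod (denom x z)) ^ kappa) by (apply pow_lt, sqrt_lt_R0, Hd).
  rewrite Cmod_div, Cmod_pow, Cmod_Csqrt in D.
  2:{ apply Cmod_gt_0; rewrite Cmod_pow, Cmod_Csqrt; exact Hs. }
  assert (E : Phi kappa f (mobius x z) =
     (Cmod (f (mobius x z)) / sqrt (Cmod (denom x z)) ^ kappa) ^ 2 * sqrt (Im z) ^ kappa).
  { unfold Phi; rewrite sqrt_Im_mobius by assumption.
    unfold Rdiv; rewrite !Rpow_mult_distr, !pow_inv, <- pow_mult, (Nat.mul_comm kappa),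
      pow_mult, pow2_sqrt by lra; ring. }
  rewrite E; set (s := Cmod _ / _) in *.
  assert (Hs0 : 0 <= s) by (apply Rmult_le_pos; [apply Cmod_ge_0 | left; apply Rinv_0_lt_compat, Hs]).
  apply Rmult_le_reg_r with (Im z); [exact Hz'|].
  replace (B ^ 2 * (2 ^ kappa * K) / Im z * Im z) with (B ^ 2 * (2 ^ kappa * K))
    by (field; unfold upper_half_plane in Hz'; lra).
  apply Rle_trans with ((B * exp (- (del * Im z))) ^ 2 * ((2 * Im z) ^ kappa) * Im z).
  - apply Rmult_le_compat_r; [lra|].
    apply Rmult_le_compat; try (apply pow_le; auto using sqrt_pos).
    + apply pow_incr; auto.
    + apply pow_incr; split; [apply sqrt_pos | apply sqrt_le_double, Hz].
  - rewrite !Rpow_mult_distr.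
    replace (exp (- (del * Im z)) ^ 2) with (exp (- (2 * del * Im z)))
      by (simpl; rewrite Rmult_1_r, <- exp_plus; f_equal; ring).
    replace (B ^ 2 * exp (- (2 * del * Im z)) * (2 ^ kappa * Im z ^ kappa) * Im z)
      with (B ^ 2 * (2 ^ kappa * (Im z ^ S kappa * exp (- (2 * del * Im z)))))
      by (simpl; ring).
    apply Rmult_le_compat_l; [apply pow_le, HB|].
    apply Rmult_le_compat_l; [apply pow_le; lra|].
    apply HK; lra.
Qed.

Definition mod_entries (N : Z) (i j k l : nat) (x : mat2) : Prop :=
  (ma x mod N = Z.of_nat i /\ mb x mod N = Z.of_nat j /\
   mc x mod N = Z.of_nat k /\ md x mod N = Z.of_nat l)%Z.

(** Modulo N the two matrices agree, so the product is congruent to $yy^{-1}=1$. *)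
Lemma principal_Gamma_quotient N x y i j k l : (0 < N)%Z -> SL2Z x -> SL2Z y ->
  mod_entries N i j k l x -> mod_entries N i j k l y ->
  principal_Gamma N (mat2_mul x (mat2_inv y)).
Proof.
  intros HN Hx Hy (A1 & A2 & A3 & A4) (B1 & B2 & B3 & B4).
  assert (Dv : forall u v w, (u mod N = w -> v mod N = w -> exists q, u = v + q * N)%Z).
  { intros u v w Hu Hv; exists (u / N - v / N)%Z.
    assert (Eu := Z.div_mod u N ltac:(lia)); assert (Ev := Z.div_mod v N ltac:(lia)); lia. }
  destruct (Dv _ _ _ A1 B1) as [q1 E1]; destruct (Dv _ _ _ A2 B2) as [q2 E2].
  destruct (Dv _ _ _ A3 B3) as [q3 E3]; destruct (Dv _ _ _ A4 B4) as [q4 E4].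
  split; [apply SL2Z_mul; [exact Hx | apply SL2Z_inv, Hy]|].
  unfold SL2Z in Hy; unfold mat2_mul, mat2_inv; simpl; rewrite E1, E2, E3, E4.
  clear -Hy; destruct y as [a b c d]; simpl in *.
  repeat split.
  - exists (q1 * d - q2 * c)%Z; replace ((a + q1 * N) * d + (b + q2 * N) * - c - 1)%Z
      with (a * d - b * c - 1 + (q1 * d - q2 * c) * N)%Z by ring; lia.
  - exists (q2 * a - q1 * b)%Z; ring.
  - exists (q3 * d - q4 * c)%Z; ring.
  - exists (q4 * a - q3 * b)%Z; replace ((c + q3 * N) * - b + (d + q4 * N) * a - 1)%Z
      with (a * d - b * c - 1 + (q4 * a - q3 * b) * N)%Z by ring; lia.
Qed.

(* The bound of [Phi_cusp] depends only on x modulo the level. *)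
Lemma Phi_cusp_uniform kappa G chi f :
  congruence_subgroup G -> (forall n, Cmod (chi n) <= 1) -> cusp_form kappa G chi f ->
  exists K, 0 <= K /\ forall x z, SL2Z x -> / 2 <= Im z -> Phi kappa f (mobius x z) <= K / Im z.
Proof.
  intros (_ & _ & _ & _ & N & HN & HG) Hchi Hf.
  set (P := fun i j k l K => forall x z, SL2Z x -> mod_entries N i j k l x -> / 2 <= Im z ->
     Phi kappa f (mobius x z) <= K / Im z).
  assert (Mon : forall i j k l K K', P i j k l K -> K <= K' -> P i j k l K').
  { intros i j k l K K' H L x z Hx Hm Hz; eapply Rle_trans; [apply H; auto|].
    apply Rmult_le_compat_r; [left; apply Rinv_0_lt_compat; lra | exact L]. }
  (* If the class contains some y, then $x=(xy^{-1})y$ with the first factor in $\Gamma(N)$, hence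
     in [G], and [Phi_automorphic] transfers the bound of y. An empty class is bounded vacuously. *)
  assert (Ex : forall i j k l, exists K, P i j k l K).
  { intros i j k l; destruct (classic (exists y, SL2Z y /\ mod_entries N i j k l y))
      as [(y & Hy & Hm)|Hno].
    - destruct (Phi_cusp kappa G chi f y Hf Hy) as [K HK]; exists K; intros x z Hx Hmx Hz.
      assert (Hz' : upper_half_plane z) by (unfold upper_half_plane; lra).
      eapply Rle_trans; [|apply HK, Hz].
      assert (Gq := principal_Gamma_quotient N x y i j k l HN Hx Hy Hmx Hm).
      rewrite <- (mat2_mul_inv_mul x y Hy) at 1.
      rewrite mobius_mul; auto; [|apply Gq].
      apply (Phi_automorphic kappa G chi); auto; [apply Gq | apply mobius_upper; auto].
    - exists 0; intros x z Hx Hm; exfalso; eauto. }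
  set (n := Z.to_nat N).
  destruct (exists_uniform_bound n (fun i K => forall j, (j < n)%nat -> forall k, (k < n)%nat ->
     forall l, (l < n)%nat -> P i j k l K)) as [K HK].
  { intros i K K' H L j Hj k Hk l Hl; apply (Mon i j k l K); auto. }
  { intros i _; apply exists_uniform_bound.
    { intros j K K' H L k Hk l Hl; apply (Mon i j k l K); auto. }
    intros j _; apply exists_uniform_bound.
    { intros k K K' H L l Hl; apply (Mon i j k l K); auto. }
    intros k _; apply exists_uniform_bound.
    { intros l K K' H L; apply (Mon i j k l K); auto. }
    intros l _; apply Ex. }
  exists (Rmax K 0); split; [apply Rmax_r|]; intros x z Hx Hz.
  assert (R : forall u, (Z.to_nat (u mod N) < n)%nat /\ (u mod N = Z.of_nat (Z.to_nat (u mod N)))%Z).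
  { intros u; assert (B := Z.mod_pos_bound u N HN); unfold n; lia. }
  apply Rle_trans with (K / Im z).
  - apply (HK _ (proj1 (R (ma x))) _ (proj1 (R (mb x))) _ (proj1 (R (mc x))) _ (proj1 (R (md x))));
      [exact Hx | repeat split; apply R | exact Hz].
  - apply Rmult_le_compat_r; [left; apply Rinv_0_lt_compat; lra | apply Rmax_l].
Qed.

(** * Reduction to height 1/2 and the global bounds *)

Definition S_mat : mat2 := Mat2 0 (-1) 1 0.
Definition T_mat (n : Z) : mat2 := Mat2 1 n 0 1.

Lemma denom_S z : denom S_mat z = z.
Proof. unfold denom; simpl; ring. Qed.

Lemma mobius_T n z : mobius (T_mat n) z = (z + IZR n)%C.
Proof. unfold mobius; simpl; field. Qed.

(* If Im z < 1/2 and |Re z| <= 1/2, then z -> -1/z at least doubles Im z. *)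
Lemma reduction (m : nat) : forall z, upper_half_plane z -> / 2 <= 2 ^ m * Im z ->
  exists x, SL2Z x /\ / 2 <= Im (mobius x z).
Proof.
  induction m as [|m IH]; intros z Hz Hm.
  - exists (Mat2 1 0 0 1); split; [reflexivity|].
    replace (mobius (Mat2 1 0 0 1) z) with z by (unfold mobius; simpl; field).
    rewrite pow_O, Rmult_1_l in Hm; exact Hm.
  - destruct (Rle_lt_dec (/ 2) (Im z)) as [L|L].
    { exists (Mat2 1 0 0 1); split; [reflexivity|].
      replace (mobius (Mat2 1 0 0 1) z) with z by (unfold mobius; simpl; field); exact L. }
    assert (Tr : exists n : Z, Rabs (Re z + IZR n) <= / 2).
    { exists (- (up (Re z - / 2)))%Z; rewrite opp_IZR.
      destruct (archimed (Re z - / 2)); apply Rabs_le; lra. }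
    destruct Tr as [n Hn]; set (w := mobius (T_mat n) z).
    assert (HT : SL2Z (T_mat n)) by (unfold SL2Z, T_mat; cbn [ma mb mc md]; ring).
    assert (HS : SL2Z S_mat) by reflexivity.
    assert (Hw : upper_half_plane w) by (apply mobius_upper; assumption).
    assert (Ew : w = (z + IZR n)%C) by apply mobius_T.
    assert (Iw : Im w = Im z) by (rewrite Ew; unfold Im; simpl; ring).
    assert (Rw : Re w = Re z + IZR n) by (rewrite Ew; reflexivity).
    assert (Dw : Cmod w * Cmod w <= / 2).
    { rewrite Cmod_sqr, Iw, Rw; apply Rabs_le_between in Hn; unfold upper_half_plane in Hz; nra. }
    assert (Pw : 0 < Cmod w * Cmod w).
    { rewrite Cmod_sqr, Iw; unfold upper_half_plane in Hz; nra. }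
    destruct (IH (mobius S_mat w)) as (x & Hx & Bx).
    + apply mobius_upper; assumption.
    + rewrite Im_mobius, denom_S, Iw by assumption.
      apply Rle_trans with (2 ^ S m * Im z); [exact Hm|].
      simpl; unfold upper_half_plane in Hz.
      assert (Q : 2 <= / (Cmod w * Cmod w)).
      { rewrite <- (Rinv_inv 2); apply Rinv_le_contravar; lra. }
      assert (0 < 2 ^ m) by (apply pow_lt; lra).
      unfold Rdiv; assert (0 < 2 ^ m * Im z) by (apply Rmult_lt_0_compat; lra); nra.
    + exists (mat2_mul (mat2_mul x S_mat) (T_mat n)); split.
      * repeat apply SL2Z_mul; assumption.
      * rewrite mobius_mul, mobius_mul; auto using SL2Z_mul.
Qed.

(** Some [x] lifts z to height at least 1/2, and the uniform cusp bound is applied to the inverse of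
    [x]; as [x] is arbitrary in $\mathrm{SL}_2(\mathbb Z)$, uniformity is essential. The second
    bound is the cusp bound at $-1/z$, whose height is $y/|z|^2$; if that height is below 1/2, the
    first bound is stronger. *)
Theorem Phi_bound kappa G chi f :
  congruence_subgroup G -> (forall n, Cmod (chi n) <= 1) -> cusp_form kappa G chi f ->
  exists K, 0 <= K /\ forall z, upper_half_plane z ->
    Phi kappa f z <= K /\ Phi kappa f z <= K * (Cmod z * Cmod z) / Im z.
Proof.
  intros HG Hchi Hf; destruct (Phi_cusp_uniform kappa G chi f HG Hchi Hf) as (K & HK & H).
  assert (B : forall z, upper_half_plane z -> Phi kappa f z <= 2 * K).
  { intros z Hz; destruct (Pow_x_infinity 2) with (b := / Im z) as [m Hm];
      [rewrite Rabs_right; lra|].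
    specialize (Hm m (Nat.le_refl m)).
    assert (P2 : 0 < 2 ^ m) by (apply pow_lt; lra).
    rewrite Rabs_right in Hm by lra; unfold upper_half_plane in Hz.
    assert (E : / Im z * Im z = 1) by (apply Rinv_l; lra).
    destruct (reduction m z Hz) as (x & Hx & Bx); [nra|].
    rewrite <- (mobius_inv_mobius x z Hx Hz).
    eapply Rle_trans; [apply H; [apply SL2Z_inv, Hx | exact Bx]|].
    unfold Rdiv; rewrite Rmult_comm; apply Rmult_le_compat_r; [exact HK|].
    rewrite <- (Rinv_inv 2); apply Rinv_le_contravar; lra. }
  exists (2 * K); split; [lra|]; intros z Hz; split; [apply B, Hz|].
  assert (HS : SL2Z S_mat) by reflexivity.
  assert (Hw := mobius_upper S_mat z HS Hz).
  assert (Iw := Im_mobius S_mat z HS Hz); rewrite denom_S in Iw.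
  assert (Pz : 0 < Cmod z * Cmod z).
  { rewrite Cmod_sqr; unfold upper_half_plane in Hz; nra. }
  unfold upper_half_plane in Hz.
  replace (2 * K * (Cmod z * Cmod z) / Im z) with (2 * (K / Im (mobius S_mat z)))
    by (rewrite Iw; field; split; [lra|]; intros E; rewrite E in Pz; lra).
  destruct (Rle_lt_dec (/ 2) (Im (mobius S_mat z))) as [L|L].
  - assert (Q := H (mat2_inv S_mat) (mobius S_mat z) (SL2Z_inv _ HS) L).
    rewrite mobius_inv_mobius in Q by assumption.
    generalize (Phi_nonneg kappa f z); lra.
  - eapply Rle_trans; [apply B, Hz|].
    unfold upper_half_plane in Hw.
    assert (2 <= / Im (mobius S_mat z)).
    { rewrite <- (Rinv_inv 2); apply Rinv_le_contravar; lra. }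
    unfold Rdiv; nra.
Qed.

(** * Second moment of the partial sums *)

Definition unit_exp (t : R) : C := Cexp (0, 2 * PI * t).

Lemma unit_exp_eq (t : R) : unit_exp t = (cos (2 * PI * t), sin (2 * PI * t)).
Proof.
  unfold unit_exp, Cexp; apply injective_projections; unfold Re, Im; simpl;
    rewrite exp_0; ring.
Qed.

Lemma Cmod_unit_exp t : Cmod (unit_exp t) = 1.
Proof. unfold unit_exp; rewrite Cmod_Cexp; apply exp_0. Qed.

Lemma unit_exp_plus s t : unit_exp (s + t) = (unit_exp s * unit_exp t)%C.
Proof.
  unfold unit_exp; rewrite <- Cexp_plus; f_equal.
  apply injective_projections; simpl; ring.
Qed.

Lemma unit_exp_conj t : Cconj (unit_exp t) = unit_exp (- t).
Proof.
  rewrite !unit_exp_eq; replace (2 * PI * - t) with (- (2 * PI * t)) by ring.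
  rewrite cos_neg, sin_neg; reflexivity.
Qed.

(** Orthogonality in real form: the coefficient [v] is there because the cross terms in [parseval]
    are real parts of complex multiples of exponentials. *)
Lemma is_RInt_unit_exp (v : C) (d : Z) : d <> 0%Z ->
  is_RInt (fun x => Re (v * unit_exp (IZR d * x))) (- / 2) (/ 2) 0.
Proof.
  intros Hd; assert (D : IZR d <> 0) by (apply not_0_IZR, Hd).
  assert (P := PI_RGT_0).
  set (h := fun x => (Re v * sin (2 * PI * (IZR d * x)) + Im v * cos (2 * PI * (IZR d * x)))
                       / (2 * PI * IZR d)).
  assert (S0 : sin (2 * PI * (IZR d * / 2)) = 0).
  { apply sin_eq_0_1; exists d; field. }
  replace 0 with (minus (h (/ 2)) (h (- / 2))).
  - apply (is_RInt_ext (fun x => Re v * cos (2 * PI * (IZR d * x))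
                               - Im v * sin (2 * PI * (IZR d * x)))).
    { intros x _; rewrite unit_exp_eq; reflexivity. }
    apply (is_RInt_derive (V := R_CompleteNormedModule)).
    + intros x _; unfold h; auto_derive; trivial; field; lra.
    + intros x _; apply (ex_derive_continuous (K := R_AbsRing) (V := R_NormedModule)).
      auto_derive; trivial.
  - unfold h, minus, plus, opp; simpl.
    replace (2 * PI * (IZR d * - / 2)) with (- (2 * PI * (IZR d * / 2))) by ring.
    rewrite sin_neg, cos_neg, S0; field; lra.
Qed.

Lemma is_RInt_sum_n (F : nat -> R -> R) (a b : R) n :
  (forall i, (i <= n)%nat -> is_RInt (F i) a b 0) ->
  is_RInt (fun x => sum_n (fun i => F i x) n) a b 0.
Proof.
  induction n as [|n IH]; intros H.
  - apply (is_RInt_ext (F O)); [intros x _; rewrite sum_O; reflexivity | apply H; lia].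
  - apply (is_RInt_ext (fun x => plus (sum_n (fun i => F i x) n) (F (S n) x))).
    { intros x _; rewrite sum_Sn; reflexivity. }
    replace 0 with (plus 0 0) by (unfold plus; simpl; ring).
    apply (is_RInt_plus (V := R_NormedModule)); [apply IH; intros; apply H; lia | apply H; lia].
Qed.

Lemma Re_sum_n (u : nat -> C) (v : C) n :
  Re (sum_n u n * v) = sum_n (fun i => Re (u i * v)) n.
Proof.
  induction n as [|n IH]; [rewrite !sum_O; reflexivity|].
  rewrite sum_n_S_C, sum_n_S_R, <- IH; generalize (sum_n u n) (u (S n)).
  intros p q; unfold Re, Im; simpl; ring.
Qed.

Lemma Cmod_sqr_plus (s t : C) :
  Cmod (s + t) ^ 2 = Cmod s ^ 2 + Cmod t ^ 2 + 2 * Re (s * Cconj t).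
Proof. rewrite !Cmod2_alt; unfold Cconj, Re, Im; simpl; ring. Qed.

(** One exponential is added at a time; its frequency [S (S n)] differs from all earlier ones, so
    the cross term of [Cmod_sqr_plus] integrates to 0. Only finite sums occur here, and
    [second_moment] deals with truncation. *)
Theorem parseval (w : nat -> C) n :
  is_RInt (fun x => Cmod (sum_n (fun i => w i * unit_exp (INR (S i) * x))%C n) ^ 2)
    (- / 2) (/ 2) (sum_n (fun i => Cmod (w i) ^ 2) n).
Proof.
  assert (Sq : forall i x, Cmod (w i * unit_exp (INR (S i) * x)) ^ 2 = Cmod (w i) ^ 2)
    by (intros; rewrite Cmod_mult, Cmod_unit_exp, Rmult_1_r; reflexivity).
  assert (Cst : forall c : R, is_RInt (fun _ => c) (- / 2) (/ 2) c).
  { intros c; evar_last; [apply (is_RInt_const (V := R_NormedModule))|].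
    unfold scal; simpl; unfold mult; simpl; field. }
  induction n as [|n IH].
  - rewrite sum_O; apply (is_RInt_ext (fun _ => Cmod (w O) ^ 2)); [|apply Cst].
    intros x _; rewrite sum_O; symmetry; apply Sq.
  - rewrite sum_n_S_R.
    apply (is_RInt_ext (fun x => plus (plus (Cmod (sum_n (fun i => w i * unit_exp (INR (S i) * x))%C n) ^ 2)
       (Cmod (w (S n)) ^ 2))
       (scal 2 (sum_n (fun i => Re (w i * Cconj (w (S n)) *
                unit_exp (IZR (Z.of_nat (S i) - Z.of_nat (S (S n))) * x))) n)))).
    { intros x _; rewrite sum_n_S_C, Cmod_sqr_plus, Sq, Re_sum_n.
      rewrite (sum_n_ext (fun i => Re (w i * unit_exp (INR (S i) * x) *
                 Cconj (w (S n) * unit_exp (INR (S (S n)) * x))))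
        (fun i => Re (w i * Cconj (w (S n)) *
                unit_exp (IZR (Z.of_nat (S i) - Z.of_nat (S (S n))) * x)))); [reflexivity|].
      intros i; f_equal; rewrite Cmult_conj, unit_exp_conj.
      replace (IZR (Z.of_nat (S i) - Z.of_nat (S (S n))) * x)
        with (INR (S i) * x + - (INR (S (S n)) * x))
        by (rewrite minus_IZR, <- !INR_IZR_INZ; ring).
      rewrite unit_exp_plus; ring. }
    replace (sum_n (fun i => Cmod (w i) ^ 2) n + Cmod (w (S n)) ^ 2)
      with (plus (plus (sum_n (fun i => Cmod (w i) ^ 2) n) (Cmod (w (S n)) ^ 2)) (scal 2 0))
      by (unfold plus, scal; simpl; unfold mult; simpl; ring).
    apply (is_RInt_plus (V := R_NormedModule));
      [apply (is_RInt_plus (V := R_NormedModule)); [exact IH | apply Cst]|].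
    apply (is_RInt_scal (V := R_NormedModule)), is_RInt_sum_n.
    intros i Hi; apply is_RInt_unit_exp; lia.
Qed.

(** The Leibniz series cut after the term 1/13 gives 3.284. The purpose is $(\pi/2)^2\le3$ in
    [sin_sqr_lower]. *)
Lemma PI_upper : PI <= 33 / 10.
Proof.
  destruct (PI_ineq 3) as [_ H]; unfold tg_alt, PI_tg in H; simpl in H; lra.
Qed.

(** $\sin u\ge u-u^3/6\ge u/2$ as long as $u^2\le3$, which covers $0\le u\le\pi/2$. *)
Lemma sin_sqr_lower (t : R) : Rabs t <= PI / 2 -> t ^ 2 / 4 <= sin t ^ 2.
Proof.
  assert (B : forall u, 0 <= u <= PI / 2 -> u / 2 <= sin u).
  { intros u Hu; assert (P := PI_4).
    destruct (pre_sin_bound u 0) as [H _]; [lra|lra|].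
    unfold sin_approx, sin_term in H; simpl in H.
    assert (K := PI_upper); assert (u * u <= 3) by nra.
    nra. }
  intros Ht; destruct (Rle_lt_dec 0 t) as [L|L].
  - rewrite Rabs_right in Ht by lra; assert (K := B t (conj L Ht)); nra.
  - rewrite Rabs_left in Ht by lra; assert (K := B (- t) ltac:(lra)).
    rewrite sin_neg in K; nra.
Qed.

(** With $\rho=e^{-2\pi y}$ one has $|1-e(z)|^2=(1-\rho)^2+4\rho\sin^2\pi x$. The first term
    controls y through $1-\rho\ge y/2$, the second controls x through $\rho\ge e^{-2\pi}$; both use
    $y\le1$. *)
Lemma one_minus_e_lower (x y : R) : Rabs x <= / 2 -> 0 < y <= 1 ->
  exp (- (2 * PI)) * (x * x + y * y) <= Cmod (1 - e (x, y)) ^ 2.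
Proof.
  intros Hx Hy; assert (P3 := PI2_3_2).
  set (rho := exp (- (2 * PI * y))).
  assert (E : Cmod (1 - e (x, y)) ^ 2 = (1 - rho) ^ 2 + 4 * rho * sin (PI * x) ^ 2).
  { rewrite Cmod2_alt; unfold e.
    assert (A1 : Re (2 * PI * Ci * (x, y))%C = - (2 * PI * y)) by (unfold Re; simpl; ring).
    assert (A2 : Im (2 * PI * Ci * (x, y))%C = 2 * (PI * x)) by (unfold Im; simpl; ring).
    change (Re (1 - Cexp (2 * PI * Ci * (x, y)))) with (1 + - Re (Cexp (2 * PI * Ci * (x, y)))).
    change (Im (1 - Cexp (2 * PI * Ci * (x, y)))) with (0 + - Im (Cexp (2 * PI * Ci * (x, y)))).
    rewrite Re_Cexp, Im_Cexp, A1, A2; fold rho.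
    rewrite cos_2a_sin, sin_2a.
    assert (T : cos (PI * x) * cos (PI * x) = 1 - sin (PI * x) * sin (PI * x))
      by (generalize (sin2_cos2 (PI * x)); unfold Rsqr; lra).
    replace ((0 + - (rho * (2 * sin (PI * x) * cos (PI * x)))) ^ 2)
      with (4 * rho * rho * (sin (PI * x) * sin (PI * x)) * (cos (PI * x) * cos (PI * x))) by ring.
    rewrite T; ring. }
  rewrite E.
  assert (R1 : exp (- (2 * PI)) <= rho) by (apply exp_le; nra).
  assert (Hx2 := Rabs_pos x).
  assert (R0 := exp_pos (- (2 * PI))).
  assert (Sx := sin_sqr_lower (PI * x)).
  rewrite Rabs_mult, (Rabs_right PI) in Sx by lra.
  specialize (Sx ltac:(nra)); rewrite Rpow_mult_distr in Sx.
  assert (S1 : x * x <= sin (PI * x) ^ 2) by (assert (4 <= PI ^ 2) by nra; assert (0 <= x ^ 2) by nra; nra).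
  assert (S2 : exp (- (2 * PI)) * (x * x) <= rho * sin (PI * x) ^ 2)
    by (apply Rmult_le_compat; nra).
  assert (S3 : y / 2 <= 1 - rho).
  { assert (K := exp_ineq1_le (2 * PI * y)).
    assert (K2 : rho * exp (2 * PI * y) = 1)
      by (unfold rho; rewrite <- exp_plus, Rplus_opp_l; apply exp_0).
    assert (0 < rho) by apply exp_pos.
    assert (K3 : rho * (1 + 6 * y) <= 1).
    { rewrite <- K2; apply Rmult_le_compat_l; [lra|]; nra. }
    apply Rnot_lt_le; intros L.
    assert ((1 - y / 2) * (1 + 6 * y) < rho * (1 + 6 * y)) by (apply Rmult_lt_compat_r; lra).
    nra. }
  assert (S4 : exp (- (2 * PI)) <= / 4).
  { rewrite exp_Ropp; apply Rinv_le_contravar; [lra|].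
    generalize (exp_ineq1_le (2 * PI)); lra. }
  assert (S5 : 0 <= rho * sin (PI * x) ^ 2).
  { apply Rle_trans with (exp (- (2 * PI)) * (x * x)); [nra | exact S2]. }
  assert (S6 : exp (- (2 * PI)) * (y * y) <= (1 - rho) ^ 2) by nra.
  lra.
Qed.

(** The kernel that remains after the saving at the cusp 0. With $s=\sqrt y$ and the arctangent at
    most $\pi/2$, the integral is at most $\pi y^{-1/2}$. *)
Lemma is_RInt_cauchy (s : R) : 0 < s ->
  is_RInt (fun x => / (x * x + s * s)) (- / 2) (/ 2) (2 / s * atan (/ 2 / s)).
Proof.
  intros Hs; set (h := fun x => / s * atan (x / s)).
  replace (2 / s * atan (/ 2 / s)) with (minus (h (/ 2)) (h (- / 2))).
  - apply (is_RInt_derive (V := R_CompleteNormedModule)).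
    + intros x _; unfold h; auto_derive; trivial; field; split; nra.
    + intros x _; apply (ex_derive_continuous (K := R_AbsRing) (V := R_NormedModule)).
      auto_derive; nra.
  - unfold h, minus, plus, opp; simpl.
    replace (- / 2 / s) with (- (/ 2 / s)) by (field; lra).
    rewrite atan_opp; field; lra.
Qed.

Lemma linear_geom_small (E r eps : R) : 0 <= E -> 0 < r < 1 -> 0 < eps ->
  exists N, forall n, (N <= n)%nat -> E * (INR (S n) * r ^ n) <= eps.
Proof.
  intros HE Hr Heps; set (q := sqrt r).
  assert (Hq : 0 < q) by (apply sqrt_lt_R0; lra).
  assert (Hqq : q * q = r) by (apply sqrt_sqrt; lra).
  assert (Hq1 : q < 1) by nra.
  destruct (pow_exp_bounded 1 (- ln q)) as [K HK].
  { assert (ln q < ln 1) by (apply ln_increasing; lra); rewrite ln_1 in *; lra. }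
  assert (HK' : forall n, INR n * q ^ n <= K).
  { intros n; specialize (HK (INR n) (pos_INR n)); rewrite pow_1 in HK.
    replace (- (- ln q * INR n)) with (INR n * ln q) in HK by ring.
    rewrite exp_mul_nat, exp_ln in HK by exact Hq; exact HK. }
  assert (K0 : 0 <= K) by (specialize (HK' O); simpl in HK'; lra).
  destruct (pow_lt_1_zero q) with (y := eps / (E * (K + 1) + 1)) as [N HN].
  { rewrite Rabs_right; lra. }
  { apply Rdiv_lt_0_compat; [exact Heps|]; nra. }
  exists N; intros n Hn; specialize (HN n Hn).
  assert (Q : 0 < q ^ n) by (apply pow_lt, Hq).
  rewrite Rabs_right in HN by lra.
  assert (Q1 : q ^ n <= 1) by (rewrite <- (pow1 n); apply pow_incr; lra).
  rewrite S_INR, <- Hqq, Rpow_mult_distr; specialize (HK' n).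
  assert (A1 : (INR n + 1) * (q ^ n * q ^ n) <= (K + 1) * q ^ n) by nra.
  apply Rle_trans with (E * (K + 1) * q ^ n).
  - rewrite Rmult_assoc; apply Rmult_le_compat_l; assumption.
  - assert (D : 0 < E * (K + 1) + 1) by nra.
    apply Rle_trans with ((E * (K + 1) + 1) * (eps / (E * (K + 1) + 1))).
    + apply Rmult_le_compat; nra.
    + right; field; lra.
Qed.

(* The partial sum a(1) + ... + a(n + 1). *)
Definition psum (a : Z -> C) (n : nat) : C := sum_n (fun m => a (Z.of_nat (S m))) n.

Lemma e_pow (x y : R) (n : nat) :
  (e (x, y) ^ n)%C = (exp (- (2 * PI * y)) ^ n * unit_exp (INR n * x))%C.
Proof.
  assert (E : e (x, y) = (exp (- (2 * PI * y)) * unit_exp x)%C).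
  { rewrite unit_exp_eq; unfold e, Cexp.
    replace (Re (2 * PI * Ci * (x, y))) with (- (2 * PI * y)) by (unfold Re; simpl; ring).
    replace (Im (2 * PI * Ci * (x, y))) with (2 * PI * x) by (unfold Im; simpl; ring).
    reflexivity. }
  rewrite E, Cpow_mult_l; f_equal.
  unfold unit_exp; rewrite Cexp_pow; f_equal.
  apply injective_projections; simpl; ring.
Qed.

Lemma e_scaled (z : C) (n : Z) : (0 <= n)%Z -> e (IZR n * z / INR 1) = (e z ^ Z.to_nat n)%C.
Proof.
  intros Hn; unfold e; rewrite Cexp_pow; f_equal.
  rewrite (INR_IZR_INZ (Z.to_nat n)), Z2Nat.id by exact Hn; simpl; field.
Qed.

(** Truncation of $(1-q)\sum A(n)q^n=\sum a(n)q^n$; the last term is the cost of stopping at L. *)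
Lemma psum_power_series (u : nat -> C) (q : C) (L : nat) :
  ((1 - q) * sum_n (fun i => sum_n u i * q ^ S i) L =
   sum_n (fun i => u i * q ^ S i) L - sum_n u L * q ^ S (S L))%C.
Proof.
  induction L as [|L IH]; [rewrite !sum_O; simpl; ring|].
  rewrite !sum_n_S_C, Cmult_plus_distr_l, IH.
  generalize (sum_n u L) (sum_n (fun i : nat => (u i * q ^ S i)%C) L); intros p s.
  simpl; ring.
Qed.

(** The two bounds of [Phi_bound] add up to $|f|^2y^k(x^2+y)\le2K_0|z|^2$. Division by
    $|1-e(z)|^2\ge c|z|^2$ majorizes the squared generating function of the partial sums by a
    multiple of $y^{-k}/(x^2+y)$. Since [parseval] concerns finite sums, the truncation errors must
    be small uniformly in x. *)
Theorem second_moment kappa G chi f a :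
  congruence_subgroup G -> (forall n, Cmod (chi n) <= 1) -> cusp_form kappa G chi f ->
  fourier_expansion 1 f a ->
  exists K, 0 <= K /\ forall y L, 0 < y <= 1 ->
    sum_n (fun i => Cmod (psum a i) ^ 2 * exp (- (4 * PI * y)) ^ S i) L <= K / sqrt y ^ S kappa.
Proof.
  intros HG Hchi Hf Ha.
  destruct (Phi_bound kappa G chi f HG Hchi Hf) as (K0 & HK0 & HPhi).
  assert (P := PI_RGT_0).
  set (c := exp (- (2 * PI))); assert (Hc : 0 < c) by apply exp_pos.
  exists (4 * K0 / c * PI); split.
  { apply Rmult_le_pos; [apply Rmult_le_pos; [lra | left; apply Rinv_0_lt_compat, Hc] | lra]. }
  intros y L0 Hy; set (s := sqrt y).
  assert (Hs : 0 < s) by (apply sqrt_lt_R0; lra).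
  assert (Hss : s * s = y) by (apply sqrt_sqrt; lra).
  assert (Hsk : 0 < s ^ kappa) by (apply pow_lt, Hs).
  set (u := fun m : nat => a (Z.of_nat (S m))).
  set (r := exp (- (PI * y))); set (rho := exp (- (2 * PI * y))).
  assert (Hr : 0 < r < 1).
  { split; [apply exp_pos|]; unfold r; rewrite <- exp_0; apply exp_increasing; nra. }
  assert (Hrr : rho = r * r) by (unfold rho, r; rewrite <- exp_plus; f_equal; ring).
  (* Controlled at height y/2, the coefficients grow at most like $r^{-m}$; at height y the
     exponentials have size $\rho^m=r^{2m}$, so a factor $r^m$ remains for convergence. *)
  destruct (fourier_coeff_bound 1 f a (y / 2)) as (B & HB0 & HB); [lia | exact Ha | lra|].
  assert (Hu : forall m, Cmod (u m) <= B * (/ r) ^ S m).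
  { intros m; eapply Rle_trans; [apply HB|]; right; do 2 f_equal.
    unfold r; rewrite <- exp_Ropp; f_equal; simpl; field. }
  assert (Hq : forall x, Cmod (e (x, y)) = rho) by (intros x; apply Cmod_e).
  assert (Hr' : forall m, (/ r) ^ m * rho ^ m = r ^ m).
  { intros m; rewrite <- Rpow_mult_distr; f_equal; rewrite Hrr; field; lra. }
  assert (Ht : forall x m, Cmod (u m * e (x, y) ^ S m) <= B * r ^ S m).
  { intros x m; rewrite Cmod_mult, Cmod_pow, Hq, <- Hr', <- Rmult_assoc.
    apply Rmult_le_compat_r; [left; apply pow_lt, exp_pos | apply Hu]. }
  assert (HA : forall n, Cmod (sum_n u n) <= INR (S n) * (B * (/ r) ^ S n)).
  { assert (Hir : 1 <= / r) by (rewrite <- Rinv_1; apply Rinv_le_contravar; lra).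
    induction n as [|n IH].
    - rewrite sum_O; eapply Rle_trans; [apply Hu | simpl INR; lra].
    - rewrite sum_n_S_C; eapply Rle_trans; [apply Cmod_triangle|].
      assert (Hi : (/ r) ^ S n <= (/ r) ^ S (S n)) by (apply Rle_pow; [exact Hir | lia]).
      assert (I1 : INR (S n) * (B * (/ r) ^ S n) <= INR (S n) * (B * (/ r) ^ S (S n))).
      { apply Rmult_le_compat_l; [apply pos_INR|]; apply Rmult_le_compat_l; assumption. }
      specialize (Hu (S n)); rewrite (S_INR (S n)); lra. }
  set (fL := fun x L => sum_n (fun i => u i * e (x, y) ^ S i)%C L).
  assert (Htail : forall x L, Cmod (f (x, y) - fL x L) <= B / (1 - r) * r ^ L).
  { intros x L.
    (* Subtracting the remaining geometric tail makes the estimate inductive in d; it is dropped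
       once the limit is taken. *)
    assert (D : forall d, Cmod (fL x (L + d)%nat - fL x L) <=
                B / (1 - r) * r ^ L - B / (1 - r) * r ^ (L + d)).
    { induction d as [|d IH].
      - rewrite Nat.add_0_r; replace (fL x L - fL x L)%C with (RtoC 0) by ring.
        rewrite Cmod_0; lra.
      - rewrite Nat.add_succ_r; unfold fL at 1; rewrite sum_n_S_C; fold (fL x (L + d)%nat).
        replace (fL x (L + d)%nat + u (S (L + d)) * e (x, y) ^ S (S (L + d)) - fL x L)%C
          with ((fL x (L + d)%nat - fL x L) + u (S (L + d)) * e (x, y) ^ S (S (L + d)))%C by ring.
        eapply Rle_trans; [apply Cmod_triangle|].
        specialize (Ht x (S (L + d))).
        set (v := r ^ (L + d)) in *.
        assert (Hv : 0 <= v) by (apply pow_le; lra).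
        replace (r ^ S (L + d)) with (r * v) by reflexivity.
        replace (r ^ S (S (L + d))) with (r * (r * v)) in Ht by reflexivity.
        assert (T1 : B / (1 - r) * v - B / (1 - r) * (r * v) = B * v) by (field; lra).
        assert (T2 : B * (r * (r * v)) <= B * v).
        { apply Rmult_le_compat_l; [exact HB0|]; assert (r * v <= v) by nra; nra. }
        lra. }
    assert (Ser : clim (fL x) (f (x, y))).
    { assert (K := Ha (x, y) (proj1 Hy)); apply is_series_clim in K.
      intros eps Heps; destruct (K eps Heps) as [N HN]; exists N; intros n Hn.
      specialize (HN n Hn); unfold fL.
      rewrite (sum_n_ext _ (fun m : nat => let n := Z.of_nat (S m) in
                (a n * e (IZR n * (x, y) / INR 1))%C)); [exact HN|].
      intros m; cbv zeta; rewrite e_scaled by lia; rewrite Nat2Z.id; reflexivity. }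
    apply le_of_le_plus_eps; intros eps Heps; destruct (Ser eps Heps) as [N HN].
    specialize (HN (L + N)%nat ltac:(lia)); specialize (D N).
    replace (f (x, y) - fL x L)%C
      with ((fL x (L + N)%nat - fL x L) - (fL x (L + N)%nat - f (x, y)))%C by ring.
    eapply Rle_trans; [apply Cmod_minus_le|].
    assert (0 <= B / (1 - r) * r ^ (L + N)).
    { apply Rmult_le_pos; [apply Rmult_le_pos; [exact HB0 | left; apply Rinv_0_lt_compat; lra] |
        apply pow_le; lra]. }
    lra. }
  set (E := B / (1 - r) + B).
  set (PL := fun x L => sum_n (fun i => sum_n u i * e (x, y) ^ S i)%C L).
  assert (HPL : forall x L, Cmod (1 - e (x, y)) * Cmod (PL x L) <=
                 Cmod (f (x, y)) + E * (INR (S L) * r ^ L)).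
  { intros x L; rewrite <- Cmod_mult; unfold PL; rewrite psum_power_series.
    fold (fL x L); eapply Rle_trans; [apply Cmod_minus_le|].
    assert (T1 := Cmod_triangle_sub (fL x L) (f (x, y))).
    rewrite Cmod_minus_sym in T1; specialize (Htail x L).
    assert (T2 : Cmod (sum_n u L * e (x, y) ^ S (S L)) <= B * (INR (S L) * r ^ L)).
    { rewrite Cmod_mult, Cmod_pow, Hq.
      apply Rle_trans with (INR (S L) * (B * (/ r) ^ S L) * rho ^ S (S L)).
      - apply Rmult_le_compat_r; [left; apply pow_lt, exp_pos | apply HA].
      - replace (rho ^ S (S L)) with (rho ^ S L * (r * r)) by (rewrite <- Hrr; simpl; ring).
        replace (INR (S L) * (B * (/ r) ^ S L) * (rho ^ S L * (r * r)))
          with (B * (INR (S L) * ((/ r) ^ S L * rho ^ S L * (r * r)))) by ring.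
        rewrite Hr'; apply Rmult_le_compat_l; [exact HB0|].
        apply Rmult_le_compat_l; [apply pos_INR|].
        assert (0 < r ^ L) by (apply pow_lt; lra); simpl.
        assert (r * (r * r) <= 1) by nra; nra. }
    assert (T3 : B / (1 - r) * r ^ L <= B / (1 - r) * (INR (S L) * r ^ L)).
    { apply Rmult_le_compat_l;
        [apply Rmult_le_pos; [exact HB0 | left; apply Rinv_0_lt_compat; lra]|].
      rewrite S_INR; assert (0 < r ^ L) by (apply pow_lt; lra); generalize (pos_INR L); nra. }
    unfold E; lra. }
  assert (HE : 0 <= E).
  { unfold E; assert (0 <= B / (1 - r)); [|lra].
    apply Rmult_le_pos; [exact HB0 | left; apply Rinv_0_lt_compat; lra]. }
  apply le_of_le_plus_eps; intros eps Heps.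
  set (del := Rmin 1 (eps / 2)).
  assert (Hdel : 0 < del) by (apply Rmin_pos; lra).
  assert (Hdel2 : 2 * (del * del) <= eps).
  { assert (del <= 1) by apply Rmin_l; assert (del <= eps / 2) by apply Rmin_r; nra. }
  assert (Hrho : 0 < rho < 1) by (rewrite Hrr; nra).
  (* For every x the divisor satisfies $|1-e(z)|\ge1-\rho$, so this choice makes the truncation
     error at most [del] times the divisor. *)
  destruct (linear_geom_small E r (del * (1 - rho)) HE Hr) as [N HN]; [nra|].
  set (L := Nat.max L0 N); specialize (HN L (Nat.le_max_r _ _)).
  set (w := fun i => (sum_n u i * rho ^ S i)%C).
  assert (Hw : forall i, Cmod (w i) ^ 2 = Cmod (psum a i) ^ 2 * exp (- (4 * PI * y)) ^ S i).
  { intros i; unfold w; rewrite Cmod_mult, <- RtoC_pow, Cmod_R, Rabs_right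
      by (apply Rle_ge, pow_le; lra).
    rewrite Rpow_mult_distr; f_equal; rewrite <- pow_mult, Nat.mul_comm, pow_mult; f_equal.
    unfold rho; simpl; rewrite Rmult_1_r, <- exp_plus; f_equal; ring. }
  assert (Mono : sum_n (fun i => Cmod (psum a i) ^ 2 * exp (- (4 * PI * y)) ^ S i) L0
             <= sum_n (fun i => Cmod (w i) ^ 2) L).
  { assert (Md : forall d, sum_n (fun i => Cmod (psum a i) ^ 2 * exp (- (4 * PI * y)) ^ S i) L0
             <= sum_n (fun i => Cmod (w i) ^ 2) (L0 + d)).
    { induction d as [|d IH].
      - rewrite Nat.add_0_r; apply sum_n_le_R; intros i _; rewrite Hw; lra.
      - rewrite Nat.add_succ_r, sum_n_S_R; assert (0 <= Cmod (w (S (L0 + d))) ^ 2)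
          by apply pow2_ge_0; lra. }
    replace L with (L0 + (L - L0))%nat by (unfold L; lia); apply Md. }
  eapply Rle_trans; [exact Mono|].
  assert (Int := parseval w L).
  (* The 4 is a product of two factors 2: one from adding the two bounds on [Phi], one from
     $(F+\delta m)^2\le2F^2+2\delta^2m^2$, whose second half leaves the constant $2\delta^2$. *)
  assert (Maj : is_RInt (fun x => plus (scal (4 * K0 / (c * s ^ kappa)) (/ (x * x + s * s)))
             (2 * (del * del))) (- / 2) (/ 2)
             (plus (scal (4 * K0 / (c * s ^ kappa)) (2 / s * atan (/ 2 / s)))
               (scal (/ 2 - - / 2) (2 * (del * del))))).
  { apply (is_RInt_plus (V := R_NormedModule)).
    - apply (is_RInt_scal (V := R_NormedModule)), is_RInt_cauchy, Hs.
    - apply (is_RInt_const (V := R_NormedModule)). }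
  assert (Cmp := is_RInt_le _ _ (- / 2) (/ 2) _ _ ltac:(lra) Int Maj).
  lapply Cmp; [clear Cmp; intros Cmp|].
  - eapply Rle_trans; [exact Cmp|]; unfold plus, scal; simpl; unfold mult; simpl.
    assert (At : atan (/ 2 / s) <= PI / 2) by (left; apply atan_bound).
    assert (K4 : 0 <= 4 * K0 / (c * s ^ kappa)).
    { apply Rmult_le_pos; [lra|]; left; apply Rinv_0_lt_compat, Rmult_lt_0_compat; assumption. }
    assert (T : 4 * K0 / (c * s ^ kappa) * (2 / s * atan (/ 2 / s)) <=
                4 * K0 / (c * s ^ kappa) * (2 / s * (PI / 2))).
    { apply Rmult_le_compat_l; [exact K4|]; apply Rmult_le_compat_l; [|exact At].
      left; apply Rdiv_lt_0_compat; lra. }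
    replace (4 * K0 / (c * s ^ kappa) * (2 / s * (PI / 2))) with (4 * K0 / c * PI / (s * s ^ kappa))
      in T by (field; repeat split; lra).
    lra.
  - intros x Hx; unfold plus, scal; simpl; unfold mult; simpl.
    assert (Hx' : Rabs x <= / 2) by (apply Rabs_le; lra).
    rewrite (sum_n_ext _ (fun i => sum_n u i * e (x, y) ^ S i)%C).
    2:{ intros i; unfold w; rewrite e_pow, Cmult_assoc; reflexivity. }
    fold (PL x L); specialize (HPL x L).
    assert (Low := one_minus_e_lower x y Hx' Hy); fold c in Low.
    set (m := Cmod (1 - e (x, y))) in *; set (p := Cmod (PL x L)) in *.
    set (F := Cmod (f (x, y))) in *.
    assert (Hm : 1 - rho <= m).
    { assert (T := Cmod_triangle_sub 1 (e (x, y))); rewrite Hq, Cmod_1 in T; fold m in T; lra. }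
    assert (Hp : 0 <= p) by apply Cmod_ge_0.
    assert (HF : 0 <= F) by apply Cmod_ge_0.
    destruct (HPhi (x, y) (proj1 Hy)) as [Q1 Q2]; unfold Phi in Q1, Q2; fold F in Q1, Q2.
    rewrite Cmod_sqr in Q2; simpl Im in Q1, Q2; simpl Re in Q2; fold s in Q1, Q2.
    set (X := x * x + y * y) in *; set (Z := x * x + s * s).
    assert (HZ : 0 < Z) by (unfold Z; nra).
    assert (HX : 0 < X) by (unfold X; nra).
    assert (HXZ : Z <= X + y) by (unfold X, Z; nra).
    assert (Q3 : F ^ 2 * s ^ kappa * Z <= 2 * K0 * X).
    { assert (Q4 : F ^ 2 * s ^ kappa * y <= K0 * X).
      { apply Rle_trans with (K0 * X / y * y);
          [apply Rmult_le_compat_r; lra | right; field; lra]. }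
      assert (Q5 : F ^ 2 * s ^ kappa * X <= K0 * X) by (apply Rmult_le_compat_r; lra).
      assert (0 <= F ^ 2 * s ^ kappa) by (apply Rmult_le_pos; [apply pow2_ge_0 | lra]); nra. }
    assert (Q6 : F ^ 2 * (c * s ^ kappa * Z) <= 2 * K0 * m ^ 2).
    { apply Rle_trans with (c * (2 * K0 * X)); [|nra].
      replace (F ^ 2 * (c * s ^ kappa * Z)) with (c * (F ^ 2 * s ^ kappa * Z)) by ring.
      apply Rmult_le_compat_l; lra. }
    assert (HW : 0 < c * s ^ kappa * Z) by (repeat apply Rmult_lt_0_compat; assumption).
    set (W := c * s ^ kappa * Z) in *.
    replace (4 * K0 / (c * s ^ kappa) * / Z) with (4 * K0 / W)
      by (unfold W; field; repeat split; lra).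
    assert (Q7 : F ^ 2 <= 2 * K0 * m ^ 2 / W).
    { apply Rmult_le_reg_r with W; [exact HW|]; unfold Rdiv.
      rewrite Rmult_assoc, Rinv_l, Rmult_1_r by lra; exact Q6. }
    assert (Hm0 : 0 < m) by lra.
    assert (Q8 : m * p <= F + del * m) by nra.
    assert (Q9 : (m * p) ^ 2 <= 2 * F ^ 2 + 2 * (del * m) ^ 2).
    { apply Rle_trans with ((F + del * m) ^ 2).
      - apply pow_incr; split; [nra | exact Q8].
      - generalize (pow2_ge_0 (F - del * m)); nra. }
    apply Rmult_le_reg_l with (m ^ 2); [nra|].
    apply Rle_trans with (2 * (2 * K0 * m ^ 2 / W) + 2 * (del * m) ^ 2); [nra|].
    right; field; lra.
Qed.

(** * Dirichlet series *)

Lemma sum_n_single_le (u : nat -> R) j n : (j <= n)%nat -> (forall i, 0 <= u i) -> u j <= sum_n u n.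
Proof.
  intros Hj Hu.
  assert (Pos : forall m, 0 <= sum_n u m).
  { induction m as [|m IH]; [rewrite sum_O; apply Hu|].
    rewrite sum_n_S_R; specialize (Hu (S m)); lra. }
  induction n as [|n IH].
  - replace j with O by lia; rewrite sum_O; lra.
  - rewrite sum_n_S_R; destruct (Nat.eq_dec j (S n)) as [->|E].
    + specialize (Pos n); lra.
    + specialize (IH ltac:(lia)); specialize (Hu (S n)); lra.
Qed.

(** The bound [j <= n] keeps the exponent within the finite range of j summed over in
    [dirichlet_abs_bound]. *)
Lemma exists_power4 (n : nat) : (1 <= n)%nat ->
  exists j, (j <= n)%nat /\ INR n <= 4 ^ j /\ 4 ^ j <= 4 * INR n.
Proof.
  induction n as [|n IH]; intros Hn; [lia|].
  destruct n as [|n].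
  { exists O; simpl; split; [lia | lra]. }
  destruct IH as (j & J1 & J2 & J3); [lia|].
  assert (P1 : 1 <= INR (S n)) by (apply (le_INR 1); lia).
  destruct (Rle_lt_dec (INR (S (S n))) (4 ^ j)) as [L|L].
  - exists j; split; [lia|]; rewrite (S_INR (S n)) in *; split; lra.
  - exists (S j); split; [lia|]; rewrite (S_INR (S n)) in *; simpl pow; split; lra.
Qed.

(* Dyadic decomposition: n^-beta is at most a constant times
   sum_j 4^(- j beta) exp(- 4 pi n 4^-j). *)
Lemma dirichlet_abs_bound (v : nat -> R) (K beta : R) (p : nat) :
  (forall i, 0 <= v i) -> 0 <= K -> INR p / 2 < beta ->
  (forall y L, 0 < y <= 1 ->
     sum_n (fun i => v i * exp (- (4 * PI * y)) ^ S i) L <= K / sqrt y ^ p) ->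
  exists K', 0 <= K' /\ forall L, sum_n (fun i => v i * exp (- (beta * ln (INR (S i))))) L <= K'.
Proof.
  intros Hv HK Hbeta H.
  assert (Pi := PI_RGT_0).
  assert (B0 : 0 <= beta) by (generalize (pos_INR p); lra).
  set (q4 := exp (- (beta * ln 4))).
  (* Passing from j to j + 1 halves [sqrt y], so the moment bound grows by $2^p$ while the weight
     shrinks by $4^{-\beta}$. The ratio is below 1 exactly when $p/2<\beta$. *)
  set (q := q4 * 2 ^ p).
  assert (L2 : 0 < ln 2) by (rewrite <- ln_1; apply ln_increasing; lra).
  assert (L4 : ln 4 = 2 * ln 2).
  { replace 4 with (2 * 2) by ring; rewrite ln_mult by lra; ring. }
  assert (Hq : 0 < q < 1).
  { assert (E : q = exp (- ((2 * beta - INR p) * ln 2))).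
    { unfold q, q4; rewrite L4, <- (exp_ln (2 ^ p)), <- exp_plus by (apply pow_lt; lra).
      f_equal; rewrite ln_pow by lra; ring. }
    rewrite E; split; [apply exp_pos|]; rewrite <- exp_0; apply exp_increasing; nra. }
  (* If $n\le4^j\le4n$, then $4^{-j\beta}\ge(4n)^{-\beta}$ and $e^{-4\pi n/4^j}\ge e^{-4\pi}$.
     Hence, with this constant, one well-chosen j already dominates $n^{-\beta}$. *)
  set (C0 := exp (beta * ln 4) * exp (4 * PI)).
  assert (HC0 : 0 < C0) by (apply Rmult_lt_0_compat; apply exp_pos).
  set (yy := fun j : nat => / 4 ^ j).
  assert (Hyy : forall j, 0 < yy j <= 1).
  { intros j; assert (1 <= 4 ^ j) by (apply pow_R1_Rle; lra); unfold yy; split.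
    - apply Rinv_0_lt_compat; lra.
    - rewrite <- Rinv_1; apply Rinv_le_contravar; lra. }
  assert (Hsy : forall j, sqrt (yy j) ^ p = / (2 ^ p) ^ j).
  { intros j; unfold yy; replace (/ 4 ^ j) with ((/ 2 ^ j) * (/ 2 ^ j)).
    - rewrite sqrt_square by (left; apply Rinv_0_lt_compat, pow_lt; lra).
      rewrite pow_inv, <- !pow_mult, Nat.mul_comm; reflexivity.
    - rewrite <- Rinv_mult, <- Rpow_mult_distr; do 2 f_equal; ring. }
  set (g := fun i j => C0 * (q4 ^ j * exp (- (4 * PI * yy j)) ^ S i)).
  assert (Hg : forall i j, 0 <= g i j).
  { intros i j; apply Rmult_le_pos; [lra|]; apply Rmult_le_pos; apply pow_le; left; apply exp_pos. }
  assert (Pt : forall L i, (i <= L)%nat ->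
     exp (- (beta * ln (INR (S i)))) <= sum_n (g i) (S L)).
  { intros L i Hi; destruct (exists_power4 (S i)) as (j & J1 & J2 & J3); [lia|].
    apply Rle_trans with (g i j); [|apply sum_n_single_le; [lia | auto]].
    assert (Hn : 0 < INR (S i)) by (apply lt_0_INR; lia).
    unfold g, C0, q4; rewrite <- !exp_mul_nat.
    replace (exp (beta * ln 4) * exp (4 * PI) *
       (exp (INR j * - (beta * ln 4)) * exp (INR (S i) * - (4 * PI * yy j))))
      with (exp (beta * (ln 4 - INR j * ln 4) + 4 * PI * (1 - INR (S i) * yy j)))
      by (rewrite <- !exp_plus; f_equal; ring).
    apply exp_le.
    assert (A1 : 0 <= 1 - INR (S i) * yy j).
    { unfold yy; assert (0 < 4 ^ j) by (apply pow_lt; lra).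
      assert (INR (S i) * / 4 ^ j <= 4 ^ j * / 4 ^ j)
        by (apply Rmult_le_compat_r; [left; apply Rinv_0_lt_compat; lra | exact J2]).
      rewrite Rinv_r in H1 by lra; lra. }
    assert (A2 : INR j * ln 4 <= ln 4 + ln (INR (S i))).
    { rewrite <- ln_pow, <- ln_mult by lra; apply Rcomplements.ln_le; [apply pow_lt; lra | exact J3]. }
    assert (0 <= 4 * PI * (1 - INR (S i) * yy j)) by (apply Rmult_le_pos; lra).
    nra. }
  exists (C0 * K * / (1 - q)); split.
  { apply Rmult_le_pos; [apply Rmult_le_pos; lra | left; apply Rinv_0_lt_compat; lra]. }
  intros L.
  apply Rle_trans with (sum_n (fun i => sum_n (fun j => v i * g i j) (S L)) L).
  { apply sum_n_le_R; intros i Hi; rewrite <- sum_n_scal_R.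
    apply Rmult_le_compat_l; [apply Hv | apply Pt, Hi]. }
  rewrite sum_n_switch.
  apply Rle_trans with (sum_n (fun j => C0 * K * q ^ j) (S L)).
  - apply sum_n_le_R; intros j _.
    rewrite (sum_n_ext _ (fun i => (C0 * q4 ^ j) * (v i * exp (- (4 * PI * yy j)) ^ S i))).
    2:{ intros i; unfold g; rewrite Rmult_comm, !Rmult_assoc; do 2 f_equal; apply Rmult_comm. }
    rewrite <- sum_n_scal_R.
    assert (T := H (yy j) L (Hyy j)); rewrite Hsy in T.
    apply Rle_trans with (C0 * q4 ^ j * (K / / (2 ^ p) ^ j)).
    + apply Rmult_le_compat_l; [apply Rmult_le_pos; [lra | apply pow_le; left; apply exp_pos] | exact T].
    + right; unfold q; rewrite Rpow_mult_distr; field; apply pow_nonzero, pow_nonzero; lra.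
  - rewrite <- sum_n_scal_R; apply Rmult_le_compat_l; [apply Rmult_le_pos; lra|].
    apply sum_n_geom_le; lra.
Qed.

(** * The powers n^-w as functions of log n, and their differences *)

Definition npow (w : C) (x : R) : C := Cexp (- (x * w)).

Lemma Cmod_npow w x : Cmod (npow w x) = exp (- (Re w * x)).
Proof. unfold npow; rewrite Cmod_Cexp; f_equal; unfold Re; simpl; ring. Qed.

Lemma is_derive_npow (w : C) (x : R) :
  is_derive (fun t : R => Re (npow w t)) x (Re (- w * npow w x)) /\
  is_derive (fun t : R => Im (npow w t)) x (Im (- w * npow w x)).
Proof.
  destruct (is_derive_Cexp_line (- w) x) as [H1 H2].
  assert (E : forall t : R, npow w t = Cexp (t * - w)) by (intros t; unfold npow; f_equal; ring).
  rewrite E; split.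
  - apply (is_derive_ext (fun t : R => Re (Cexp (t * - w)))); [intros t; rewrite E; reflexivity | exact H1].
  - apply (is_derive_ext (fun t : R => Im (Cexp (t * - w)))); [intros t; rewrite E; reflexivity | exact H2].
Qed.

Lemma is_derive_mult_npow (w : C) (x : R) :
  is_derive (fun t : R => Re (t * npow w t)) x (Re ((1 - x * w) * npow w x)) /\
  is_derive (fun t : R => Im (t * npow w t)) x (Im ((1 - x * w) * npow w x)).
Proof.
  destruct (is_derive_npow w x) as [H1 H2]; split.
  - apply (is_derive_ext (fun t : R => t * Re (npow w t)));
      [intros t; rewrite re_scal_l; reflexivity|].
    evar_last.
    + apply (is_derive_mult (K := R_AbsRing)); [apply is_derive_id | exact H1 | exact Rmult_comm].
    + unfold plus, mult, one; simpl; unfold Re, Im; simpl; ring.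
  - apply (is_derive_ext (fun t : R => t * Im (npow w t)));
      [intros t; rewrite im_scal_l; reflexivity|].
    evar_last.
    + apply (is_derive_mult (K := R_AbsRing)); [apply is_derive_id | exact H2 | exact Rmult_comm].
    + unfold plus, mult, one; simpl; unfold Re, Im; simpl; ring.
Qed.

Lemma ln_S_bounds (i : nat) : 0 <= ln (INR (S i)) <= ln (INR (S (S i))) /\
  ln (INR (S (S i))) - ln (INR (S i)) <= exp (- ln (INR (S i))).
Proof.
  assert (P1 : 1 <= INR (S i)) by (apply (le_INR 1); lia).
  assert (P2 : INR (S i) <= INR (S (S i))) by (apply le_INR; lia).
  split; [split|].
  - rewrite <- ln_1; apply Rcomplements.ln_le; lra.
  - apply Rcomplements.ln_le; lra.
  - rewrite <- ln_div, exp_Ropp, exp_ln by lra.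
    assert (E : INR (S (S i)) / INR (S i) = 1 + / INR (S i))
      by (rewrite (S_INR (S i)); field; lra).
    rewrite E; assert (0 < / INR (S i)) by (apply Rinv_0_lt_compat; lra).
    assert (K := exp_ineq1_le (/ INR (S i))).
    apply Rle_trans with (ln (exp (/ INR (S i)))); [apply Rcomplements.ln_le; lra|].
    rewrite ln_exp; lra.
Qed.

(** With n = i + 1, the interval from $\ln n$ to $\ln(n+1)$ has length at most 1/n: this is where a
    difference gains a full power of n over its two terms. *)
Lemma log_increment (phi dphi : R -> C) (M sigma : R) (i : nat) : 0 <= M -> 0 <= sigma ->
  (forall x, 0 <= x -> is_derive (fun u : R => Re (phi u)) x (Re (dphi x)) /\
     is_derive (fun u : R => Im (phi u)) x (Im (dphi x)) /\
     Cmod (dphi x) <= M * exp (- (sigma * x))) ->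
  Cmod (phi (ln (INR (S (S i)))) - phi (ln (INR (S i)))) <=
    2 * M * exp (- ((sigma + 1) * ln (INR (S i)))).
Proof.
  intros HM Hs H; destruct (ln_S_bounds i) as [[B1 B2] B3].
  set (x := ln (INR (S i))) in *; set (x' := ln (INR (S (S i)))) in *.
  eapply Rle_trans.
  - apply (mvt_bound_C phi dphi x x' (M * exp (- (sigma * x)))); [exact B2|].
    intros t Ht; destruct (H t) as (D1 & D2 & D3); [lra|].
    split; [exact D1 | split; [exact D2|]].
    eapply Rle_trans; [exact D3|]; apply Rmult_le_compat_l; [exact HM|]; apply exp_le; nra.
  - replace (- ((sigma + 1) * x)) with (- (sigma * x) + - x) by ring; rewrite exp_plus.
    rewrite <- !Rmult_assoc; apply Rmult_le_compat_l; [|exact B3].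
    apply Rmult_le_pos; [lra | left; apply exp_pos].
Qed.

Definition dpow (i : nat) (w : C) : C := (npow w (ln (INR (S i))) - npow w (ln (INR (S (S i)))))%C.

(** The derivative of [dpow i] with respect to [w], since $e^{-wx}$ has derivative $-xe^{-wx}$. *)
Definition dpow' (i : nat) (w : C) : C :=
  (ln (INR (S (S i))) * npow w (ln (INR (S (S i)))) - ln (INR (S i)) * npow w (ln (INR (S i))))%C.

Lemma exp_weight_le (s s' : R) (i : nat) : s' <= s ->
  exp (- (s * ln (INR (S i)))) <= exp (- (s' * ln (INR (S i)))).
Proof. intros H; apply exp_le; destruct (ln_S_bounds i) as [[B1 _] _]; nra. Qed.

Lemma Cmod_dpow i w : 0 <= Re w ->
  Cmod (dpow i w) <= 2 * Cmod w * exp (- ((Re w + 1) * ln (INR (S i)))).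
Proof.
  intros Hw; unfold dpow; rewrite Cmod_minus_sym.
  apply (log_increment (npow w) (fun x => - w * npow w x)%C); [apply Cmod_ge_0 | exact Hw|].
  intros x Hx; destruct (is_derive_npow w x) as [D1 D2].
  split; [exact D1 | split; [exact D2|]].
  rewrite Cmod_mult, Cmod_opp, Cmod_npow; lra.
Qed.

(** With $x=\log n$, polynomials in x cost $n^{1/16}$. The loss of 1/8 in the next two bounds leaves
    a second sixteenth, which pays for $e^{x|h|}$ with $|h|\le1/16$ in [dpow_taylor]. *)
Lemma poly_exp_16 : exists K, 0 <= K /\ forall x, 0 <= x ->
  (1 + x + x * x) * exp (- (/ 16 * x)) <= K.
Proof.
  destruct (pow_exp_bounded 0 (/ 16)) as [K0 H0]; [lra|].
  destruct (pow_exp_bounded 1 (/ 16)) as [K1 H1]; [lra|].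
  destruct (pow_exp_bounded 2 (/ 16)) as [K2 H2]; [lra|].
  assert (HK : forall x, 0 <= x -> (1 + x + x * x) * exp (- (/ 16 * x)) <= K0 + K1 + K2).
  { intros x Hx; specialize (H0 x Hx); specialize (H1 x Hx); specialize (H2 x Hx).
    simpl in H0, H1, H2; lra. }
  exists (K0 + K1 + K2); split; [|exact HK].
  eapply Rle_trans; [|apply (HK 0 (Rle_refl 0))].
  apply Rmult_le_pos; [lra | left; apply exp_pos].
Qed.

Lemma Cmod_dpow' w : / 8 <= Re w -> exists M, 0 <= M /\ forall i,
  Cmod (dpow' i w) <= M * exp (- ((Re w + 7 / 8) * ln (INR (S i)))).
Proof.
  intros Hw; destruct poly_exp_16 as (K & HK0 & HK).
  assert (W := Cmod_ge_0 w).
  exists (2 * ((1 + Cmod w) * K)); split; [apply Rmult_le_pos; [lra | apply Rmult_le_pos; lra]|].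
  intros i; unfold dpow'; replace (Re w + 7 / 8) with (Re w - / 8 + 1) by field.
  apply (log_increment (fun x => x * npow w x)%C (fun x => (1 - x * w) * npow w x)%C);
    [apply Rmult_le_pos; lra | lra|].
  intros x Hx; destruct (is_derive_mult_npow w x) as [D1 D2].
  split; [exact D1 | split; [exact D2|]].
  rewrite Cmod_mult, Cmod_npow.
  assert (A : Cmod (1 - x * w) <= (1 + Cmod w) * (1 + x + x * x)).
  { eapply Rle_trans; [apply Cmod_minus_le|].
    rewrite Cmod_1, Cmod_mult, Cmod_R, Rabs_right by lra; nra. }
  replace (- (Re w * x)) with (- (/ 16 * x) + (- (/ 16 * x) + - ((Re w - / 8) * x))) by field.
  rewrite !exp_plus.
  apply Rle_trans with ((1 + Cmod w) * (1 + x + x * x) *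
     (exp (- (/ 16 * x)) * (1 * exp (- ((Re w - / 8) * x))))).
  - apply Rmult_le_compat; [apply Cmod_ge_0 | | exact A |].
    + repeat (apply Rmult_le_pos; [left; apply exp_pos|]); left; apply exp_pos.
    + apply Rmult_le_compat_l; [left; apply exp_pos|].
      apply Rmult_le_compat_r; [left; apply exp_pos|].
      rewrite <- exp_0; apply exp_le; lra.
  - rewrite Rmult_1_l, <- Rmult_assoc; apply Rmult_le_compat_r; [left; apply exp_pos|].
    rewrite Rmult_assoc; apply Rmult_le_compat_l; [lra | apply HK, Hx].
Qed.

(** At fixed x, [T] is the first-order Taylor remainder of $e^{-wx}$ in w. Its x-derivative [T'] is
    built from $e^{-xh}-1+xh$ and $h(e^{-xh}-1)$, both of order $|h|^2$; applying [log_increment] to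
    [T] keeps the gained power of n, uniformly in i. *)
Lemma dpow_taylor w : / 8 <= Re w -> exists M, 0 <= M /\ forall i h, Cmod h <= / 16 ->
  Cmod (dpow i (w + h) - dpow i w - h * dpow' i w) <=
    M * (Cmod h * Cmod h) * exp (- ((Re w + 7 / 8) * ln (INR (S i)))).
Proof.
  intros Hw; destruct poly_exp_16 as (K & HK0 & HK).
  assert (W := Cmod_ge_0 w).
  exists (2 * ((4 * Cmod w + 2) * K)); split;
    [apply Rmult_le_pos; [lra | apply Rmult_le_pos; lra]|].
  intros i h Hh.
  set (T := fun x : R => (npow (w + h) x - npow w x + h * (x * npow w x))%C).
  set (T' := fun x : R => (- (npow w x * (w * (Cexp (- (x * h)) - 1 - - (x * h)) +
                        h * (Cexp (- (x * h)) - 1))))%C).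
  replace (dpow i (w + h) - dpow i w - h * dpow' i w)%C
    with (- (T (ln (INR (S (S i)))) - T (ln (INR (S i)))))%C
    by (unfold T, dpow, dpow'; ring).
  rewrite Cmod_opp.
  set (y := Cmod h) in *; assert (Hy : 0 <= y) by apply Cmod_ge_0.
  replace (2 * ((4 * Cmod w + 2) * K) * (y * y)) with (2 * ((4 * Cmod w + 2) * K * (y * y))) by ring.
  replace (Re w + 7 / 8) with (Re w - / 8 + 1) by field.
  apply (log_increment T T'); [| lra |].
  { repeat apply Rmult_le_pos; lra. }
  intros x Hx.
  assert (N : npow (w + h) x = (npow w x * Cexp (- (x * h)))%C).
  { unfold npow; rewrite <- Cexp_plus; f_equal; ring. }
  assert (ET : T' x = (- (w + h) * npow (w + h) x - - w * npow w x +
                         h * ((1 - x * w) * npow w x))%C).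
  { rewrite N; unfold T'; ring. }
  destruct (is_derive_npow w x) as [A1 A2]; destruct (is_derive_npow (w + h) x) as [B1 B2].
  destruct (is_derive_mult_npow w x) as [C1 C2].
  split; [|split].
  - rewrite ET; apply (is_derive_ext (fun t : R => Re (npow (w + h) t) - Re (npow w t) +
       (Re h * Re (t * npow w t) - Im h * Im (t * npow w t)))); [intros t; reflexivity|].
    evar_last.
    + apply (is_derive_plus (V := R_NormedModule)).
      * apply (is_derive_minus (V := R_NormedModule)); [exact B1 | exact A1].
      * apply (is_derive_minus (V := R_NormedModule)); apply is_derive_scal; [exact C1 | exact C2].
    + reflexivity.
  - rewrite ET; apply (is_derive_ext (fun t : R => Im (npow (w + h) t) - Im (npow w t) +
       (Re h * Im (t * npow w t) + Im h * Re (t * npow w t)))); [intros t; reflexivity|].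
    evar_last.
    + apply (is_derive_plus (V := R_NormedModule)).
      * apply (is_derive_minus (V := R_NormedModule)); [exact B2 | exact A2].
      * apply (is_derive_plus (V := R_NormedModule)); apply is_derive_scal; [exact C2 | exact C1].
    + reflexivity.
  - unfold T'; rewrite Cmod_opp, Cmod_mult, Cmod_npow.
    assert (M1 := Cmod_Cexp_taylor (- (x * h))); assert (M2 := Cmod_Cexp_minus_1 (- (x * h))).
    assert (EX : Cmod (- (x * h)) = x * y)
      by (rewrite Cmod_opp, Cmod_mult, Cmod_R, Rabs_right by lra; reflexivity).
    rewrite EX in M1, M2.
    assert (Exy : exp (x * y) <= exp (/ 16 * x)) by (apply exp_le; nra).
    set (X := exp (/ 16 * x)) in *.
    assert (HX : 0 < X) by apply exp_pos.
    assert (A : Cmod (w * (Cexp (- (x * h)) - 1 - - (x * h)) + h * (Cexp (- (x * h)) - 1))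
        <= (4 * Cmod w + 2) * (y * y) * ((1 + x + x * x) * X)).
    { eapply Rle_trans; [apply Cmod_triangle|]; rewrite !Cmod_mult; fold y.
      assert (U1 : Cmod w * Cmod (Cexp (- (x * h)) - 1 - - (x * h)) <=
                   Cmod w * (4 * (x * y) * (x * y) * X)).
      { apply Rmult_le_compat_l; [exact W|]; eapply Rle_trans; [exact M1|].
        apply Rmult_le_compat_l; [|exact Exy]; assert (0 <= x * y) by nra; nra. }
      assert (U2 : y * Cmod (Cexp (- (x * h)) - 1) <= y * (2 * (x * y) * X)).
      { apply Rmult_le_compat_l; [exact Hy|]; eapply Rle_trans; [exact M2|].
        apply Rmult_le_compat_l; [|exact Exy]; nra. }
      apply Rle_trans with ((4 * Cmod w * (x * x) + 2 * x) * ((y * y) * X)); [lra|].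
      replace ((4 * Cmod w + 2) * (y * y) * ((1 + x + x * x) * X))
        with ((4 * Cmod w + 2) * (1 + x + x * x) * ((y * y) * X)) by ring.
      apply Rmult_le_compat_r; [apply Rmult_le_pos; nra|].
      assert (0 <= x * x) by nra; assert (0 <= Cmod w * x) by nra; nra. }
    replace (- (Re w * x)) with (- (/ 16 * x) + (- (/ 16 * x) + - ((Re w - / 8) * x))) by field.
    rewrite !exp_plus.
    set (Y := exp (- (/ 16 * x))).
    assert (HXY : X * Y = 1) by (unfold X, Y; rewrite <- exp_plus, Rplus_opp_r; apply exp_0).
    assert (HY : 0 < Y) by apply exp_pos.
    set (Z := exp (- ((Re w - / 8) * x))).
    assert (HZ : 0 < Z) by apply exp_pos.
    apply Rle_trans with (Y * (Y * Z) * ((4 * Cmod w + 2) * (y * y) * ((1 + x + x * x) * X))).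
    + apply Rmult_le_compat_l; [repeat apply Rmult_le_pos; lra | exact A].
    + replace (Y * (Y * Z) * ((4 * Cmod w + 2) * (y * y) * ((1 + x + x * x) * X)))
        with ((4 * Cmod w + 2) * ((1 + x + x * x) * Y) * (y * y) * Z * (X * Y)) by ring.
      rewrite HXY, Rmult_1_r; apply Rmult_le_compat_r; [lra|].
      apply Rmult_le_compat_r; [nra|]; apply Rmult_le_compat_l; [lra | apply HK, Hx].
Qed.

Lemma clim_of_abs (u : nat -> C) (M : R) :
  (forall L, sum_n (fun i => Cmod (u i)) L <= M) -> exists l, clim (sum_n u) l.
Proof.
  intros H.
  assert (X : ex_series (fun i => Cmod (u i))).
  { destruct (ex_finite_lim_seq_incr (sum_n (fun i => Cmod (u i))) M) as [l Hl]; auto.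
    - intros n; rewrite sum_n_S_R; generalize (Cmod_ge_0 (u (S n))); lra.
    - exists l; exact Hl. }
  destruct (ex_series_le (K := C_AbsRing) (V := C_CompleteNormedModule) u (fun i => Cmod (u i)))
    as [l Hl]; [intros n; apply Rle_refl | exact X|].
  exists l; apply filterlim_clim; exact Hl.
Qed.

Lemma clim_plus_scal (u v : nat -> C) (l m c : C) :
  clim u l -> clim v m -> clim (fun n => u n + c * v n)%C (l + c * m)%C.
Proof.
  intros Hu Hv eps Heps.
  assert (Hc : 0 < Cmod c + 1) by (generalize (Cmod_ge_0 c); lra).
  destruct (Hu (eps / 2)) as [N1 H1]; [lra|].
  destruct (Hv (eps / 2 / (Cmod c + 1))) as [N2 H2]; [apply Rdiv_lt_0_compat; lra|].
  exists (Nat.max N1 N2); intros n Hn.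
  specialize (H1 n ltac:(lia)); specialize (H2 n ltac:(lia)).
  replace (u n + c * v n - (l + c * m))%C with ((u n - l) + c * (v n - m))%C by ring.
  eapply Rle_lt_trans; [apply Cmod_triangle|]; rewrite Cmod_mult.
  assert ((Cmod c + 1) * Cmod (v n - m) < eps / 2).
  { apply Rlt_le_trans with ((Cmod c + 1) * (eps / 2 / (Cmod c + 1))).
    - apply Rmult_lt_compat_l; assumption.
    - right; field; lra. }
  generalize (Cmod_ge_0 (v n - m)); lra.
Qed.

Lemma clim_unique (u : nat -> C) (l m : C) : clim u l -> clim u m -> l = m.
Proof.
  intros Hl Hm; apply Ceq_minus, Cmod_eq_0.
  apply Rle_antisym; [|apply Cmod_ge_0]; apply le_of_le_plus_eps; intros eps Heps.
  destruct (Hl (eps / 2)) as [N1 H1]; [lra|]; destruct (Hm (eps / 2)) as [N2 H2]; [lra|].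
  specialize (H1 (Nat.max N1 N2) ltac:(lia)); specialize (H2 (Nat.max N1 N2) ltac:(lia)).
  replace (l - m)%C with ((u (Nat.max N1 N2) - m) - (u (Nat.max N1 N2) - l))%C by ring.
  eapply Rle_trans; [apply Cmod_minus_le | lra].
Qed.

Lemma clim_ext (u v : nat -> C) (l : C) : (forall n, u n = v n) -> clim u l -> clim v l.
Proof.
  intros E H eps Heps; destruct (H eps Heps) as [N HN]; exists N; intros n Hn.
  rewrite <- E; auto.
Qed.

Lemma sum_n_plus_scal (u v : nat -> C) (c : C) n :
  (sum_n u n + c * sum_n v n)%C = sum_n (fun i => u i + c * v i)%C n.
Proof.
  induction n as [|n IH]; [rewrite !sum_O; reflexivity|].
  rewrite !sum_n_S_C, <- IH; generalize (sum_n u n) (sum_n v n); intros p q; ring.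
Qed.

(* The Abel-summed form of sum_n (c_n - c_(n-1)) n^-w; the limit exists for
   Re w >= beta - 7/8, see abel_sum_clim, and is junk otherwise. *)
Definition abel_sum (c : nat -> C) (w : C) : C :=
  epsilon (inhabits (RtoC 0)) (clim (sum_n (fun i => c i * dpow i w)%C)).

Section AbelSum.

Variables (c : nat -> C) (beta K : R).
Hypothesis beta_ge_1 : 1 <= beta.
Hypothesis c_bound : forall L,
  sum_n (fun i => Cmod (c i) * exp (- (beta * ln (INR (S i))))) L <= K.

Lemma sum_weight_le (x : nat -> C) (M s : R) : 0 <= M -> beta <= s ->
  (forall i, Cmod (x i) <= M * exp (- (s * ln (INR (S i))))) ->
  forall L, sum_n (fun i => Cmod (c i * x i)) L <= M * K.
Proof.
  intros HM Hs Hx L.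
  apply Rle_trans with (M * sum_n (fun i => Cmod (c i) * exp (- (beta * ln (INR (S i))))) L);
    [|apply Rmult_le_compat_l; [exact HM | apply c_bound]].
  rewrite sum_n_scal_R; apply sum_n_le_R; intros i _; rewrite Cmod_mult.
  rewrite <- Rmult_assoc, (Rmult_comm M), Rmult_assoc.
  apply Rmult_le_compat_l; [apply Cmod_ge_0|]; eapply Rle_trans; [apply Hx|].
  apply Rmult_le_compat_l; [exact HM | apply exp_weight_le, Hs].
Qed.

Lemma abel_sum_clim (w : C) : beta - 7 / 8 <= Re w ->
  clim (sum_n (fun i => c i * dpow i w)%C) (abel_sum c w).
Proof.
  intros Hw; unfold abel_sum; apply epsilon_spec.
  apply clim_of_abs with (2 * Cmod w * K), (sum_weight_le _ _ (Re w + 1)).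
  - generalize (Cmod_ge_0 w); lra.
  - lra.
  - intros i; apply Cmod_dpow; lra.
Qed.

(** Termwise differentiation: the derivative is the sum of [c i * dpow' i w], and the remainders
    from [dpow_taylor] add up to at most $MK|h|^2$. *)
Lemma abel_sum_cdiff (w : C) : beta - 7 / 8 < Re w -> cdiff (abel_sum c) w.
Proof.
  intros Hw.
  destruct (Cmod_dpow' w) as (M' & HM' & HD); [lra|].
  destruct (dpow_taylor w) as (M & HM & HT); [lra|].
  destruct (clim_of_abs (fun i => c i * dpow' i w)%C (M' * K)) as [l Hl].
  { apply (sum_weight_le _ _ (Re w + 7 / 8)); [exact HM' | lra | exact HD]. }
  assert (K0 : 0 <= K).
  { eapply Rle_trans; [|apply (c_bound O)]; rewrite sum_O.
    apply Rmult_le_pos; [apply Cmod_ge_0 | left; apply exp_pos]. }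
  assert (HMK : 0 <= M * K) by (apply Rmult_le_pos; assumption).
  exists l; intros eps Heps.
  (* The three entries serve, in turn, [dpow_taylor], convergence of the series at [t], and the
     passage from $MK|h|^2$ to $\varepsilon|h|$; the added 1 covers the case [M * K = 0]. *)
  exists (Rmin (/ 16) (Rmin (Re w - (beta - 7 / 8)) (eps / (M * K + 1)))); split.
  { repeat apply Rmin_pos; try lra; apply Rdiv_lt_0_compat; lra. }
  intros t Ht; set (h := (t - w)%C) in *.
  assert (T1 : Cmod h < / 16) by (eapply Rlt_le_trans; [exact Ht | apply Rmin_l]).
  assert (T2 : Cmod h < Rmin (Re w - (beta - 7 / 8)) (eps / (M * K + 1)))
    by (eapply Rlt_le_trans; [exact Ht | apply Rmin_r]).
  assert (T3 : Cmod h < Re w - (beta - 7 / 8)) by (eapply Rlt_le_trans; [exact T2 | apply Rmin_l]).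
  assert (T4 : Cmod h < eps / (M * K + 1)) by (eapply Rlt_le_trans; [exact T2 | apply Rmin_r]).
  assert (Et : t = (w + h)%C) by (unfold h; ring).
  assert (Rt : beta - 7 / 8 <= Re t).
  { assert (R1 := re_le_Cmod h); apply Rabs_le_between in R1.
    rewrite Et; change (Re (w + h)) with (Re w + Re h); lra. }
  assert (Lim := clim_plus_scal _ _ _ _ (- h)%C
    (clim_plus_scal _ _ _ _ (-1)%C (abel_sum_clim t Rt)
      (abel_sum_clim w (Rlt_le _ _ Hw))) Hl).
  replace (abel_sum c t - abel_sum c w - l * h)%C
    with (abel_sum c t + -1 * abel_sum c w + - h * l)%C by ring.
  apply Rle_trans with (M * (Cmod h * Cmod h) * K).
  - apply (clim_le _ _ _ Lim); intros n; rewrite !sum_n_plus_scal.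
    eapply Rle_trans; [apply Cmod_sum_n|].
    rewrite (sum_n_ext _ (fun i => Cmod (c i * (dpow i (w + h) - dpow i w - h * dpow' i w)))).
    + apply (sum_weight_le _ _ (Re w + 7 / 8)); [|lra|].
      * apply Rmult_le_pos; [exact HM|]; generalize (Cmod_ge_0 h); nra.
      * intros i; apply HT; lra.
    + intros i; rewrite Et; f_equal; ring.
  - assert (Hh := Cmod_ge_0 h).
    apply Rle_trans with ((M * K + 1) * Cmod h * Cmod h); [nra|].
    apply Rmult_le_compat_r; [exact Hh|].
    apply Rle_trans with ((M * K + 1) * (eps / (M * K + 1))).
    + apply Rmult_le_compat_l; lra.
    + right; field; lra.
Qed.

(** Index 0 stands for n = 1, and the first case reflects c(0) = 0, an empty partial sum. *)
Definition delta (i : nat) : C := match i with O => c O | S j => (c (S j) - c j)%C end.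

Lemma abel_identity (w : C) (N : nat) :
  (c N * npow w (ln (INR (S (S N)))) + sum_n (fun i => c i * dpow i w)%C N)%C =
  sum_n (fun i => delta i * npow w (ln (INR (S i))))%C N.
Proof.
  induction N as [|N IH].
  - rewrite !sum_O; unfold dpow; simpl delta; ring.
  - rewrite !sum_n_S_C, <- IH; unfold dpow at 2; simpl delta.
    generalize (sum_n (fun i => c i * dpow i w)%C N); intros p; ring.
Qed.

(** A single term of the bounded sum gives $|c_N|\le K(N+1)^\beta$, so one power beyond [beta]
    forces decay. So distant a half-plane is enough, because the identity is continued to 1
    afterwards. *)
Lemma abel_boundary_term (w : C) : beta + 1 <= Re w ->
  clim (fun N => c N * npow w (ln (INR (S (S N)))))%C 0.
Proof.
  intros Hw eps Heps.
  assert (Kc : forall N, Cmod (c N) * exp (- (beta * ln (INR (S N)))) <= K).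
  { intros N; eapply Rle_trans; [|apply (c_bound N)].
    apply (sum_n_single_le (fun i => Cmod (c i) * exp (- (beta * ln (INR (S i)))))); [lia|].
    intros i; apply Rmult_le_pos; [apply Cmod_ge_0 | left; apply exp_pos]. }
  assert (K0 : 0 <= K).
  { eapply Rle_trans; [|apply (Kc O)]; apply Rmult_le_pos; [apply Cmod_ge_0 | left; apply exp_pos]. }
  destruct (INR_archimed eps K) as [n Hn]; [exact Heps|].
  exists n; intros N HN.
  replace (c N * npow w (ln (INR (S (S N)))) - 0)%C
    with (c N * npow w (ln (INR (S (S N)))))%C by ring.
  rewrite Cmod_mult, Cmod_npow.
  destruct (ln_S_bounds N) as [[B1 B2] _].
  assert (E : exp (- (Re w * ln (INR (S (S N))))) <=
     exp (- (beta * ln (INR (S N)))) * / INR (S (S N))).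
  { rewrite <- (exp_ln (INR (S (S N)))) at 2 by (apply lt_0_INR; lia).
    rewrite <- exp_Ropp, <- exp_plus; apply exp_le; nra. }
  assert (P : 0 < INR (S (S N))) by (apply lt_0_INR; lia).
  apply Rle_lt_trans with (K * / INR (S (S N))).
  - eapply Rle_trans; [apply Rmult_le_compat_l; [apply Cmod_ge_0 | exact E]|].
    rewrite <- Rmult_assoc; apply Rmult_le_compat_r; [left; apply Rinv_0_lt_compat, P | apply Kc].
  - apply Rmult_lt_reg_r with (INR (S (S N))); [exact P|].
    rewrite Rmult_assoc, Rinv_l, Rmult_1_r by lra.
    assert (INR n <= INR (S (S N))) by (apply le_INR; lia); nra.
Qed.

Lemma abel_sum_eq (w : C) : beta + 1 <= Re w ->
  clim (sum_n (fun i => delta i * npow w (ln (INR (S i))))%C) (abel_sum c w).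
Proof.
  intros Hw.
  assert (L := clim_plus_scal _ _ _ _ 1 (abel_boundary_term w Hw) (abel_sum_clim w ltac:(lra))).
  replace (0 + 1 * abel_sum c w)%C with (abel_sum c w) in L by ring.
  eapply clim_ext; [|exact L]; intros N; cbv beta; rewrite <- abel_identity; ring.
Qed.

End AbelSum.

(** * The sums over h *)

Lemma sum_n_S_l (u : nat -> C) n : (u O + sum_n (fun i => u (S i)) n)%C = sum_n u (S n).
Proof.
  induction n as [|n IH]; [rewrite sum_n_S_C, !sum_O; reflexivity|].
  rewrite (sum_n_S_C u (S n)), <- IH, (sum_n_S_C (fun i => u (S i)) n).
  generalize (sum_n (fun i => u (S i)) n); intros p; ring.
Qed.

(* b(1) + ... + b(i) *)
Definition psum_pred (b : Z -> C) (i : nat) : C :=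
  match i with O => 0 | S j => psum b j end.

(** With n = i + 1 and h = j + 1 the argument n - h descends from i. All terms with h at least n
    vanish, so the sum is independent of N once N is at least i. *)
Lemma sum_shift (b : Z -> C) : (forall n, (n <= 0)%Z -> b n = 0) ->
  forall i N, (i <= N)%nat ->
  sum_n (fun j => b (Z.of_nat (S i) - Z.of_nat (S j))%Z) N = psum_pred b i.
Proof.
  intros Hb i N HN.
  assert (E : sum_n (fun j => b (Z.of_nat (S i) - Z.of_nat (S j))%Z) i = psum_pred b i).
  { clear N HN; induction i as [|i IH]; [rewrite sum_O; apply Hb; lia|].
    rewrite <- sum_n_S_l.
    rewrite (sum_n_ext _ (fun j => b (Z.of_nat (S i) - Z.of_nat (S j))%Z)) by (intros j; f_equal; lia).
    rewrite IH; replace (Z.of_nat (S (S i)) - Z.of_nat 1)%Z with (Z.of_nat (S i)) by lia.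
    destruct i as [|i]; simpl psum_pred; unfold psum; [rewrite sum_O; apply Cplus_0_r|].
    rewrite sum_n_S_C; apply Cplus_comm. }
  replace N with (i + (N - i))%nat by lia.
  induction (N - i)%nat as [|d IH]; [rewrite Nat.add_0_r; exact E|].
  rewrite Nat.add_succ_r, sum_n_S_C, IH, Hb by lia; apply Cplus_0_r.
Qed.

Lemma Cconj_sum_n (u : nat -> C) n : Cconj (sum_n u n) = sum_n (fun i => Cconj (u i)) n.
Proof.
  induction n as [|n IH]; [rewrite !sum_O; reflexivity|].
  rewrite !sum_n_S_C, <- IH; generalize (sum_n u n) (u (S n)); intros p q.
  apply injective_projections; simpl; ring.
Qed.

Lemma sum_n_Cmult_l (x : C) (u : nat -> C) n :
  (x * sum_n u n)%C = sum_n (fun i => x * u i)%C n.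
Proof.
  induction n as [|n IH]; [rewrite !sum_O; reflexivity|].
  rewrite !sum_n_S_C, <- IH; generalize (sum_n u n); intros p; ring.
Qed.

(** In a square partial sum i is at most N, so the truncated sum over h is already complete; no
    interchange of limits is involved. *)
Lemma shifted_convolution_sum (a b : Z -> C) (v : C) :
  (forall n, (n <= 0)%Z -> a n = 0) -> (forall n, (n <= 0)%Z -> b n = 0) ->
  forall i N, (i <= N)%nat ->
  sum_n (fun j => let n := Z.of_nat (S i) in let h := Z.of_nat (S j) in
     ((a n * Cconj (b (n - h)%Z) + a (n - h)%Z * Cconj (b n)) / v)%C) N =
  ((a (Z.of_nat (S i)) * Cconj (psum_pred b i) + psum_pred a i * Cconj (b (Z.of_nat (S i)))) / v)%C.
Proof.
  intros Ha Hb i N HN; cbv zeta.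
  rewrite <- (sum_shift a Ha i N HN), <- (sum_shift b Hb i N HN), Cconj_sum_n.
  set (n := Z.of_nat (S i)).
  replace ((a n * sum_n (fun j => Cconj (b (n - Z.of_nat (S j))%Z)) N +
     sum_n (fun j => a (n - Z.of_nat (S j))%Z) N * Cconj (b n)) / v)%C
    with ((a n / v) * sum_n (fun j => Cconj (b (n - Z.of_nat (S j))%Z)) N +
       (Cconj (b n) / v) * sum_n (fun j => a (n - Z.of_nat (S j))%Z) N)%C
    by (unfold Cdiv; ring).
  rewrite sum_n_Cmult_l, sum_n_plus_scal; apply sum_n_ext; intros j.
  match goal with |- ?x = ?y => change (@eq C x y) end; unfold Cdiv; ring.
Qed.

(** The discrete product rule: its second-order term is the diagonal series, its two first-order
    terms are the shifted ones. *)
Lemma delta_product (a b : Z -> C) (i : nat) :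
  delta (fun j => psum a j * Cconj (psum b j))%C i =
  (a (Z.of_nat (S i)) * Cconj (b (Z.of_nat (S i))) +
   (a (Z.of_nat (S i)) * Cconj (psum_pred b i) + psum_pred a i * Cconj (b (Z.of_nat (S i)))))%C.
Proof.
  destruct i as [|i]; unfold delta, psum_pred.
  - unfold psum; rewrite !sum_O; replace (Cconj 0) with (RtoC 0); [ring|].
    apply injective_projections; simpl; ring.
  - unfold psum; rewrite !sum_n_S_C.
    generalize (sum_n (fun m => a (Z.of_nat (S m))) i) (sum_n (fun m => b (Z.of_nat (S m))) i).
    generalize (a (Z.of_nat (S (S i)))) (b (Z.of_nat (S (S i)))); intros x y p q.
    replace (Cconj (q + y)) with (Cconj q + Cconj y)%C; [ring|].
    apply injective_projections; simpl; ring.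
Qed.

(** * Meromorphic continuation *)

Lemma locally_disc (s0 : C) (P : C -> Prop) : locally s0 P ->
  exists d, 0 < d /\ forall s, Cmod (s - s0) < d -> P s.
Proof.
  intros [d Hd]; exists d; split; [apply cond_pos|]; intros s Hs; apply Hd.
  apply C_NormedModule_mixin_compat1, Hs.
Qed.

Lemma locally'_disc (s0 : C) (P : C -> Prop) : locally' s0 P ->
  exists d, 0 < d /\ forall s, s <> s0 -> Cmod (s - s0) < d -> P s.
Proof.
  intros H; destruct (locally_disc s0 _ H) as (d & Hd & K).
  exists d; split; [exact Hd|]; intros s Hs Hsd; apply K; assumption.
Qed.

(** Clearing the pole, rather than splitting off a principal part, makes sums immediate: orders are
    added. The centre is excluded because [F s0] is arbitrary. *)
Definition meromorphic_germ (F : C -> C) (s0 : C) : Prop :=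
  exists (M : nat) (g : C -> C) (d : R), 0 < d /\
    (forall s, Cmod (s - s0) < d -> cdiff g s) /\
    (forall s, s <> s0 -> Cmod (s - s0) < d -> ((s - s0) ^ M * F s = g s)%C).

Lemma cdiff_sum_n (F : nat -> C -> C) (s : C) n : (forall i, cdiff (F i) s) ->
  cdiff (fun t => sum_n (fun i => F i t) n) s.
Proof.
  intros H; induction n as [|n IH].
  - apply cdiff_ext with (F O); [intros t; rewrite sum_O; reflexivity | apply H].
  - apply cdiff_ext with (fun t => sum_n (fun i => F i t) n + F (S n) t)%C.
    + intros t; rewrite sum_n_S_C; reflexivity.
    + apply cdiff_plus; [exact IH | apply H].
Qed.

Lemma cdiff_shift (s0 s : C) : cdiff (fun t => t - s0)%C s.
Proof. apply cdiff_minus; [apply cdiff_id | apply cdiff_const]. Qed.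

Lemma meromorphic_at_germ F s0 : meromorphic_at F s0 -> meromorphic_germ F s0.
Proof.
  intros (m & c & h & Hh & HF).
  destruct (locally_disc s0 _ Hh) as (d1 & Hd1 & H1).
  destruct (locally'_disc s0 _ HF) as (d2 & Hd2 & H2).
  exists (S m), (fun s => sum_n (fun j => c j * (s - s0) ^ (m - j)) m + (s - s0) ^ S m * h s)%C,
    (Rmin d1 d2); split; [apply Rmin_pos; assumption|]; split.
  - intros s Hs; apply cdiff_plus.
    + apply cdiff_sum_n; intros i; apply cdiff_scal, cdiff_pow, cdiff_shift.
    + apply cdiff_mult; [apply cdiff_pow, cdiff_shift|].
      apply ex_derive_cdiff, H1; eapply Rlt_le_trans; [exact Hs | apply Rmin_l].
  - intros s Hs0 Hs; rewrite (H2 s Hs0 (Rlt_le_trans _ _ _ Hs (Rmin_r _ _))).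
    assert (Hz : (s - s0)%C <> 0) by (apply Cminus_eq_contra, Hs0).
    rewrite Cmult_plus_distr_l; f_equal; rewrite sum_n_Cmult_l.
    apply sum_n_ext_loc; intros j Hj.
    replace (S m) with (m - j + S j)%nat by lia; rewrite Cpow_add_r.
    match goal with |- ?x = ?y => change (@eq C x y) end.
    field; apply Cpow_nz, Hz.
Qed.

Lemma meromorphic_germ_combine F1 F2 H s0 : meromorphic_germ F1 s0 -> meromorphic_germ F2 s0 ->
  (exists d, 0 < d /\ forall s, Cmod (s - s0) < d -> cdiff H s) ->
  meromorphic_germ (fun s => F1 s + F2 s - H s)%C s0.
Proof.
  intros (M1 & g1 & d1 & Hd1 & A1 & B1) (M2 & g2 & d2 & Hd2 & A2 & B2) (d3 & Hd3 & A3).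
  exists (M1 + M2)%nat, (fun s => (s - s0) ^ M2 * g1 s + (s - s0) ^ M1 * g2 s
                         - (s - s0) ^ (M1 + M2) * H s)%C, (Rmin d1 (Rmin d2 d3)).
  assert (L : forall s, Cmod (s - s0) < Rmin d1 (Rmin d2 d3) ->
    Cmod (s - s0) < d1 /\ Cmod (s - s0) < d2 /\ Cmod (s - s0) < d3).
  { intros s Hs; generalize (Rmin_l d1 (Rmin d2 d3)) (Rmin_r d1 (Rmin d2 d3))
      (Rmin_l d2 d3) (Rmin_r d2 d3); lra. }
  split; [repeat apply Rmin_pos; assumption|]; split.
  - intros s Hs; destruct (L s Hs) as (L1 & L2 & L3).
    apply cdiff_minus; [apply cdiff_plus|]; apply cdiff_mult; auto;
      apply cdiff_pow, cdiff_shift.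
  - intros s Hs0 Hs; destruct (L s Hs) as (L1 & L2 & L3).
    rewrite <- B1, <- B2, Cpow_add_r by assumption; ring.
Qed.

(** The neighbourhood is punctured because a meromorphic function here may take any value at its
    centre, even when the singularity is removable. *)
Definition zero_near (E : C -> C) (s0 : C) : Prop :=
  exists d, 0 < d /\ forall s, s <> s0 -> Cmod (s - s0) < d -> E s = 0.

Lemma Cmod_real_shift (s : C) (x y : R) : Cmod (s - x) <= Cmod (s - y) + Rabs (y - x).
Proof.
  replace (s - x)%C with ((s - y) + (RtoC (y - x)))%C by (rewrite RtoC_minus; ring).
  eapply Rle_trans; [apply Cmod_triangle|]; rewrite Cmod_R; lra.
Qed.

(** Once the pole at [tau] is cleared, [g] vanishes near [q = tau + d / 4]. The disc of radius d/2
    about [q] lies in the domain of [g] and contains the disc of radius d/4 about [tau], so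
    [disc_identity] carries the zeros past [tau]. *)
Lemma zero_near_step E (tau : R) : meromorphic_germ E tau ->
  (forall t, tau < t -> zero_near E t) -> zero_near E tau.
Proof.
  intros (M & g & d & Hd & Hg & HE) Hr.
  set (q := tau + d / 4).
  destruct (Hr q) as (r & Hrp & Hz); [unfold q; lra|].
  assert (Dq : Rabs (q - tau) = d / 4) by (unfold q; rewrite Rabs_right; lra).
  assert (Dq' : Rabs (tau - q) = d / 4) by (rewrite Rabs_minus_sym; exact Dq).
  set (r0 := Rmin r (d / 4)).
  assert (Hr0 : 0 < r0) by (apply Rmin_pos; lra).
  assert (Pz : forall s : C, s <> q -> Cmod (s - q) < r0 -> g s = 0).
  { intros s Hsq Hs.
    assert (S1 : Cmod (s - q) < r) by (eapply Rlt_le_trans; [exact Hs | apply Rmin_l]).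
    assert (S2 : Cmod (s - q) < d / 4) by (eapply Rlt_le_trans; [exact Hs | apply Rmin_r]).
    rewrite <- HE.
    - rewrite Hz by assumption; ring.
    - intros ->; rewrite <- RtoC_minus, Cmod_R, Dq' in S2; lra.
    - generalize (Cmod_real_shift s tau q); lra. }
  (* Nothing is known about [E] at [q] itself; continuity of [g] fills the puncture. *)
  assert (G0 : g q = 0).
  { destruct (classic (g q = 0)) as [Z|Z]; [exact Z|exfalso].
    assert (Cg : cdiff g q) by (apply Hg; rewrite <- RtoC_minus, Cmod_R, Dq; lra).
    destruct (cdiff_continuous g q Cg (Cmod (g q))) as (d' & Hd' & K); [apply Cmod_gt_0, Z|].
    set (x := Rmin d' r0 / 2).
    assert (Hx : 0 < x) by (unfold x; assert (0 < Rmin d' r0) by (apply Rmin_pos; assumption); lra).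
    assert (X1 := Rmin_l d' r0); assert (X2 := Rmin_r d' r0).
    assert (Ex : Cmod ((q + x)%R - q) = x)
      by (rewrite <- RtoC_minus, Cmod_R, Rabs_right; lra).
    specialize (K (RtoC (q + x))); rewrite Ex in K; specialize (K ltac:(unfold x in *; lra)).
    rewrite (Pz (RtoC (q + x))) in K.
    - replace (0 - g q)%C with (- g q)%C in K by ring; rewrite Cmod_opp in K; lra.
    - intros Q; apply RtoC_inj in Q; lra.
    - rewrite Ex; unfold x in *; lra. }
  assert (Z := disc_identity g q r0 (d / 2) Hr0).
  exists (d / 4); split; [lra|]; intros s Hs Hsd.
  assert (Gs : g s = 0).
  { apply Z.
    - intros t Ht; apply Hg; generalize (Cmod_real_shift t tau q); lra.
    - intros t Ht; destruct (classic (t = q)) as [->|Nt]; [exact G0 | apply Pz; assumption].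
    - generalize (Cmod_real_shift s q tau); lra. }
  rewrite <- HE in Gs by (auto; lra).
  assert (Hp : ((s - tau) ^ M)%C <> 0) by (apply Cpow_nz, Cminus_eq_contra, Hs).
  destruct (classic (E s = 0)) as [E0|E0]; [exact E0|].
  exfalso; apply (Cmult_neq_0 _ _ Hp E0), Gs.
Qed.

Lemma zero_near_neighbours E (tau : R) : zero_near E tau ->
  exists d, 0 < d /\ forall t : R, Rabs (t - tau) < d -> zero_near E t.
Proof.
  intros (d & Hd & H); exists d; split; [exact Hd|]; intros t Ht.
  destruct (Req_dec t tau) as [->|Nt]; [exists d; auto|].
  set (r := Rmin (Rabs (t - tau)) (d - Rabs (t - tau))).
  assert (P : 0 < Rabs (t - tau)) by (apply Rabs_pos_lt; lra).
  exists r; split; [apply Rmin_pos; lra|]; intros s Hs Hsr.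
  assert (S1 : Cmod (s - t) < Rabs (t - tau)) by (eapply Rlt_le_trans; [exact Hsr | apply Rmin_l]).
  assert (S2 : Cmod (s - t) < d - Rabs (t - tau)) by (eapply Rlt_le_trans; [exact Hsr | apply Rmin_r]).
  apply H.
  - intros ->; rewrite <- RtoC_minus, Cmod_R, Rabs_minus_sym in S1; lra.
  - generalize (Cmod_real_shift s tau t); lra.
Qed.

(** Connectedness of the ray: the infimum of the points reached from the right is attained by
    [zero_near_step] and, unless it is [x0], passed by [zero_near_neighbours]. The set [A] lives in
    negated coordinates so that this infimum is a supremum. *)
Theorem zero_near_continuation E (x0 sigma : R) :
  (forall t : R, x0 <= t -> meromorphic_germ E t) ->
  (forall s, sigma < Re s -> E s = 0) -> zero_near E x0.
Proof.
  intros Hm Hs.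
  set (A := fun x => x <= - x0 /\ forall t : R, - x < t -> zero_near E t).
  destruct (completeness A) as [m [Hm1 Hm2]].
  - exists (- x0); intros x [Hx _]; exact Hx.
  - exists (- (Rmax x0 sigma)); split; [generalize (Rmax_l x0 sigma); lra|].
    intros t Ht; rewrite Ropp_involutive in Ht.
    assert (Ht2 : sigma < t) by (generalize (Rmax_r x0 sigma); lra).
    exists (t - sigma); split; [lra|]; intros s _ Hsd; apply Hs.
    assert (R1 := re_le_Cmod (s - t)); apply Rabs_le_between in R1.
    change (Re (s - t)) with (Re s + - t) in R1; lra.
  - assert (Hmx : m <= - x0) by (apply Hm2; intros x [Hx _]; exact Hx).
    assert (Hr : forall t : R, - m < t -> zero_near E t).
    { intros t Ht; destruct (classic (exists x, A x /\ - x < t)) as [(x & [_ Ax] & Hx)|No];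
        [apply Ax, Hx|].
      exfalso; assert (m <= - t); [|lra].
      apply Hm2; intros x Ax; destruct (Rle_lt_dec x (- t)) as [L|L]; [exact L|].
      exfalso; apply No; exists x; split; [exact Ax | lra]. }
    assert (Z : zero_near E (- m)%R) by (apply zero_near_step; [apply Hm; lra | exact Hr]).
    destruct (Req_dec m (- x0)) as [->|N]; [rewrite Ropp_involutive in Z; exact Z|].
    exfalso; destruct (zero_near_neighbours E (- m) Z) as (d & Hd & H).
    set (x := Rmin (- x0) (m + d / 2)).
    assert (X1 : x <= - x0) by apply Rmin_l; assert (X2 : x <= m + d / 2) by apply Rmin_r.
    assert (X3 : m < x) by (unfold x; apply Rmin_glb_lt; lra).
    assert (x <= m); [|lra].
    apply Hm1; split; [exact X1|]; intros t Ht.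
    destruct (Rlt_le_dec (- m) t) as [L|L]; [apply Hr, L|].
    apply H, Rabs_def1; lra.
Qed.

(** * Residues *)

Lemma linear_bound_zero (s0 x : C) (K d : R) : 0 < d ->
  (forall s, s <> s0 -> Cmod (s - s0) < d -> Cmod x <= Cmod (s - s0) * K) -> x = 0.
Proof.
  intros Hd H; apply Cmod_eq_0, (small_nonneg_eq_0 _ (d * K)); [apply Cmod_ge_0|].
  intros n; destruct n as [|n].
  - simpl; rewrite Rmult_0_r.
    assert (P : Cmod (s0 + (d / 2)%R - s0) = d / 2).
    { replace (s0 + (d / 2)%R - s0)%C with (RtoC (d / 2)) by ring.
      rewrite Cmod_R, Rabs_right; lra. }
    assert (Q := H (s0 + (d / 2)%R)%C).
    rewrite P in Q; generalize (Cmod_ge_0 x); intros C0.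
    assert (Cmod x <= d / 2 * K); [|lra]; apply Q; [|lra].
    intros E; assert (E' := f_equal (fun z => (z - s0)%C) E); cbv beta in E'.
    apply (f_equal Cmod) in E'; rewrite P in E'.
    replace (s0 - s0)%C with (RtoC 0) in E' by ring; rewrite Cmod_0 in E'; lra.
  - assert (Hn : 1 <= INR (S n)) by (apply (le_INR 1); lia).
    set (y := d / (2 * INR (S n))).
    assert (Hy : 0 < y) by (apply Rdiv_lt_0_compat; lra).
    assert (Hyd : y < d).
    { apply Rmult_lt_reg_r with (2 * INR (S n)); [lra|]; unfold y, Rdiv.
      rewrite Rmult_assoc, Rinv_l by lra; nra. }
    assert (P : Cmod (s0 + y - s0) = y).
    { replace (s0 + y - s0)%C with (RtoC y) by ring; rewrite Cmod_R, Rabs_right; lra. }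
    assert (Q := H (s0 + y)%C); rewrite P in Q.
    assert (Q2 : Cmod x <= y * K).
    { apply Q; [|exact Hyd]; intros E.
      assert (E' := f_equal (fun z => Cmod (z - s0)) E); cbv beta in E'; rewrite P in E'.
      replace (s0 - s0)%C with (RtoC 0) in E' by ring; rewrite Cmod_0 in E'; lra. }
    apply Rle_trans with (y * K * INR (S n)); [apply Rmult_le_compat_r; lra|].
    replace (y * K * INR (S n)) with (d * K / 2) by (unfold y; field; lra).
    assert (0 <= y * K) by (generalize (Cmod_ge_0 x); lra).
    assert (0 <= K) by (apply Rmult_le_reg_l with y; lra); nra.
Qed.

(** Put $z=s-s_0$. Multiplying by the highest power of z exhibits the top coefficient as a
    difference of two terms of order $|z|$, so it is 0; the shorter sum is then still bounded by B,
    and the induction descends. *)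
Lemma bounded_principal_part (s0 : C) (d B : R) : 0 < d -> forall (m : nat) (c : nat -> C),
  (forall s, s <> s0 -> Cmod (s - s0) < d ->
     Cmod (sum_n (fun j => c j / (s - s0) ^ S j)%C m) <= B) -> c O = 0.
Proof.
  intros Hd m; induction m as [|m IH]; intros c H.
  - apply (linear_bound_zero s0 _ B d Hd); intros s Hs Hsd; specialize (H s Hs Hsd).
    assert (Hz : (s - s0)%C <> 0) by (apply Cminus_eq_contra, Hs).
    rewrite sum_O in H.
    replace (c O) with ((s - s0) * (c O / (s - s0) ^ 1))%C by (simpl; field; exact Hz).
    rewrite Cmod_mult; apply Rmult_le_compat_l; [apply Cmod_ge_0 | exact H].
  - assert (T : c (S m) = 0).
    { apply (linear_bound_zero s0 _ (B + sum_n (fun j => Cmod (c j)) m) (Rmin d 1));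
        [apply Rmin_pos; lra|].
      intros s Hs Hsd.
      assert (S1 : Cmod (s - s0) < d) by (eapply Rlt_le_trans; [exact Hsd | apply Rmin_l]).
      assert (S2 : Cmod (s - s0) < 1) by (eapply Rlt_le_trans; [exact Hsd | apply Rmin_r]).
      specialize (H s Hs S1); rewrite sum_n_S_C in H.
      assert (Hz : (s - s0)%C <> 0) by (apply Cminus_eq_contra, Hs).
      set (z := (s - s0)%C) in *; assert (Z0 := Cmod_ge_0 z).
      set (Sm := sum_n (fun j => c j / z ^ S j)%C m) in *.
      assert (E : c (S m) = (z ^ S (S m) * (Sm + c (S m) / z ^ S (S m)) - z ^ S (S m) * Sm)%C)
        by (field; apply Cpow_nz, Hz).
      assert (Pw : forall i, Cmod (z ^ S i) <= Cmod z).
      { intros i; rewrite Cmod_pow; apply Rle_trans with (Cmod z * 1); [|lra].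
        simpl; apply Rmult_le_compat_l; [exact Z0|]; rewrite <- (pow1 i); apply pow_incr; lra. }
      assert (U1 : Cmod (z ^ S (S m) * (Sm + c (S m) / z ^ S (S m))) <= Cmod z * B).
      { rewrite Cmod_mult; apply Rmult_le_compat; try apply Cmod_ge_0; [apply Pw | exact H]. }
      assert (U2 : Cmod (z ^ S (S m) * Sm) <= Cmod z * sum_n (fun j => Cmod (c j)) m).
      { unfold Sm; rewrite sum_n_Cmult_l; eapply Rle_trans; [apply Cmod_sum_n|].
        rewrite sum_n_scal_R; apply sum_n_le_R; intros i Hi.
        replace (z ^ S (S m) * (c i / z ^ S i))%C with (z ^ S (m - i) * c i)%C.
        - rewrite Cmod_mult; apply Rmult_le_compat_r; [apply Cmod_ge_0 | apply Pw].
        - replace (S (S m)) with (S (m - i) + S i)%nat by lia; rewrite Cpow_add_r.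
          field; apply Cpow_nz, Hz. }
      rewrite E; eapply Rle_trans; [apply Cmod_minus_le|].
      rewrite Rmult_plus_distr_l; apply Rplus_le_compat; assumption. }
    apply IH; intros s Hs Hsd; specialize (H s Hs Hsd); rewrite sum_n_S_C, T in H.
    replace (0 / (s - s0) ^ S (S m))%C with (RtoC 0) in H by (unfold Cdiv; ring).
    rewrite Cplus_0_r in H; exact H.
Qed.

(** Padding with zeros brings two principal parts to the common length m1 + m2, where they can be
    added coefficientwise. *)
Lemma principal_part_pad (c : nat -> C) (z : C) (m d : nat) :
  sum_n (fun j => (if Nat.leb j m then c j else 0) / z ^ S j)%C (m + d) =
  sum_n (fun j => c j / z ^ S j)%C m.
Proof.
  induction d as [|d IH].
  - rewrite Nat.add_0_r; apply sum_n_ext_loc; intros j Hj.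
    rewrite (proj2 (Nat.leb_le j m) Hj); reflexivity.
  - rewrite Nat.add_succ_r, sum_n_S_C, IH.
    rewrite (proj2 (Nat.leb_gt (S (m + d)) m)) by lia.
    unfold Cdiv; rewrite Cmult_0_l; apply Cplus_0_r.
Qed.

Lemma cdiff_bounded (f : C -> C) (s : C) : cdiff f s ->
  exists B d, 0 < d /\ forall t, Cmod (t - s) < d -> Cmod (f t) <= B.
Proof.
  intros H; destruct (cdiff_continuous f s H 1 Rlt_0_1) as (d & Hd & K).
  exists (Cmod (f s) + 1), d; split; [exact Hd|]; intros t Ht; specialize (K t Ht).
  generalize (Cmod_triangle_sub (f t) (f s)); lra.
Qed.

Lemma holomorphic_at_cdiff h s : holomorphic_at h s -> cdiff h s.
Proof.
  intros H; apply ex_derive_cdiff; destruct (locally_disc s _ H) as (d & Hd & K).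
  apply K; replace (s - s)%C with (RtoC 0) by ring; rewrite Cmod_0; exact Hd.
Qed.

(** Near [s0] the two principal parts add up to [H s - h1 s - h2 s], which is bounded; hence the
    first coefficient of their sum is 0. *)
Lemma residues_opposite (F1 F2 H : C -> C) (s0 r1 r2 : C) :
  is_residue F1 s0 r1 -> is_residue F2 s0 r2 -> cdiff H s0 ->
  zero_near (fun s => F1 s + F2 s - H s)%C s0 -> r1 = (- r2)%C.
Proof.
  intros (m1 & c1 & (h1 & Hh1 & P1) & <-) (m2 & c2 & (h2 & Hh2 & P2) & <-) HH (d0 & Hd0 & Z).
  destruct (locally'_disc s0 _ P1) as (d1 & Hd1 & E1).
  destruct (locally'_disc s0 _ P2) as (d2 & Hd2 & E2).
  destruct (cdiff_bounded h1 s0 (holomorphic_at_cdiff _ _ Hh1)) as (B3 & d3 & Hd3 & E3).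
  destruct (cdiff_bounded h2 s0 (holomorphic_at_cdiff _ _ Hh2)) as (B4 & d4 & Hd4 & E4).
  destruct (cdiff_bounded H s0 HH) as (B5 & d5 & Hd5 & E5).
  set (pad := fun (c : nat -> C) m j => if Nat.leb j m then c j else RtoC 0).
  assert (K : (pad c1 m1 O + pad c2 m2 O)%C = 0).
  { set (d := Rmin d0 (Rmin d1 (Rmin d2 (Rmin d3 (Rmin d4 d5))))).
    apply (bounded_principal_part s0 d (B5 + B3 + B4)) with (m := (m1 + m2)%nat)
      (c := fun j => (pad c1 m1 j + pad c2 m2 j)%C).
    - repeat apply Rmin_pos; assumption.
    - intros s Hs Hsd.
      assert (D : Cmod (s - s0) < d0 /\ Cmod (s - s0) < d1 /\ Cmod (s - s0) < d2 /\
        Cmod (s - s0) < d3 /\ Cmod (s - s0) < d4 /\ Cmod (s - s0) < d5).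
      { unfold d in Hsd; repeat (apply Rmin_Rgt in Hsd; destruct Hsd as [? Hsd]); lra. }
      destruct D as (D0 & D1 & D2 & D3 & D4 & D5).
      specialize (Z s Hs D0); cbv beta in Z; rewrite (E1 s Hs D1), (E2 s Hs D2) in Z.
      specialize (E3 s D3); specialize (E4 s D4); specialize (E5 s D5).
      rewrite (sum_n_ext _ (fun j => pad c1 m1 j / (s - s0) ^ S j +
         1 * (pad c2 m2 j / (s - s0) ^ S j))%C).
      2:{ intros j; match goal with |- ?x = ?y => change (@eq C x y) end; unfold Cdiv; ring. }
      rewrite <- sum_n_plus_scal; unfold pad.
      rewrite principal_part_pad, (Nat.add_comm m1 m2), principal_part_pad.
      set (S1 := sum_n _ m1) in *; set (S2 := sum_n _ m2) in *.
      replace (S1 + 1 * S2)%C with ((S1 + h1 s + (S2 + h2 s) - H s) + (H s - h1 s - h2 s))%C by ring.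
      rewrite Z, Cplus_0_l.
      eapply Rle_trans; [apply Cmod_minus_le|].
      generalize (Cmod_minus_le (H s) (h1 s)); lra. }
  unfold pad in K; simpl in K.
  replace (c1 O) with ((c1 O + c2 O) + - c2 O)%C by ring; rewrite K; ring.
Qed.

(** * Assembling the residue identity *)

Lemma div_Zcpow (x w : C) (i : nat) :
  (x / Zcpow (Z.of_nat (S i)) w)%C = (x * npow w (ln (INR (S i))))%C.
Proof.
  unfold Cdiv, Zcpow, npow; rewrite <- Cexp_opp, <- INR_IZR_INZ.
  f_equal; f_equal; ring.
Qed.

(** The inequality $|A\bar B|\le|A|^2+|B|^2$ reduces the product to the two second moments; their
    exponent [S kappa] makes the threshold $(\kappa+1)/2=k+1/2$. *)
Lemma product_bound kappa G chi f g a b (beta : R) :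
  congruence_subgroup G -> nebentypus G chi ->
  cusp_form kappa G chi f -> cusp_form kappa G chi g ->
  fourier_expansion 1 f a -> fourier_expansion 1 g b -> INR (S kappa) / 2 < beta ->
  exists K, forall L, sum_n (fun i => Cmod (psum a i * Cconj (psum b i)) *
                              exp (- (beta * ln (INR (S i))))) L <= K.
Proof.
  intros HG Hchi Hf Hg Ha Hb Hbeta.
  assert (Hc : forall n, Cmod (chi n) <= 1) by (intros n; apply (Cmod_nebentypus G), Hchi).
  destruct (second_moment kappa G chi f a HG Hc Hf Ha) as (K1 & HK1 & H1).
  destruct (second_moment kappa G chi g b HG Hc Hg Hb) as (K2 & HK2 & H2).
  destruct (dirichlet_abs_bound (fun i => Cmod (psum a i * Cconj (psum b i))) (K1 + K2)
              beta (S kappa)) as (K & _ & HK).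
  - intros i; apply Cmod_ge_0.
  - lra.
  - exact Hbeta.
  - intros y L Hy; specialize (H1 y L Hy); specialize (H2 y L Hy).
    apply Rle_trans with
      (sum_n (fun i => plus (Cmod (psum a i) ^ 2 * exp (- (4 * PI * y)) ^ S i)
                            (Cmod (psum b i) ^ 2 * exp (- (4 * PI * y)) ^ S i)) L).
    + apply sum_n_le_R; intros i _; unfold plus; simpl AbelianMonoid.plus.
      rewrite Cmod_mult, Cmod_conj.
      assert (E : 0 < exp (- (4 * PI * y)) ^ S i) by (apply pow_lt, exp_pos).
      set (E' := exp (- (4 * PI * y)) ^ S i) in *.
      set (p := Cmod (psum a i)); set (q := Cmod (psum b i)).
      change (p * q * E' <= p ^ 2 * E' + q ^ 2 * E').
      assert (p * q <= p ^ 2 + q ^ 2); [|nra].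
      generalize (pow2_ge_0 (p - q)) (pow2_ge_0 p) (pow2_ge_0 q); simpl; lra.
    + rewrite sum_n_plus; unfold plus; simpl.
      unfold Rdiv in *; rewrite Rmult_plus_distr_r; apply Rplus_le_compat; assumption.
  - exists K; exact HK.
Qed.

Theorem theorem6p1
  (Gamma : mat2 -> Prop) (chi : Z -> C) (k : R) (kappa : nat)
  (f g : C -> C) (a b : Z -> C)
  (hGamma : congruence_subgroup Gamma)
  (hchi : nebentypus Gamma chi)
  (hkappa : k = INR kappa / 2)
  (hk : 2 < k)
  (* the theta multiplier of half-integral weight lives on Gamma0(4) *)
  (hGamma4 : Nat.Odd kappa -> forall x, Gamma x -> Gamma0 4 x)
  (hf : cusp_form kappa Gamma chi f)
  (hg : cusp_form kappa Gamma chi g)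
  (ha : fourier_expansion 1 f a) (ha0 : forall n, (n <= 0)%Z -> a n = 0)
  (hb : fourier_expansion 1 g b) (hb0 : forall n, (n <= 0)%Z -> b n = 0) :
  forall (D1 D2 : C -> C) (r1 r2 : C),
    meromorphic_continuation
      (fun s => is_series (fun i : nat =>
         let n := Z.of_nat (S i) in
         (a n * Cconj (b n) / Zcpow n (s + k - 1))%C)) D1 ->
    meromorphic_continuation
      (fun s => is_double_series (fun i j : nat =>
         let n := Z.of_nat (S i) in
         let h := Z.of_nat (S j) in
         ((a n * Cconj (b (n - h)%Z) + a (n - h)%Z * Cconj (b n))
            / Zcpow n (s + k - 1))%C)) D2 ->
    is_residue D1 1 r1 ->
    is_residue D2 1 r2 ->
    r1 = (- r2)%C.
Proof.
  intros D1 D2 r1 r2 (U1 & _ & U11 & U1r & M1 & sig1 & S1) (U2 & _ & U21 & U2r & M2 & sig2 & S2)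
    R1 R2.
  (* [product_bound] requires more than k + 1/2, and holomorphy at s = 1, where w = k, requires
     [beta - 7 / 8 < k]; so 5/8 is a choice between 1/2 and 7/8. It makes [H] holomorphic for Re s >
     3/4. *)
  set (beta := k + 5 / 8).
  destruct (product_bound kappa Gamma chi f g a b beta hGamma hchi hf hg ha hb) as [K HK].
  { unfold beta; rewrite S_INR; lra. }
  set (c := fun i => (psum a i * Cconj (psum b i))%C).
  set (H := fun s : C => abel_sum c (s + k - 1)%C).
  assert (Hb1 : 1 <= beta) by (unfold beta; lra).
  assert (Rew : forall s : C, Re (s + k - 1) = Re s + k - 1)
    by (intros s; unfold Re; simpl; ring).
  assert (HH : forall s : C, 3 / 4 < Re s -> cdiff H s).
  { intros s Hs; apply (cdiff_comp (abel_sum c) (fun s => s + k - 1)%C).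
    - apply (abel_sum_cdiff c beta K Hb1 HK); rewrite Rew; unfold beta; lra.
    - apply cdiff_minus; [apply cdiff_plus; [apply cdiff_id|]|]; apply cdiff_const. }
  apply (residues_opposite D1 D2 H 1); [exact R1 | exact R2 | apply HH; simpl; lra |].
  (* The 3 comes from [abel_sum_eq], which needs Re w at least [beta + 1], that is, Re s at least 2
     + 5/8. *)
  apply (zero_near_continuation _ 1 (Rmax 3 (Rmax sig1 sig2))).
  - intros t Ht; apply meromorphic_germ_combine.
    + apply meromorphic_at_germ, M1; destruct (Req_dec t 1) as [->|N]; [exact U11 | apply U1r; simpl; lra].
    + apply meromorphic_at_germ, M2; destruct (Req_dec t 1) as [->|N]; [exact U21 | apply U2r; simpl; lra].
    (* Since t is at least 1, a disc of radius 1/4 about it stays in Re s > 3/4. *)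
    + exists (/ 4); split; [lra|]; intros s Hs; apply HH.
      assert (T := re_le_Cmod (s - t)); apply Rabs_le_between in T.
      change (Re (s - t)) with (Re s + - t) in T; lra.
  - intros s Hs.
    assert (L1 := Rmax_l 3 (Rmax sig1 sig2)); assert (L2 := Rmax_r 3 (Rmax sig1 sig2)).
    assert (L3 := Rmax_l sig1 sig2); assert (L4 := Rmax_r sig1 sig2).
    assert (A1 := S1 s ltac:(lra)); apply is_series_clim in A1.
    destruct (S2 s ltac:(lra)) as [_ A2]; apply filterlim_clim in A2.
    assert (A3 : clim (sum_n (fun i => delta c i * npow (s + k - 1) (ln (INR (S i))))%C) (H s)).
    { apply (abel_sum_eq c beta K Hb1 HK); rewrite Rew; unfold beta; lra. }
    (* The nth partial sum of the first series and the nth square sum of the second add up exactly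
       to the nth partial sum of the [delta] series, so uniqueness of limits identifies D1 + D2 with
       [H]. *)
    assert (A12 := clim_plus_scal _ _ _ _ 1 A1 A2).
    apply (clim_ext _ (sum_n (fun i => delta c i * npow (s + k - 1) (ln (INR (S i))))%C)) in A12.
    + rewrite (clim_unique _ _ _ A3 A12); ring.
    + intros n; cbv beta.
      rewrite (sum_n_ext_loc (fun i => sum_n _ n) (fun i =>
        ((a (Z.of_nat (S i)) * Cconj (psum_pred b i) + psum_pred a i * Cconj (b (Z.of_nat (S i))))
           / Zcpow (Z.of_nat (S i)) (s + k - 1))%C)).
      2:{ intros i Hi; apply (shifted_convolution_sum a b _ ha0 hb0 i n Hi). }
      rewrite sum_n_plus_scal; apply sum_n_ext; intros i; cbv zeta.
      rewrite !div_Zcpow; unfold c; rewrite delta_product.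
      match goal with |- ?x = ?y => change (@eq C x y) end; ring.
Qed.
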